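(* Let $r,s\ge 1$, let $n_1,\dots,n_r,n_{r+1},\dots,n_{r+s}$ be positive integers, $p=n_1+\cdots+n_r$, $q=n_{r+1}+\cdots+n_{r+s}$, and \[ N=\{n_1,\;n_1+n_2,\;\dots,\;n_1+\cdots+n_{r+s}\}\subset[p+q]. \] Let $(\mathcal A,\phi,\phi_2)$ be a second order probability space with first order cumulants $(\kappa_n)_n$ and second order cumulants $(\kappa_{m,n})_{m,n}$, and let $a_1,\dots,a_{p+q}\in\mathcal A$. Let $A_1=a_1\cdots a_{n_1}$, $A_2=a_{n_1+1}\cdots a_{n_1+n_2}$, $\dots$, $A_{r+s}=a_{n_1+\cdots+n_{r+s-1}+1}\cdots a_{n_1+\cdots+n_{r+s}}$. Then \[ \kappa_{r,s}(A_1,\dots,A_r,A_{r+1},\dots,A_{r+s})=\sum_{(\mathcal V,\pi)}\kappa_{(\mathcal V,\pi)}(a_1,\dots,a_{p+q}), \] where the sum is over those $(\mathcal V,\pi)\in\mathcal{PS}_{NC}(p,q)$ such that $\pi^{-1}\gamma_{p,q}$ separates the points of $N$.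
   Context: Permutations. $[n]=\{1,\dots,n\}$; $\#(\pi)$ is the number of cycles of a permutation $\pi$ (fixed points included); products of permutations are compositions. $\gamma_n=(1,2,\dots,n)$ and $\gamma_{p,q}=(1,\dots,p)(p+1,\dots,p+q)\in S_{p+q}$. $NC(n)$ is the set of non-crossing partitions of $[n]$, identified with the permutations whose cycles are the blocks listed in increasing order; equivalently the $\pi\in S_n$ with $\#(\pi)+\#(\pi^{-1}\gamma_n)+1=n+2$. $NC(p)\times NC(q)$ is the set of permutations $\pi=\pi_1\times\pi_2\in S_{p+q}$ with $\pi_1$ a non-crossing permutation of $[p]$ and $\pi_2$ one of $[p+1,p+q]=\{p+1,\dots,p+q\}$. $S_{NC}(p,q)$ is the set of $\pi\in S_{p+q}$ such that some cycle of $\pi$ meets both $[p]$ and $[p+1,p+q]$ and $\#(\pi)+\#(\pi^{-1}\gamma_{p,q})+\#(\gamma_{p,q})=p+q+2$. A permutation separates the points of a set $N$ if no two distinct points of $N$ lie in the same cycle. Partitioned permutations. A partitioned permutation of $[n]$ is a pair $(\mathcal V,\pi)$ with $\mathcal V$ a partition of $[n]$, $\pi\in S_n$ and every cycle of $\pi$ contained in a block of $\mathcal V$. $0_\pi$ is the partition whose blocks are the cycles of $\pi$; $\pi\in S_{NC}(p,q)$ is identified with $(0_\pi,\pi)$. $\mathcal{PS}_{NC}(p,q)'$ is the set of partitioned permutations $(\mathcal V,\pi)$ with $\pi=\pi_1\times\pi_2\in NC(p)\times NC(q)$ such that every block of $\mathcal V$ except one contains exactly one cycle of $\pi$, and the exceptional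 block contains exactly two cycles of $\pi$, one of $\pi_1$ and one of $\pi_2$. $\mathcal{PS}_{NC}(p,q)=S_{NC}(p,q)\cup\mathcal{PS}_{NC}(p,q)'$. Second order probability space: a triple $(\mathcal A,\phi,\phi_2)$ with $\mathcal A$ a unital algebra over $\mathbb C$, $\phi:\mathcal A\to\mathbb C$ a tracial linear functional with $\phi(1)=1$, and $\phi_2:\mathcal A\times\mathcal A\to\mathbb C$ a symmetric bilinear function, tracial in each variable, with $\phi_2(1,a)=\phi_2(a,1)=0$ for all $a$. Cumulants. The multilinear functionals $\kappa_n$ are defined recursively by $\phi(a_1\cdots a_n)=\sum_{\pi\in NC(n)}\kappa_\pi(a_1,\dots,a_n)$, and then the $(p+q)$-linear functionals $\kappa_{p,q}$ are defined recursively by $\phi_2(a_1\cdots a_p,a_{p+1}\cdots a_{p+q})=\sum_{(\mathcal V,\pi)\in\mathcal{PS}_{NC}(p,q)}\kappa_{(\mathcal V,\pi)}(a_1,\dots,a_{p+q})$. Here $\kappa_\pi=\prod_c\kappa_c$ over the cycles $c=(i_1,\dots,i_m)$ of $\pi$, with $\kappa_c(a_1,\dots)=\kappa_m(a_{i_1},\dots,a_{i_m})$ (well defined since $\kappa_m$ is invariant under cyclic permutation of its arguments), and $\kappa_{(\mathcal V,\pi)}=\prod_{V\in\mathcal V}\kappa_V$, where $\kappa_V=\kappa_c$ if $V$ contains one cycle $c$ of $\pi$, and $\kappa_V(a_1,\dots)=\kappa_{m,l}(a_{i_1},\dots,a_{i_m},a_{j_1},\dots,a_{j_l})$ if $V$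 contains two cycles, $(i_1,\dots,i_m)$ in $[p]$ and $(j_1,\dots,j_l)$ in $[p+1,p+q]$. *)

(* Defs.v *)
From HB Require Import structures.
From mathcomp Require Import all_boot all_order all_fingroup all_algebra.
From mathcomp Require Import reals.
From mathcomp.real_closed Require Import complex.

Set Implicit Arguments.
Unset Strict Implicit.
Unset Printing Implicit Defensive.

Import GRing.Theory.

Local Open Scope ring_scope.

(* The set [n] = {1, ..., n} is 'I_n = {0, ..., n-1}.  In 'I_(p + q), [p] is the
   image of lshift q and [p+1, p+q] the image of rshift p.

   Products of permutations are compositions, (s t)(x) = s (t x), whereas
   MathComp has (s * t) x = t (s x): pi^-1 gamma is written
   (gamma * pi^-1)%g below. *)

Section Permutations.

Definition ncycles n (s : 'S_n) : nat := #|porbits s|.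

Definition gamma n : 'S_n := perm (@ordS_inj n).

Definition prod_perm_fun p q (s : 'S_p) (t : 'S_q) (i : 'I_(p + q)) :
    'I_(p + q) :=
  match split i with
  | inl j => lshift q (s j)
  | inr k => rshift p (t k)
  end.

Lemma prod_perm_inj p q (s : 'S_p) (t : 'S_q) : injective (prod_perm_fun s t).
Proof.
move=> i i'; rewrite /prod_perm_fun => E.
rewrite -(splitK i) -(splitK i'); move: E.
case: (split i) => j; case: (split i') => k /=.
- by move/lshift_inj/perm_inj => ->.
- by move/eqP; rewrite eq_lrshift.
- by move/eqP; rewrite eq_rlshift.
- by move/rshift_inj/perm_inj => ->.
Qed.

(* pi_1 x pi_2 *)
Definition prod_perm p q (s : 'S_p) (t : 'S_q) : 'S_(p + q) :=
  perm (@prod_perm_inj p q s t).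

Definition gamma2 p q : 'S_(p + q) := prod_perm (gamma p) (gamma q).

Definition noncrossing n (P : {set {set 'I_n}}) : bool :=
  [forall B in P, forall C in P, (B != C) ==>
    ~~ [exists i in B, exists j in C, exists k in B, exists l in C,
          (i < j < k)%N && (k < l)%N]].

(* Non-crossing permutations: the cycles form a non-crossing partition and each
   of them lists its elements in increasing order (enum is increasing on 'I_n,
   and next is the cyclic successor in a list). *)
Definition NC n : {set 'S_n} :=
  [set s : 'S_n | noncrossing (porbits s)
                  && [forall i, s i == next (enum (porbit s i)) i]].

Definition NCxNC p q : {set 'S_(p + q)} :=
  [set prod_perm s t | s in NC p, t in NC q].

Definition left_part p q : {set 'I_(p + q)} := [set lshift q i | i : 'I_p].
Definition right_part p q : {set 'I_(p + q)} := [set rshift p j | j : 'I_q].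

Definition SNC p q : {set 'S_(p + q)} :=
  [set s : 'S_(p + q) |
    [exists c in porbits s,
       (c :&: left_part p q != set0) && (c :&: right_part p q != set0)]
    && (ncycles s + ncycles (gamma2 p q * s^-1)%g + ncycles (gamma2 p q)
        == p + q + 2)%N].

Definition separates n (s : 'S_n) (N : {set 'I_n}) : bool :=
  [forall x in N, forall y in N, (x != y) ==> (y \notin porbit s x)].

End Permutations.

Section PartitionedPermutations.

Definition is_partitioned_perm n (x : {set {set 'I_n}} * 'S_n) : bool :=
  partition x.1 [set: 'I_n]
  && [forall c in porbits x.2, exists V in x.1, c \subset V].

Definition cycles_in n (s : 'S_n) (V : {set 'I_n}) : {set {set 'I_n}} :=
  [set c in porbits s | c \subset V].

Definition PSNC' p q : {set {set {set 'I_(p + q)}} * 'S_(p + q)} :=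
  [set x | [&& is_partitioned_perm x, x.2 \in NCxNC p q &
    [exists W in x.1,
       [exists c in porbits x.2, exists d in porbits x.2,
          [&& c \subset left_part p q, d \subset right_part p q &
              cycles_in x.2 W == [set c; d]]]
       && [forall V in x.1, (V != W) ==> (#|cycles_in x.2 V| == 1%N)]]]].

(* s in SNC p q is identified with (0_s, s), and 0_s = porbits s. *)
Definition PSNC p q : {set {set {set 'I_(p + q)}} * 'S_(p + q)} :=
  [set (porbits s, s) | s in SNC p q] :|: PSNC' p q.

End PartitionedPermutations.

Record second_order_space (R : realType) (A : algType R[i])
    (phi : A -> R[i]) (phi2 : A -> A -> R[i]) : Prop := SecondOrderSpace {
  phi_linear : scalar phi;
  phi_tracial : forall a b, phi (a * b) = phi (b * a);
  phi_unit : phi 1 = 1;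
  phi2_linear_l : forall b, scalar (phi2^~ b);
  phi2_linear_r : forall a, scalar (phi2 a);
  phi2_symmetric : forall a b, phi2 a b = phi2 b a;
  phi2_tracial_l : forall a b c, phi2 (a * b) c = phi2 (b * a) c;
  phi2_tracial_r : forall a b c, phi2 c (a * b) = phi2 c (b * a);
  phi2_unit_l : forall a, phi2 1 a = 0;
  phi2_unit_r : forall a, phi2 a 1 = 0 }.

Section Cumulants.

Variables (R : realType) (A : algType R[i]).

(* Families of functionals are indexed by argument lists:
     kappa_n(a_1, ..., a_n) = k1 [:: a_1; ...; a_n],
     kappa_{m,l}(a_1, ..., a_m, b_1, ..., b_l)
       = k2 [:: a_1; ...; a_m] [:: b_1; ...; b_l]. *)
Variables (k1 : seq A -> R[i]) (k2 : seq A -> seq A -> R[i]).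

(* The arguments a_{i_1}, ..., a_{i_m} along the cycle c = (i_1, ..., i_m) of s,
   where i_1 is the least element of c. *)
Definition cycle_args n (a : 'I_n -> A) (s : 'S_n) (c : {set 'I_n}) : seq A :=
  if enum c is i :: _ then [seq a j | j <- traject s i #|c|] else [::].

Definition kappa_perm n (a : 'I_n -> A) (s : 'S_n) : R[i] :=
  \prod_(c in porbits s) k1 (cycle_args a s c).

(* Used on blocks with exactly one cycle, or with exactly two, one in [p] and
   one in [p+1, p+q]; each product then has a single factor. *)
Definition kappa_block p q (a : 'I_(p + q) -> A) (s : 'S_(p + q))
    (V : {set 'I_(p + q)}) : R[i] :=
  if #|cycles_in s V| == 1%N then
    \prod_(c in cycles_in s V) k1 (cycle_args a s c)
  else
    \prod_(c in cycles_in s V | c \subset left_part p q)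
    \prod_(d in cycles_in s V | d \subset right_part p q)
      k2 (cycle_args a s c) (cycle_args a s d).

Definition kappa_pp p q (a : 'I_(p + q) -> A)
    (x : {set {set 'I_(p + q)}} * 'S_(p + q)) : R[i] :=
  \prod_(V in x.1) kappa_block a x.2 V.

End Cumulants.

(* The two moment-cumulant relations determine the cumulants recursively: in the
   first, the summand for s = gamma n is k1 [:: a_1; ...; a_n] and the others
   involve only shorter argument lists; likewise in the second for the summand
   with one block and permutation gamma2 p q.  The value of k1 on [::] and of
   k2 on pairs containing [::] is irrelevant.  Multilinearity and invariance
   under cyclic permutation of the arguments are consequences. *)
Definition first_order_cumulants (R : realType) (A : algType R[i])
    (phi : A -> R[i]) (k1 : seq A -> R[i]) : Prop :=
  forall (n : nat) (a : 'I_n -> A), (0 < n)%N ->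
    phi (\prod_(i < n) a i) = \sum_(s in NC n) kappa_perm k1 a s.

Definition second_order_cumulants (R : realType) (A : algType R[i])
    (phi2 : A -> A -> R[i]) (k1 : seq A -> R[i])
    (k2 : seq A -> seq A -> R[i]) : Prop :=
  forall (p q : nat) (a : 'I_(p + q) -> A), (0 < p)%N -> (0 < q)%N ->
    phi2 (\prod_(i < p) a (lshift q i)) (\prod_(j < q) a (rshift p j))
    = \sum_(x in PSNC p q) kappa_pp k1 k2 a x.

Section Intervals.

Variables (r s : nat) (n : 'I_(r + s) -> nat).

Definition size_l : nat := (\sum_(i < r) n (lshift s i))%N.
Definition size_r : nat := (\sum_(j < s) n (rshift r j))%N.

(* n_1 + ... + n_{k-1} and n_1 + ... + n_k *)
Definition block_start (k : 'I_(r + s)) : nat :=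
  (\sum_(i < r + s | i < k) n i)%N.
Definition block_end (k : 'I_(r + s)) : nat :=
  (\sum_(i < r + s | i <= k) n i)%N.

(* N; the point n_1 + ... + n_k of [p+q] is the ordinal of value block_end k - 1. *)
Definition block_ends : {set 'I_(size_l + size_r)} :=
  [set j : 'I_(size_l + size_r) | [exists k, j.+1 == block_end k]].

Definition block_prod (A : pzRingType) (a : 'I_(size_l + size_r) -> A)
    (k : 'I_(r + s)) : A :=
  \prod_(j < size_l + size_r | (block_start k <= j < block_end k)%N) a j.

End Intervals.

(* Main.v *)
(* Write K = pi^-1 gamma and rl for the reflection length of a permutation.  The
   elements of NC(n) and of NC(p) x NC(q) are the pi with rl pi + rl K = rl gamma,
   those of S_NC(p,q) the pi that mix the two circles and have
   rl pi + rl K = rl gamma + 2; an element of PS_NC(p,q)' is such a pi of the first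
   kind with one marked cycle on each circle.

   The theorem is an iteration of the case where a single product is split.  Let i
   be a point that K fixes, so that pi(i) = gamma(i).  The pi' whose K' becomes K
   when i is erased from it are the pi (i j), and
   - if j is in the cycle of i, (i j) cuts this cycle in two;
   - if j is on the other circle, pi is in NC(p) x NC(q) and (i j) glues the cycle of
     i to that of j; the result is in S_NC(p,q).
   Comparing the moment-cumulant formulas for (..., x y, ...) and (..., x, y, ...)
   and cancelling by induction gives
     k1(x y, w) = k1(x, y, w) + sum of k1 k1 over the cuts,
     k2(x y, w | z) = k2(x, y, w | z) + sum of k1 k2 + k2 k1 over the cuts
                      + sum of k1 over the glueings of z.
   These identities hold at every position since k1 and k2 are invariant under
   rotations and k2 is symmetric.  Splitting one after the other all the products
   A_1, ..., A_(r+s) reaches exactly once each (V, pi) such that K separates N. *)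

From mathcomp Require Import all_boot all_order all_fingroup all_algebra.
From mathcomp Require Import zify ring.
From mathcomp Require Import reals.
From mathcomp.real_closed Require Import complex.
Require Import Defs.

Set Implicit Arguments.
Unset Strict Implicit.
Unset Printing Implicit Defensive.
Import GRing.Theory.

(** * Reflection length *)

(** Reflection length replaces the planar and annular pictures: a transposition of two distinct
    points changes it by exactly one, so cutting and glueing become arithmetic, and statements about
    geodesics follow by peeling transpositions off the complement. That [NC], defined by crossings
    and order, consists of geodesics is itself proved in this way.

    Erasing a point would change the ground set. Instead the type is kept, the erased point becomes
    a fixed point and a set [M] records the points left. As the moment-cumulant formulas are
    available on ordinals only, [ext] carries them along injections.

    The cancellation works because the difference of two moment-cumulant formulas is a weighted sum
    of defects of the wanted identity. All defects except that of the full cycles concern shorter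
    arguments and vanish by induction; hence the last one vanishes too.

    The cumulants are known only through the two relations, so their invariance under rotation has
    to be derived: again only the top term has arguments of full length, and the other terms are
    covered by induction. *)

Section ReflectionLength.

Variable T : finType.
Implicit Types (s t u g : {perm T}) (L X M : {set T}) (x y i j : T).

(* The group laws restated on [{perm T}]: rewriting with the generic ones leaves
   instances of the product that [lia] does not identify. *)
Lemma perm_mulA s t u : (s * (t * u) = s * t * u)%g. Proof. exact: mulgA. Qed.
Lemma perm_mul1g s : (1 * s = s)%g. Proof. exact: mul1g. Qed.
Lemma perm_invM s t : ((s * t)^-1 = t^-1 * s^-1)%g. Proof. exact: invMg. Qed.
Lemma tperm_mulK x y s : (tperm x y * (tperm x y * s) = s)%g.
Proof. by rewrite mulgA tperm2 mul1g. Qed.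
Lemma mul_tpermK x y s : (s * tperm x y * tperm x y = s)%g.
Proof. by rewrite -mulgA tperm2 mulg1. Qed.
Lemma perm_divK g s : (g * s^-1 * s = g)%g. Proof. exact: mulgKV. Qed.

Lemma mem_porbit_perm s x y : (s y \in porbit s x) = (y \in porbit s x).
Proof.
by rewrite -!eq_porbit_mem; have := porbit_perm s 1 y; rewrite expg1 => ->.
Qed.

Definition stable X s := [forall x, (s x \in X) == (x \in X)].

Lemma stableP X s : reflect (forall x, (s x \in X) = (x \in X)) (stable X s).
Proof. exact: 'forall_eqP. Qed.

Lemma stable_iter X s n x : stable X s -> ((s ^+ n)%g x \in X) = (x \in X).
Proof.
move=> /stableP sX; elim: n => [|n IH]; first by rewrite perm1.
by rewrite expgSr permM sX.
Qed.

Lemma stable_porbit X s x y :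
  stable X s -> y \in porbit s x -> (y \in X) = (x \in X).
Proof. by move=> sX /porbitP[n ->]; rewrite stable_iter. Qed.

Lemma stableM X s t : stable X s -> stable X t -> stable X (s * t)%g.
Proof.
by move=> /stableP sX /stableP tX; apply/stableP => x; rewrite permM tX sX.
Qed.

Lemma stableV X s : stable X s^-1%g = stable X s.
Proof.
apply/stableP/stableP => H x; last by rewrite -{2}(permKV s x) H.
by rewrite -{2}(permK s x) H.
Qed.

Lemma stable_tperm X x y : stable X (tperm x y) = ((x \in X) == (y \in X)).
Proof.
apply/stableP/eqP => [/(_ y)|H z]; first by rewrite tpermR.
by case: tpermP => // ->.
Qed.

Lemma stableMl X s t : stable X s -> stable X (s * t)%g = stable X t.
Proof.
move=> sX; apply/idP/idP => [H|]; last exact: stableM.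
by rewrite -(mulKg s t) stableM ?stableV.
Qed.

Lemma stableMr X s t : stable X s -> stable X (t * s)%g = stable X t.
Proof. by move=> sX; rewrite -stableV invMg stableMl ?stableV. Qed.

Lemma stableC X s : stable (~: X) s = stable X s.
Proof.
apply/stableP/stableP => H x; have := H x; rewrite !inE //.
- by move/negb_inj.
- by move=> ->.
Qed.

Definition rl s := #|T| - #|porbits s|.

Lemma leq_card_porbits s : #|porbits s| <= #|T|.
Proof. exact: leq_imset_card. Qed.

Lemma rl1 : rl 1%g = 0.
Proof.
apply/eqP; rewrite subn_eq0 /porbits card_imset // => x y E.
by have := porbit_id 1%g x; rewrite E => /porbitP[n ->]; rewrite expg1n perm1.
Qed.

Lemma rlV s : rl s^-1%g = rl s.
Proof. by rewrite /rl porbitsV. Qed.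

Lemma rl_tperm_in s i j : i != j -> i \in porbit s j ->
  rl s = (rl (tperm i j * s)%g).+1.
Proof.
move=> ij ins; have := porbits_mul_tperm s i j.
have := leq_card_porbits s; have := leq_card_porbits (tperm i j * s)%g.
by rewrite ij ins /rl /=; lia.
Qed.

Lemma rl_tperm_out s i j : i \notin porbit s j ->
  rl (tperm i j * s)%g = (rl s).+1.
Proof.
move=> nins; have ij : i != j by apply: contraNneq nins => ->; apply: porbit_id.
have := porbits_mul_tperm s i j.
have := leq_card_porbits s; have := leq_card_porbits (tperm i j * s)%g.
by rewrite ij nins /rl /=; lia.
Qed.

Lemma rl_mul_tpermV s i j : rl (s * tperm i j)%g = rl (tperm i j * s^-1)%g.
Proof. by rewrite -rlV perm_invM tpermV. Qed.

Lemma rl_mul_tperm_in s i j : i != j -> i \in porbit s j ->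
  rl s = (rl (s * tperm i j)%g).+1.
Proof.
by move=> ij ins; rewrite rl_mul_tpermV -rlV; apply: rl_tperm_in; rewrite // porbitV.
Qed.

Lemma rl_mul_tperm_out s i j : i \notin porbit s j ->
  rl (s * tperm i j)%g = (rl s).+1.
Proof.
by move=> ins; rewrite rl_mul_tpermV -[rl s]rlV; apply: rl_tperm_out; rewrite porbitV.
Qed.

Lemma rl_tperm_le s i j : rl (tperm i j * s)%g <= (rl s).+1.
Proof.
have [->|ij] := eqVneq i j; first by rewrite tperm1 mul1g.
have [/(rl_tperm_in ij)->|/rl_tperm_out-> //] := boolP (i \in porbit s j).
exact: leqW.
Qed.

Lemma rl_move s i : s i != i ->
  rl s = (rl (s * tperm i (s i))%g).+1.
Proof.
move=> si; apply: rl_mul_tperm_in; first by rewrite eq_sym.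
by rewrite porbit_sym mem_porbit_perm porbit_id.
Qed.

(** A moved point can be split off its cycle by a transposition, which shortens the permutation by
    one. Applied to a complement [g * s^-1], this induction walks from [s] to [g] one transposition
    at a time. *)
Lemma rl_ind (P : {perm T} -> Prop) : P 1%g ->
  (forall s i, s i != i -> rl s = (rl (s * tperm i (s i))%g).+1 ->
     P (s * tperm i (s i))%g -> P s) -> forall s, P s.
Proof.
move=> P1 Pstep s; have [m] := ubnP (rl s); elim: m s => // m IH s ltm.
have [->//|/eqP ns] := eqVneq s 1%g.
have [i si] : exists i, s i != i.
  apply/existsP; rewrite -negb_forall; apply/negP => /forallP H.
  by apply: ns; apply/permP => i; rewrite perm1; apply/eqP.
by have E := rl_move si; apply: (Pstep s i si E); apply: IH; rewrite E in ltm.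
Qed.

Lemma rlM s t : rl (s * t)%g <= rl s + rl t.
Proof.
elim/rl_ind: s t => [|s i si E IH] t; first by rewrite perm_mul1g rl1.
have := IH (tperm i (s i) * t)%g; rewrite -perm_mulA tperm_mulK.
by have := rl_tperm_le t i (s i); lia.
Qed.

(* The [s] on a geodesic from the identity to [g]. *)
Definition geo g : {set {perm T}} :=
  [set s | rl s + rl (g * s^-1)%g == rl g].

Lemma rl_triangle g s : rl g <= rl s + rl (g * s^-1)%g.
Proof. by rewrite addnC -{1}(perm_divK g s) rlM. Qed.

Lemma geo_id g : g \in geo g.
Proof. by rewrite inE mulgV rl1 addn0. Qed.

(* g = k * s; peel transpositions off k and glue them to s. *)
Lemma geo_subset g s x : s \in geo g -> porbit s x \subset porbit g x.
Proof.
move: {2}(g * s^-1)%g (erefl (g * s^-1)%g) => k.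
elim/rl_ind: k s x => [|k i ki Ek IH] s x Eks.
  by have -> : s = g by rewrite -(perm_divK g s) Eks perm_mul1g.
rewrite inE Eks => /eqP Es.
set j := k i in ki Ek IH; pose s' := (tperm i j * s)%g.
have Es' : (g * s'^-1)%g = (k * tperm i j)%g by rewrite /s' perm_invM tpermV perm_mulA Eks.
have rls' : rl s' = (rl s).+1.
  by have := rl_triangle g s'; have := rl_tperm_le s i j; rewrite -/s' Es'; lia.
have s'g : s' \in geo g by rewrite inE Es' rls' -Es Ek; lia.
have sE : s = (tperm i j * s')%g by rewrite tperm_mulK.
(* Otherwise the transposition would glue two cycles of [s'] and make [s] longer than [s']. *)
have ij : porbit s' i = porbit s' j.
  apply/eqP; rewrite eq_porbit_mem; apply/negPn/negP => H.
  by have := rl_tperm_out H; rewrite -sE; lia.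
apply: (subset_trans _ (IH s' x Es' s'g)).
have : stable (porbit s' x) s.
  rewrite sE stableM //; last by apply/stableP => y; rewrite mem_porbit_perm.
  by rewrite stable_tperm !(porbit_sym s' _ x) ij.
move=> st; apply/subsetP => y /(stable_porbit st) ->; exact: porbit_id.
Qed.

Lemma geo_stable g s X : s \in geo g -> stable X g -> stable X s.
Proof.
move=> sg gX; apply/stableP => x; apply: (stable_porbit gX).
by apply: (subsetP (geo_subset x sg)); rewrite mem_porbit_perm porbit_id.
Qed.

Lemma geo_fix g s x : s \in geo g -> g x = x -> s x = x.
Proof.
move=> sg gx; have gX : stable [set x] g.
  by apply/stableP => y; rewrite !inE -{1}gx (inj_eq perm_inj).
by have /stableP/(_ x) := geo_stable sg gX; rewrite !inE eqxx => /eqP.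
Qed.

Lemma geo_full g s : s \in geo g -> rl s = rl g -> s = g.
Proof.
rewrite inE => /eqP E Es; have : rl (g * s^-1)%g = 0 by lia.
move=> E0; rewrite -(perm_divK g s); suff -> : (g * s^-1)%g = 1%g by rewrite mul1g.
move: (g * s^-1)%g E0; apply: rl_ind => // k i ki Ek _; lia.
Qed.

(** Peeling the complement leads from [s] to [g], which preserves [L], so at some step the
    transposition has its two points on different sides of [L]. There it glues two cycles of the
    stable [s']: both [s] and its complement are longer by one than those of [s'], which adds 2 to
    the triangle inequality. *)
Lemma rl_connected g s L : stable L g -> ~~ stable L s ->
  rl g + 2 <= rl s + rl (g * s^-1)%g.
Proof.
move=> gL; move: {2}(g * s^-1)%g (erefl (g * s^-1)%g) => k.
elim/rl_ind: k s => [|k i ki Ek IH] s Eks nsL.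
  by have sg : s = g by [rewrite -(perm_divK g s) Eks perm_mul1g]; rewrite sg gL in nsL.
set j := k i in ki Ek IH; pose s' := (tperm i j * s)%g.
have Es' : (g * s'^-1)%g = (k * tperm i j)%g by rewrite /s' perm_invM tpermV perm_mulA Eks.
have sE : s = (tperm i j * s')%g by rewrite tperm_mulK.
rewrite Eks; have [s'L|ns'L] := boolP (stable L s'); last first.
  by have := IH s' Es' ns'L; have := rl_tperm_le s i j; rewrite -/s' Es'; lia.
have ijL : (i \in L) != (j \in L).
  by apply: contraNN nsL => E; rewrite sE stableMr // stable_tperm.
have /rl_tperm_out : i \notin porbit s' j.
  by apply: contraNN ijL => /(stable_porbit s'L)->.
by rewrite -sE; have := rl_triangle g s'; rewrite Es'; lia.
Qed.

(* With [g] having the two cycles [M :&: L] and [M :\: L], the annular non-crossing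
   permutations of [M]. *)
Definition ann M g L : {set {perm T}} :=
  [set s | [&& perm_on M s, ~~ stable L s & rl s + rl (g * s^-1)%g == rl g + 2]].

End ReflectionLength.

(** * Erasing a point from the complement *)

Section OnePoint.

Variables (T : finType) (g' : {perm T}) (i : T).
Implicit Types (s t : {perm T}) (L X M : {set T}) (j x y : T).

(* Here [s] fixes [i] and permutes the points other than [i]; [reinsert i s] puts [i]
   just before [g' i] in the cycle of [g' i], [ext_orbit s] is the cycle so extended,
   and [reinsert j s] is moreover cut or glued by (i j). *)
Definition reinsert j s : {perm T} := (tperm i j * s * tperm i (g' i))%g.
Definition remove_point : {perm T} := (g' * tperm i (g' i))%g.
Definition ext_orbit s : {set T} := i |: porbit s (g' i).

Lemma insK j : involutive (reinsert j).
Proof. by move=> s; rewrite /reinsert !perm_mulA tperm2 perm_mul1g mul_tpermK. Qed.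

Lemma del_fix : remove_point i = i.
Proof. by rewrite permM tpermR. Qed.

Lemma ins_self s : reinsert i s = (s * tperm i (g' i))%g.
Proof. by rewrite /reinsert tperm1 mul1g. Qed.

Lemma insE j s : reinsert j s = (tperm i j * reinsert i s)%g.
Proof. by rewrite ins_self perm_mulA. Qed.

(** Lets the inserted index be read off the result: if [s] fixes [i], then [j] is the preimage of
    [g' i]. *)
Lemma ins_eq j s : (reinsert j s j == g' i) = (s i == i).
Proof.
by rewrite !permM tpermR -[X in _ == X](tpermL i (g' i)) (inj_eq perm_inj).
Qed.

Lemma porbit_fix s x : s x = x -> porbit s x = [set x].
Proof.
move=> sx; apply/setP => y; rewrite inE; apply/idP/eqP => [|->]; last exact: porbit_id.
have st : stable [set x] s.
  by apply/stableP => z; rewrite !inE -{1}sx (inj_eq perm_inj).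
by move/(stable_porbit st); rewrite !inE eqxx => /eqP.
Qed.

Hypothesis gi : g' i != i.

Lemma span_orbit s : s i = i -> porbit (reinsert i s) i = ext_orbit s.
Proof.
move=> si; have insi : reinsert i s i = g' i by apply/eqP; rewrite ins_eq si.
have git : g' i \in porbit (reinsert i s) i by rewrite -insi mem_porbit_perm porbit_id.
apply/eqP; rewrite eqEsubset; apply/andP; split; apply/subsetP => y.
  have st : stable (ext_orbit s) (reinsert i s).
    rewrite ins_self stableM ?stable_tperm ?inE ?eqxx ?porbit_id ?orbT //.
    by apply/stableP => z; rewrite /ext_orbit !inE mem_porbit_perm -{1}si (inj_eq perm_inj).
  by move/(stable_porbit st)->; rewrite !inE eqxx.
rewrite !inE => /predU1P[->|]; first exact: porbit_id.
have st : stable (porbit (reinsert i s) i) s.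
  have {2}-> : s = (reinsert i s * tperm i (g' i))%g by rewrite ins_self mul_tpermK.
  rewrite stableM //.
    by apply/stableP => z; rewrite mem_porbit_perm.
  by rewrite stable_tperm porbit_id git.
by move/(stable_porbit st)->.
Qed.

Lemma rl_del : rl g' = (rl remove_point).+1.
Proof. exact: rl_move. Qed.

(** Joining [i] to the cycle of [g' i] costs 1. If [j] is not [i], the factor (i j) also joins the
    fixed point [i] to a cycle of the complement (+1), while on [reinsert i s] it either cuts a
    cycle (-1) or glues two (+1). The total is 1 inside [ext_orbit s] and 3 outside. *)
Lemma rl_ins_sum j s : s i = i ->
  rl (reinsert j s) + rl (g' * (reinsert j s)^-1)%g =
  rl s + rl (remove_point * s^-1)%g + 1 + (j \notin ext_orbit s).*2.
Proof.
move=> si.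
have out : i \notin porbit s (g' i).
  by rewrite porbit_sym porbit_fix // inE.
have rli : rl (reinsert i s) = (rl s).+1 by rewrite ins_self rl_mul_tperm_out.
have EK : (g' * (reinsert j s)^-1)%g = (remove_point * s^-1 * tperm i j)%g.
  by rewrite /reinsert !perm_invM !tpermV /remove_point !perm_mulA.
rewrite EK; have [->|ji] := eqVneq j i.
  by rewrite tperm1 mulg1 rli !inE eqxx /=; lia.
have Ki : (remove_point * s^-1)%g i = i by rewrite permM del_fix -{1}si permK.
have out2 : i \notin porbit (remove_point * s^-1)%g j.
  by rewrite porbit_sym (porbit_fix Ki) inE.
rewrite (rl_mul_tperm_out out2) insE -span_orbit //.
have [jin|jout] := boolP (j \in porbit (reinsert i s) i).
  have := @rl_tperm_in _ (reinsert i s) i j; rewrite eq_sym ji porbit_sym jin.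
  by move=> /(_ isT isT) ; rewrite rli /=; lia.
by rewrite rl_tperm_out 1?porbit_sym // rli /=; lia.
Qed.

Lemma geo_ins j s : s i = i -> 
  (reinsert j s \in geo g') = (s \in geo remove_point) && (j \in ext_orbit s).
Proof.
move=> si; have := rl_ins_sum j si; have := rl_triangle remove_point s.
rewrite !inE => le ->; rewrite rl_del.
by case: (_ || _); apply/eqP/andP => [|[/eqP]]; lia.
Qed.

(** For fixed [j] the map [reinsert j] is an involution, and [j] is recovered from the result by
    [ins_eq]; the pairs with [s i = i] thus parametrize all permutations. *)
Lemma sum_ins (V : nmodType) (S : {set {perm T}}) (F : {perm T} -> V) :
  (\sum_(s in S) F s =
   \sum_(p : {perm T} * T | (reinsert p.2 p.1 \in S) && (p.1 i == i)) F (reinsert p.2 p.1))%R.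
Proof.
rewrite (reindex_onto (fun p : {perm T} * T => reinsert p.2 p.1)
  (fun s : {perm T} => let j := s^-1%g (g' i) in (reinsert j s, j))) /=; last first.
  by move=> s _; rewrite insK.
apply: eq_bigl => -[s j] /=; congr (_ && _).
rewrite -(ins_eq j) -(inj_eq (@perm_inj _ (reinsert j s)^-1%g)) permK.
rewrite eq_sym; apply/eqP/eqP => [[_ <-] // |jE].
by rewrite -jE insK.
Qed.

Lemma sum_geo_ins (V : nmodType) (F : {perm T} -> V) :
  (\sum_(s in geo g') F s =
   \sum_(s in geo remove_point) \sum_(j in ext_orbit s) F (reinsert j s))%R.
Proof.
rewrite pair_big_dep sum_ins /=; apply: eq_bigl => -[s j] /=.
have [si|nsi] := eqVneq (s i) i; first by rewrite andbT geo_ins.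
rewrite andbF; apply/esym/negbTE; apply: contraNN nsi => /andP[sg _].
by apply/eqP; apply: (geo_fix sg); apply: del_fix.
Qed.

Variables (M' L : {set T}).
Hypotheses (iM : i \in M') (gM : perm_on M' g') (gL : stable L g').

Let M := M' :\ i.

Lemma perm_on_ins j s : s i = i -> 
  (perm_on M' (reinsert j s)) = (perm_on M s) && (j \in M').
Proof.
have giM : g' i \in M' by rewrite perm_closed.
move=> si; apply/idP/andP => [on|[on jM]].
  have jM : j \in M'.
    by rewrite -(perm_closed _ on) (eqP (_ : reinsert j s j == g' i)) // ins_eq si.
  have on' : perm_on M' s.
    rewrite -(insK j s) /reinsert.
    by apply: perm_onM; [apply: perm_onM|] => //;
      apply: (subset_trans (tperm_on _ _)); rewrite subUset !sub1set iM.
  split=> //; apply/subsetP => x; rewrite inE => sx; rewrite !inE.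
  apply/andP; split; first by apply: contraNneq sx => ->; rewrite si.
  by apply: (subsetP on'); rewrite inE.
have on' : perm_on M' s by apply: (subset_trans on); apply: subsetDl.
by apply: perm_onM; [apply: perm_onM|] => //;
  apply: (subset_trans (tperm_on _ _)); rewrite subUset !sub1set iM.
Qed.

Lemma giL : (g' i \in L) = (i \in L). Proof. by move/stableP: gL. Qed.

Lemma stable_ins j s : (j \in L) = (i \in L) -> stable L (reinsert j s) = stable L s.
Proof.
by move=> jL; rewrite /reinsert stableMr ?stableMl // stable_tperm ?giL ?jL.
Qed.

Lemma span_sub s : perm_on M s -> ext_orbit s \subset M'.
Proof.
move=> on; apply/subsetP => j; rewrite !inE => /predU1P[->//|].
have st : stable M' s.
  by apply/stableP => x; apply: perm_closed; apply: (subset_trans on); apply: subsetDl.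
by move/(stable_porbit st)->; rewrite perm_closed.
Qed.

Lemma span_side j s : stable L s -> j \in ext_orbit s -> (j \in L) = (i \in L).
Proof.
move=> sL; rewrite !inE => /predU1P[->//|].
by move/(stable_porbit sL)->; rewrite giL.
Qed.

Lemma perm_on_del : perm_on M remove_point.
Proof.
have := perm_on_ins i del_fix; have -> : reinsert i remove_point = g'.
  by rewrite ins_self mul_tpermK.
by rewrite gM iM andbT => <-.
Qed.

Lemma stable_del : stable L remove_point.
Proof. by rewrite stableM // stable_tperm giL. Qed.

Lemma geo_perm_on s : s \in geo remove_point -> perm_on M s.
Proof.
move=> sg; apply/subsetP => x; rewrite inE => sx.
apply/negPn/negP => xM; move: sx; rewrite (geo_fix sg) ?eqxx //.
exact: out_perm perm_on_del _.
Qed.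

(** When [s] keeps the circles apart, only a glueing across can mix them. It costs 3 by
    [rl_ins_sum], of which 1 is the growth of [rl g']; the remaining 2 is the annular excess exactly
    when [s] is geodesic. *)
Lemma ann_ins_stable j s : s i = i -> stable L s ->
  (reinsert j s \in ann M' g' L) =
  (s \in geo remove_point) && ((j \in M) && ((j \in L) != (i \in L))).
Proof.
move=> si sL; have E := rl_ins_sum j si; have le := rl_triangle remove_point s.
rewrite [in LHS]inE perm_on_ins // E.
have jM : (j \in L) != (i \in L) -> (j \in M) = (j \in M').
  by move=> ne; rewrite in_setD1; case: (eqVneq j i) ne => [->|]; rewrite ?eqxx.
have [jL|/[dup] jL /jM->] := eqVneq (j \in L) (i \in L).
  by rewrite stable_ins // sL !andbF.
have nst : ~~ stable L (reinsert j s).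
  apply: contraNN jL => st.
  have : stable L (tperm i j).
    rewrite -(@stableMr _ L (s * tperm i (g' i))%g) ?perm_mulA //.
    by rewrite stableM // stable_tperm giL.
  by rewrite stable_tperm eq_sym.
have nsp : j \notin ext_orbit s by apply: contraNN jL => /(span_side sL)->.
rewrite nst nsp rl_del /= andbT.
have [sg|] := boolP (s \in geo remove_point).
  rewrite geo_perm_on //=; move: sg; rewrite inE => /eqP Es.
  by case: (j \in M') => //=; apply/eqP; lia.
rewrite inE => /eqP nE; apply/negbTE; rewrite !negb_and; apply/orP; right.
by apply/eqP; lia.
Qed.

(** When [s] already mixes the circles, [rl_connected] uses up the whole excess of 2, so a further
    glueing would be too long. A cut cannot separate the circles again: a stable result forces [j]
    onto the side of [i], and then [s] would be stable too. *)
Lemma ann_ins_nstable j s : s i = i -> ~~ stable L s ->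
  (reinsert j s \in ann M' g' L) = (s \in ann M remove_point L) && (j \in ext_orbit s).
Proof.
move=> si sL; have E := rl_ins_sum j si; have le := rl_connected stable_del sL.
rewrite [in LHS]inE [in X in _ = X && _]inE perm_on_ins // sL E rl_del /=.
have [onM|] := boolP (perm_on M s) => //=.
have [jsp|jsp] := boolP (j \in ext_orbit s); last first.
  by rewrite andbF; apply/negbTE; rewrite !negb_and; apply/orP; right;
    apply/orP; right; apply/eqP => /=; lia.
rewrite (subsetP (span_sub onM)) //= andbT.
have [E2|nE] := eqVneq (rl s + rl (remove_point * s^-1)%g) (rl remove_point + 2); last first.
  by apply/negbTE; rewrite negb_and; apply/orP; right; apply/eqP; lia.
rewrite E2; have -> : rl remove_point + 2 + 1 + 0 == (rl remove_point).+1 + 2 by apply/eqP; lia.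
rewrite andbT; apply/negP => st.
have jL : (j \in L) = (i \in L).
  move/stableP: st => /(_ j); have /eqP-> : reinsert j s j == g' i by rewrite ins_eq si.
  by rewrite giL.
by move: sL; rewrite -(stable_ins _ jL) st.
Qed.

Lemma sum_ann_ins (V : nmodType) (F : {perm T} -> V) :
  (\sum_(s in ann M' g' L) F s =
   \sum_(s in ann M remove_point L) \sum_(j in ext_orbit s) F (reinsert j s) +
   \sum_(s in geo remove_point) \sum_(j in M | (j \in L) != (i \in L)) F (reinsert j s))%R.
Proof.
rewrite !pair_big_dep sum_ins /= addrC (bigID (fun p => stable L p.1)) /=.
congr (_ + _)%R; apply: eq_bigl => -[s j] /=.
  have [si|nsi] := eqVneq (s i) i; last first.
    rewrite andbF; apply/esym/negbTE; apply: contraNN nsi => /andP[sg _].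
    by apply/eqP; apply: (geo_fix sg); apply: del_fix.
  have [sL|nsL] := boolP (stable L s); first by rewrite andbT andbT ann_ins_stable.
  rewrite andbF; apply/esym/negbTE; apply: contraNN nsL => /andP[sg _].
  exact: geo_stable sg stable_del.
have [si|nsi] := eqVneq (s i) i; last first.
  rewrite andbF; apply/esym/negbTE; apply: contraNN nsi => /andP[].
  rewrite inE => /and3P[on _ _] _; apply/eqP; apply: (out_perm on).
  by rewrite !inE eqxx.
have [sL|nsL] := boolP (stable L s); last by rewrite andbT andbT ann_ins_nstable.
by rewrite andbF; apply/esym/negbTE; rewrite inE sL /= andbF.
Qed.

End OnePoint.

Lemma big_setU_disjoint (R : Type) (idx : R) (op : Monoid.com_law idx) (I : finType)
    (A B : {set I}) (F : I -> R) : [disjoint A & B] ->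
  \big[op/idx]_(i in A :|: B) F i =
  op (\big[op/idx]_(i in A) F i) (\big[op/idx]_(i in B) F i).
Proof. by move=> dis; rewrite -bigU //; apply: eq_bigl => x; rewrite !inE. Qed.

(** * Cycles and their arguments *)

Section Cycles.

Variable T : finType.
Implicit Types (s t : {perm T}) (X Z c : {set T}) (x y i j : T) (l p : seq T).

Definition cycs s X : {set {set T}} := [set c in porbits s | c \subset X].

Lemma cycsP s X c :
  reflect (exists2 x, c = porbit s x & c \subset X) (c \in cycs s X).
Proof.
rewrite inE; apply: (iffP andP) => [[/imsetP[x _ ->] sub]|[x -> sub]].
  by exists x.
by rewrite imset_f.
Qed.

Lemma porbit_sub s X x : stable X s -> (porbit s x \subset X) = (x \in X).
Proof.
move=> st; apply/subsetP/idP => [H|xX y /(stable_porbit st)->//].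
by apply: H; apply: porbit_id.
Qed.

Lemma cycs_porbit s X x : stable X s -> (porbit s x \in cycs s X) = (x \in X).
Proof.
move=> st; rewrite inE porbit_sub // andb_idl // => _.
by rewrite /porbits imset_f.
Qed.

Lemma porbit_n0 s x : porbit s x != set0.
Proof. by apply/set0Pn; exists x; apply: porbit_id. Qed.

Lemma porbits_n0 s c : c \in porbits s -> c != set0.
Proof. by move=> /imsetP[x _ ->]; apply: porbit_n0. Qed.

Lemma cycsT s : cycs s setT = porbits s.
Proof. by apply/setP => c; rewrite inE subsetT andbT. Qed.

Lemma cycsU s X Z : stable X s -> stable Z s -> cycs s (X :|: Z) = cycs s X :|: cycs s Z.
Proof.
move=> sX sZ; have sXZ : stable (X :|: Z) s.
  by apply/stableP => x; rewrite !inE (stableP _ _ sX) (stableP _ _ sZ).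
apply/setP => c; rewrite in_setU; apply/idP/orP => [/cycsP[x -> ]|].
  by rewrite porbit_sub // in_setU -(cycs_porbit x sX) -(cycs_porbit x sZ) => /orP.
by case=> /cycsP[x -> sub]; apply/cycsP; exists x => //; apply: (subset_trans sub);
  rewrite ?subsetUl ?subsetUr.
Qed.

Lemma stableD s X Z : stable X s -> stable Z s -> stable (X :\: Z) s.
Proof.
by move=> /stableP sX /stableP sZ; apply/stableP => x; rewrite !inE sX sZ.
Qed.

Lemma stableI s X Z : stable X s -> stable Z s -> stable (X :&: Z) s.
Proof.
by move=> /stableP sX /stableP sZ; apply/stableP => x; rewrite !inE sX sZ.
Qed.

Lemma cycs_split s X Z : stable X s -> X \subset Z -> stable Z s ->
  cycs s Z = cycs s X :|: cycs s (Z :\: X) /\ [disjoint cycs s X & cycs s (Z :\: X)].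
Proof.
move=> sX XZ sZ; have sD := stableD sZ sX; split.
  by rewrite -cycsU // setDE setUIr setUCr setIT (setUidPr XZ).
apply/pred0P => c /=; apply/negbTE/negP => /andP[/cycsP[x -> /subsetP sub1]].
case/cycsP => _ _ /subsetP sub2; have := sub1 x (porbit_id s x).
by have := sub2 x (porbit_id s x); rewrite inE => /andP[/negbTE->].
Qed.

Lemma big_cycs_split (R : comPzRingType) s X Z (F : {set T} -> R) :
  stable X s -> X \subset Z -> stable Z s ->
  (\prod_(c in cycs s Z) F c =
   (\prod_(c in cycs s X) F c) * \prod_(c in cycs s (Z :\: X)) F c)%R.
Proof.
move=> sX XZ sZ; have [-> dis] := cycs_split sX XZ sZ.
exact: big_setU_disjoint.

Qed.

(* [cycle_args] on an arbitrary finite type; which element of the cycle comes first is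
   arbitrary. *)
Definition cyc_args (A : Type) (a : T -> A) s c : seq A :=
  if enum c is i :: _ then [seq a j | j <- traject s i #|c|] else [::].

Lemma porbit_agree s t X x : {in X, s =1 t} -> stable X s -> stable X t -> x \in X ->
  porbit s x = porbit t x.
Proof.
move=> st sX tX xX; apply/setP => y.
have E n : (s ^+ n)%g x = (t ^+ n)%g x.
  elim: n => [|n IH]; first by rewrite !perm1.
  by rewrite !expgSr !permM IH st // stable_iter.
by apply/porbitP/porbitP => -[n ->]; exists n; rewrite E.
Qed.

Lemma cycs_agree s t X : {in X, s =1 t} -> stable X s -> stable X t -> cycs s X = cycs t X.
Proof.
move=> st sX tX; apply/setP => c; apply/cycsP/cycsP => -[x E sub]; exists x => //.
  by rewrite -(porbit_agree st) // -(porbit_sub _ sX) -E.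
by rewrite (porbit_agree st) // -(porbit_sub _ tX) -E.
Qed.

Lemma eq_cyc_args (A : Type) (a b : T -> A) s t X c : {in X, s =1 t} -> {in X, a =1 b} ->
  stable X s -> c \subset X -> cyc_args a s c = cyc_args b t c.
Proof.
move=> st ab sX cX; rewrite /cyc_args; case E: (enum c) => [//|x e].
have xX : x \in X by apply: (subsetP cX); rewrite -mem_enum E inE eqxx.
elim: #|c| x xX {E} => //= m IH x xX.
by rewrite ab // -st // IH // (stableP _ _ sX).
Qed.

Lemma fpathE (f : T -> T) x p : fpath f x p -> p = traject f (f x) (size p).
Proof. by elim: p x => //= y p IH x /andP[/eqP-> /IH <-]. Qed.

Lemma fcycle_traject (f : T -> T) x p : fcycle f (x :: p) ->
  x :: p = traject f x (size p).+1.
Proof. by rewrite /= rcons_path => /andP[/fpathE <- _]. Qed.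

Lemma fcycle_porbit s l x : fcycle s l -> uniq l -> x \in l ->
  porbit s x = [set y in l].
Proof.
move=> cyc un xl; have st : stable [set y in l] s.
  apply/stableP => y; rewrite !inE; apply/idP/idP => yl; last first.
    by have /= /eqP-> := next_cycle cyc yl; rewrite mem_next.
  by have /= /eqP/perm_inj <- := prev_cycle cyc yl; rewrite mem_prev.
apply/setP => y; rewrite inE; apply/idP/idP => [/(stable_porbit st)|yl].
  by rewrite !inE => ->.
have [n p El] := rot_to xl; move: cyc yl; rewrite -(rot_cycle n) -(mem_rot n) El.
move/fcycle_traject => -> /trajectP[m _ ->].
by apply/porbitP; exists m; rewrite permX.
Qed.

Lemma fcycle_cycs s l : fcycle s l -> uniq l -> l != [::] ->
  cycs s [set y in l] = [set [set y in l]].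
Proof.
case: l => // x p cyc un _; have E := @fcycle_porbit s _ x cyc un (mem_head _ _).
apply/setP => c; rewrite in_set1; apply/cycsP/eqP => [[y -> /subsetP sub]|->].
  by apply: fcycle_porbit => //; have := sub y (porbit_id s y); rewrite inE.
by exists x => //; rewrite E.
Qed.

(** [cyc_args] starts at the first enumerated point of the cycle, which need not be the head of [l].
    This is why functionals of cycles are compared only under [rot_inv]. *)
Lemma fcycle_cyc_args (A : Type) (a : T -> A) s l : fcycle s l -> uniq l ->
  exists n, cyc_args a s [set y in l] = map a (rot n l).
Proof.
move=> cyc un; rewrite /cyc_args; case E: (enum _) => [|x e].
  exists 0; rewrite rot0; case: l {cyc un} E => // x p E.
  by have := mem_enum [set y in x :: p] x; rewrite E !inE eqxx.
have xl : x \in l by have := mem_enum [set y in l] x; rewrite E !inE eqxx.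
have [n p El] := rot_to xl; exists n; rewrite El cardsE (card_uniqP un).
by rewrite -(size_rot n) El -fcycle_traject // -El rot_cycle.
Qed.

Definition rot_inv (A V : Type) (h : seq A -> V) := forall n (l : seq A), h (rot n l) = h l.

Lemma rot_inv_cyc (A V : Type) (h : seq A -> V) (a : T -> A) s l : rot_inv h ->
  fcycle s l -> uniq l -> h (cyc_args a s [set y in l]) = h (map a l).
Proof.
by move=> hr cyc un; have [n ->] := fcycle_cyc_args a cyc un; rewrite map_rot hr.
Qed.

Lemma porbit_fcycle s x : exists p, [/\ fcycle s (x :: p), uniq (x :: p) &
  porbit s x = [set y in x :: p]].
Proof.
have := uniq_traject_porbit s x; have E := iter_porbit s x.
have memE := porbit_traject s x.
case Em: #|porbit s x| E memE => [|m] E memE un.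
  by have := card_porbit_neq0 s x; rewrite Em.
exists (traject s (s x) m); split => //; last by apply/setP => y; rewrite memE inE.
by rewrite /= rcons_path fpath_traject last_traject; apply/eqP.
Qed.

Lemma eq_fpath (f g : T -> T) x p : {in belast x p, f =1 g} -> fpath f x p = fpath g x p.
Proof.
elim: p x => //= y p IH x H; rewrite (H x) ?mem_head // IH // => z zp.
by apply: H; rewrite inE zp orbT.
Qed.

(** The transposition of the two last points exchanges their successors, the heads [x] and [y]: one
    closed list becomes two, and conversely. *)
Lemma fcycle_cut t x p y q : uniq ((x :: p) ++ (y :: q)) ->
  fcycle (tperm (last x p) (last y q) * t)%g ((x :: p) ++ (y :: q)) =
  fcycle t (x :: p) && fcycle t (y :: q).
Proof.
move=> un; rewrite /= !rcons_path !cat_path !last_cat /= -!andbA.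
set u := (_ * t)%g.
have un2 : uniq ((belast x p ++ belast y q) ++ [:: last x p; last y q]).
  rewrite -(perm_uniq (_ : perm_eq ((x :: p) ++ y :: q) _)) //.
  by rewrite (lastI x p) (lastI y q) -!cats1 -!catA perm_cat2l perm_catCA.
have agree z : z \in belast x p ++ belast y q -> u z = t z.
  move=> zin; rewrite permM tpermD //; apply: contraTneq un2 => E;
  by rewrite cat_uniq; apply/negP => /and3P[_ /hasPn /(_ z)] /=;
     rewrite zin !inE -E eqxx ?orbT => /(_ isT).
rewrite (@eq_fpath u t x p); last by move=> z zp; apply: agree; rewrite mem_cat zp.
rewrite (@eq_fpath u t y q); last by move=> z zp; apply: agree; rewrite mem_cat zp orbT.
by rewrite /u !permM tpermL tpermR; do ?bool_congr; case: eqP; case: eqP; case: path.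
Qed.

End Cycles.

(** * Sums over the reinsertions of a point *)

Section Mark.
Variables (I : finType) (C : comPzRingType).
Implicit Types (u v : I -> C) (A B : {set I}).
Local Open Scope ring_scope.

(** The coefficient of the first power of z in the product over [A] of [u c + z * v c]; hence the
    Leibniz rule [mark_setU]. *)
Definition mark u v A := \sum_(c in A) v c * \prod_(e in A :\ c) u e.

Lemma mark_setU u v A B : [disjoint A & B] ->
  mark u v (A :|: B) =
  mark u v A * \prod_(e in B) u e + \prod_(e in A) u e * mark u v B.
Proof.
move=> dis; rewrite /mark big_setU_disjoint //= big_distrl big_distrr /=.
congr (_ + _); apply: eq_bigr => c cin.
  rewrite setDUl (setDidPl (_ : [disjoint B & [set c]])); last first.
    by rewrite disjoint_sym disjoints1; rewrite (disjointFr dis cin).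
  rewrite big_setU_disjoint ?mulrA //=.
  by apply: (disjointWl _ dis); apply: subD1set.
rewrite setDUl (setDidPl (_ : [disjoint A & [set c]])); last first.
  by rewrite disjoint_sym disjoints1; rewrite (disjointFl dis cin).
rewrite big_setU_disjoint 1?mulrCA //=.
by apply: (disjointWr _ dis); apply: subD1set.
Qed.

Lemma mark1 u v c : mark u v [set c] = v c.
Proof. by rewrite /mark big_set1 setDv big_set0 mulr1. Qed.

Lemma eq_mark u v u' v' A : {in A, u =1 u'} -> {in A, v =1 v'} ->
  mark u v A = mark u' v' A.
Proof.
move=> eu ev; apply: eq_bigr => c cA; rewrite ev //; congr (_ * _).
by apply: eq_bigr => e /setD1P[_ /eu].
Qed.
End Mark.

Section Insertion.

Variables (T : finType) (g' : {perm T}) (i : T) (s : {perm T}) (w : seq T).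
Let k := g' i.
Hypotheses (cyc : fcycle s (k :: w)) (un : uniq (i :: k :: w)) (si : s i = i).

Implicit Types (X Z : {set T}) (j x y : T).

Local Notation ins := (reinsert g' i).
Local Notation span := (ext_orbit g' i).

Lemma spanE : span s = [set x in rcons (k :: w) i].
Proof.
have unk : uniq (k :: w) by case/andP: un.
rewrite /ext_orbit (fcycle_porbit cyc unk (mem_head _ _)).
by apply/setP => x; rewrite !inE mem_rcons !inE !(orbCA (x == i)).
Qed.

Lemma un_full : uniq (rcons (k :: w) i).
Proof. by rewrite rcons_uniq. Qed.

Lemma ins_self_fcycle : fcycle (ins i s) (rcons (k :: w) i).
Proof.
have -> : ins i s = (tperm (last k w) i * s)%g.
  have /= := cyc; rewrite rcons_path => /andP[_ /eqP sl].
  by rewrite ins_self [RHS]conjgC tpermJ si sl tpermC.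
rewrite -cats1 -[tperm _ i]/(tperm _ (last i [::])) fcycle_cut ?cats1 ?un_full //.
by rewrite cyc /= si eqxx.
Qed.

Lemma ins_cut_fcycle x p l : k :: w = (x :: p) ++ l ->
  fcycle (ins (last x p) s) (x :: p) /\ fcycle (ins (last x p) s) (rcons l i).
Proof.
move=> E; apply/andP; have := ins_self_fcycle; have := un_full.
rewrite E rcons_cat (insE _ _ (last x p)); case El: (rcons l i) => [|y q]; first by case: l El {E}.
have Ei : last y q = i by rewrite -[LHS]/(last i (y :: q)) -El last_rcons.
by move=> u; rewrite -fcycle_cut // Ei tpermC tperm_mulK.
Qed.

Lemma fcycle_agree (f h : {perm T}) l : {in l, f =1 h} -> fcycle f l = fcycle h l.
Proof.
by case: l => // x p E; apply: eq_fpath => z; rewrite belast_rcons; apply: E.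
Qed.

Lemma ins_id j x : x != i -> x != j -> s x != i -> s x != k -> ins j s x = s x.
Proof. by move=> xi xj sxi sxk; rewrite !permM !tpermD // eq_sym. Qed.

(** With [j = last y q], the glued permutation goes from [i] on to [s j = y], and from [j] back to
    [g' i]; so the second cycle is read starting just after [j]. *)
Lemma ins_merge_fcycle y q : fcycle s (y :: q) -> uniq (rcons (k :: w) i ++ y :: q) ->
  fcycle (ins (last y q) s) (rcons (k :: w) i ++ y :: q).
Proof.
move=> cq u; have E : i = last k (rcons w i) by rewrite last_rcons.
rewrite (insE _ _ (last y q)) rcons_cons {1}E fcycle_cut -?rcons_cons // ins_self_fcycle /=.
rewrite -[path _ _ _]/(fcycle (ins i s) (y :: q)).
have notin z : z \in y :: q -> z \notin rcons (k :: w) i.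
  by move: u; rewrite cat_uniq => /and3P[_ /hasPn H _] /H.
rewrite (@fcycle_agree _ s) // => z zq; rewrite ins_self permM tpermD //.
  apply: contraTneq (notin z zq) => E2; rewrite negbK mem_rcons inE.
  by rewrite -(inj_eq (@perm_inj _ s)) si E2 eqxx.
have sz : s z \in y :: q by rewrite (eqP (next_cycle cq zq : s z == _)) mem_next.
by apply: contraTneq (notin _ sz) => <-; rewrite negbK mem_rcons !inE eqxx orbT.
Qed.

Lemma stable_span_s : stable (span s) s.
Proof.
by apply/stableP => z; rewrite /ext_orbit !inE mem_porbit_perm -{1}si (inj_eq perm_inj).
Qed.

Lemma stable_ins_sup Z j : j \in span s -> span s \subset Z -> stable Z s ->
  stable Z (ins j s).
Proof.
move=> jin /subsetP sub sZ.
have iZ : i \in Z by apply: sub; rewrite !inE eqxx.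
have kZ : k \in Z by apply: sub; rewrite !inE porbit_id orbT.
by rewrite /reinsert stableM ?stableM ?stable_tperm ?iZ ?kZ ?(sub j).
Qed.

Lemma ins_agree_out j x : j \in span s -> x \notin span s -> ins j s x = s x.
Proof.
move=> jin xout; have sxout : s x \notin span s by rewrite (stableP _ _ stable_span_s).
have ne y z : y \in span s -> z \notin span s -> z != y.
  by move=> yin; apply: contraNneq => ->.
by apply: ins_id; apply: ne => //; rewrite !inE ?eqxx ?porbit_id ?orbT.
Qed.

Lemma stable_ins_out X j : j \in span s -> [disjoint X & span s] -> stable X s ->
  stable X (ins j s).
Proof.
move=> jin dis sX; apply/stableP => x.
have [xin|xout] := boolP (x \in span s); last by rewrite ins_agree_out ?(stableP _ _ sX).
have insin : ins j s x \in span s.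
  by have /stableP-> := stable_ins_sup jin (subxx _) stable_span_s.
by rewrite (disjointFl dis xin) (disjointFl dis insin).
Qed.

Lemma cycs_ins_out X j : j \in span s -> [disjoint X & span s] -> stable X s ->
  cycs (ins j s) X = cycs s X.
Proof.
move=> jin dis sX; apply: cycs_agree => //; last exact: stable_ins_out.
by move=> x xX; apply: ins_agree_out => //; rewrite (disjointFr dis).
Qed.

Lemma fcycle_stable (t : {perm T}) l : fcycle t l -> uniq l -> stable [set x in l] t.
Proof.
case: l => [|x p] ct ut; first by apply/stableP => x; rewrite !inE.
rewrite -(fcycle_porbit ct ut (mem_head _ _)); apply/stableP => y.
exact: mem_porbit_perm.
Qed.

Local Notation arc t := (k :: take t w).
Local Notation coarc t := (rcons (drop t w) i).
Local Notation cut t := (ins (nth k (k :: w) t) s).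

Lemma un_arcs t : uniq (arc t ++ coarc t).
Proof. by have := un_full; rewrite -cats1 -{1}(cat_take_drop t w) -cat_cons -catA cats1. Qed.

Lemma cut_fcycle t : (t <= size w)%N -> fcycle (cut t) (arc t) /\ fcycle (cut t) (coarc t).
Proof.
move=> tw; have <- : last k (take t w) = nth k (k :: w) t.
  by rewrite -nth_last size_takel //; case: t tw => [|t] tw /=; rewrite ?take0 ?nth_take.
by apply: ins_cut_fcycle; rewrite cat_cons cat_take_drop.
Qed.

Lemma arc_neq t : [set x in arc t] \notin [set [set x in coarc t]].
Proof.
rewrite inE; apply/eqP => /setP/(_ i); rewrite !inE mem_rcons mem_head.
move=> iarc; have := un_arcs t; rewrite cat_uniq => /and3P[_ /hasPn/(_ i)].
by rewrite mem_rcons mem_head inE iarc => /(_ isT).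
Qed.

Lemma cycs_cut t : (t <= size w)%N ->
  cycs (cut t) (span s) = [set [set x in arc t]; [set x in coarc t]].
Proof.
move=> tw; have [c1 c2] := cut_fcycle tw; have := un_arcs t; rewrite cat_uniq.
case/and3P => u1 _ u2.
have -> : span s = [set x in arc t] :|: [set x in coarc t].
  rewrite spanE; apply/setP => x; rewrite in_setU !in_set -mem_cat -cats1.
  by rewrite -{1}(cat_take_drop t w) -cat_cons -catA cats1.
rewrite cycsU ?fcycle_stable // !fcycle_cycs //.
by case: (drop t w).
Qed.

Lemma cycs_self : cycs (ins i s) (span s) = [set [set x in rcons (k :: w) i]].
Proof. by rewrite spanE fcycle_cycs ?ins_self_fcycle ?un_full. Qed.

Lemma sum_span (V : nmodType) (F : T -> V) :
  (\sum_(j in span s) F j = F i + \sum_(t < (size w).+1) F (nth k (k :: w) t))%R.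
Proof.
rewrite spanE (eq_bigl (mem (rcons (k :: w) i))); last by move=> x; rewrite inE.
by rewrite -big_uniq ?un_full //= -rcons_cons big_rcons /= addrC (big_nth k) big_mkord.
Qed.

End Insertion.

Section Sums.

Variables (T : finType) (g' : {perm T}) (i : T) (s : {perm T}) (w : seq T).
Local Notation k := (g' i).
Hypotheses (cyc : fcycle s (k :: w)) (un : uniq (i :: k :: w)) (si : s i = i).
Variables (A : pzRingType) (C : comPzRingType) (b : T -> A).

Local Notation ins := (reinsert g' i).
Local Notation span := (ext_orbit g' i).
Local Open Scope ring_scope.

(** Here [x] is the label of [i] and [l] the labels along the cycle of [g' i]; as [i] comes just
    before [g' i], its label stands last. Term [t] cuts after t+1 labels: the first factor is never
    empty, and the last [t] leaves [x] alone. *)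
Definition split1 (h : seq A -> C) (x : A) (l : seq A) : C :=
  h (rcons l x) + \sum_(t < size l) h (take t.+1 l) * h (rcons (drop t.+1 l) x).

(** The derivative of [split1] in the direction [h2]: exactly one of the pieces is evaluated by
    [h2]. *)
Definition split2 (h h2 : seq A -> C) (x : A) (l : seq A) : C :=
  h2 (rcons l x) +
  \sum_(t < size l) (h2 (take t.+1 l) * h (rcons (drop t.+1 l) x) +
                     h (take t.+1 l) * h2 (rcons (drop t.+1 l) x)).

Section Functional.
Variables (h h2 : seq A -> C).
Hypotheses (hrot : rot_inv h) (h2rot : rot_inv h2).

Let u t c := h (cyc_args b t c).
Let v t c := h2 (cyc_args b t c).

Lemma arcs_args (f : seq A -> C) t : rot_inv f -> (t <= size w)%N ->
  let p := ins (nth k (k :: w) t) s in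
  (f (cyc_args b p [set x in k :: take t w]) = f (take t.+1 (map b (k :: w)))) /\
  (f (cyc_args b p [set x in rcons (drop t w) i]) =
    f (rcons (drop t.+1 (map b (k :: w))) (b i))).
Proof.
move=> fr tw p; have [c1 c2] := cut_fcycle cyc un si tw; have := un_arcs un t.
rewrite cat_uniq => /and3P[u1 _ u2].
by split; rewrite rot_inv_cyc //= ?map_rcons ?map_take ?map_drop.
Qed.

Lemma self_args (f : seq A -> C) : rot_inv f ->
  f (cyc_args b (ins i s) [set x in rcons (k :: w) i]) = f (rcons (map b (k :: w)) (b i)).
Proof.
move=> fr; rewrite rot_inv_cyc // ?map_rcons //; last exact: un_full.
exact: ins_self_fcycle.
Qed.

Lemma sum_prod_span :
  \sum_(j in span s) \prod_(e in cycs (ins j s) (span s)) u (ins j s) e =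
  split1 h (b i) (map b (k :: w)).
Proof.
rewrite (sum_span cyc un) (cycs_self cyc un si) big_set1 /u self_args // /split1.
congr (_ + _); rewrite size_map; apply: eq_bigr => t _.
have tw : (t <= size w)%N by rewrite -ltnS.
rewrite (cycs_cut cyc un si tw) big_setU1 ?(arc_neq un) //= big_set1.
by have [-> ->] := arcs_args hrot tw.
Qed.

Lemma sum_mark_span :
  \sum_(j in span s) mark (u (ins j s)) (v (ins j s)) (cycs (ins j s) (span s)) =
  split2 h h2 (b i) (map b (k :: w)).
Proof.
rewrite (sum_span cyc un) (cycs_self cyc un si) mark1 /v self_args // /split2.
congr (_ + _); rewrite size_map; apply: eq_bigr => t _.
have tw : (t <= size w)%N by rewrite -ltnS.
rewrite (cycs_cut cyc un si tw) mark_setU ?disjoints1 ?(arc_neq un) // !mark1 !big_set1 /u /v.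
have [-> ->] := arcs_args hrot tw.
by have [-> ->] := arcs_args h2rot tw.
Qed.

End Functional.
End Sums.

Local Open Scope ring_scope.

(** * Weights of permutations and their behaviour under reinsertion *)

Section Weights.
Variables (T : finType) (A : pzRingType) (C : comPzRingType).
Implicit Types (s : {perm T}) (X Z L R : {set T}) (b : T -> A).

(* [wt] is kappa_pi, restricted to the cycles inside [X]; [wt2] is the sum of the
   kappa_(V,pi) over the choices of a cycle in [L] and a cycle in [R] joined in V. *)
Definition wt (h : seq A -> C) b s X : C := \prod_(e in cycs s X) h (cyc_args b s e).

Definition wt2 (h : seq A -> C) (h2 : seq A -> seq A -> C) b s L R : C :=
  \sum_(d in cycs s R)
    mark (fun c => h (cyc_args b s c))
         (fun c => h2 (cyc_args b s c) (cyc_args b s d)) (cycs s L) *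
    \prod_(e in cycs s R :\ d) h (cyc_args b s e).

Lemma wt_split h b s X Z : stable X s -> X \subset Z -> stable Z s ->
  wt h b s Z = wt h b s X * wt h b s (Z :\: X).
Proof. exact: big_cycs_split. Qed.

Lemma eq_wt h b b' s s' X : {in X, s =1 s'} -> {in X, b =1 b'} ->
  stable X s -> stable X s' -> wt h b s X = wt h b' s' X.
Proof.
move=> ss bb sX sX'; rewrite /wt (cycs_agree ss) //; apply: eq_bigr => e.
rewrite -(cycs_agree ss) // => /cycsP[_ _ eX].
by rewrite (eq_cyc_args ss bb).
Qed.

Lemma wtD1 h b s X d : stable X s -> d \in cycs s X ->
  wt h b s (X :\: d) = \prod_(e in cycs s X :\ d) h (cyc_args b s e).
Proof.
move=> sX /cycsP[x -> sub]; apply: eq_bigl => e.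
have sd : stable (porbit s x) s by apply/stableP => y; apply: mem_porbit_perm.
rewrite in_setD1; apply/cycsP/andP => [[y -> sub2]|[ne /cycsP[y E sub2]]].
  split; last first.
    by apply/cycsP; exists y => //; apply: (subset_trans sub2); apply: subsetDl.
  apply: contraTneq sub2 => ->; apply/subsetPn; exists x; first exact: porbit_id.
  by rewrite inE porbit_id.
exists y => //; rewrite subsetD sub2 /=; apply/pred0P => z /=.
apply/negbTE; apply: contraNN ne; rewrite E -!eq_porbit_mem => /andP[/eqP-> /eqP->].
exact: eqxx.
Qed.

Lemma wt2_swap h h2 b s X Y :
  wt2 h (fun l1 l2 => h2 l2 l1) b s X Y = wt2 h h2 b s Y X.
Proof.
rewrite /wt2 /mark; under eq_bigr do rewrite big_distrl /=.
under [RHS]eq_bigr do rewrite big_distrl /=.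
by rewrite exchange_big; apply: eq_bigr => c _; apply: eq_bigr => d _; rewrite mulrAC.
Qed.

End Weights.

Section Insertion.

Variables (T : finType) (g' : {perm T}) (i : T) (s : {perm T}) (w : seq T).
Local Notation k := (g' i).
Hypotheses (cyc : fcycle s (k :: w)) (un : uniq (i :: k :: w)) (si : s i = i).
Variables (A : pzRingType) (C : comPzRingType) (b : T -> A).
Variables (h : seq A -> C) (hrot : rot_inv h).
Implicit Types (X Z L R : {set T}).

Local Notation ins := (reinsert g' i).
Local Notation span := (ext_orbit g' i).

Definition merge_label (x : T) : A := if x == k then b i * b k else b x.
Local Notation b1 := merge_label.

Lemma span_dis Z : [disjoint Z :\: span s & span s].
Proof. by rewrite -setI_eq0 setDE -setIA (setIC _ (span s)) setICr setI0. Qed.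

Lemma wt_ins_out X j : j \in span s -> [disjoint X & span s] -> stable X s ->
  wt h b (ins j s) X = wt h b s X.
Proof.
move=> jin dis sX; apply: eq_wt => //; last exact: stable_ins_out.
by move=> x xX; apply: ins_agree_out => //; rewrite (disjointFr dis).
Qed.

Lemma mark_ins_out (v : seq A -> C) X j : j \in span s -> [disjoint X & span s] ->
  stable X s ->
  mark (fun c => h (cyc_args b (ins j s) c)) (fun c => v (cyc_args b (ins j s) c))
    (cycs (ins j s) X) =
  mark (fun c => h (cyc_args b s c)) (fun c => v (cyc_args b s c)) (cycs s X).
Proof.
move=> jin dis sX; have sX' := stable_ins_out si jin dis sX.
have ag : {in X, ins j s =1 s}.
  by move=> x xX; apply: ins_agree_out => //; rewrite (disjointFr dis).
rewrite (cycs_ins_out si) //; apply: eq_mark => c /cycsP[_ _ cX];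
by rewrite (eq_cyc_args ag (fun _ _ => erefl)).
Qed.

Lemma sum_ins_wt Z : span s \subset Z -> stable Z s ->
  \sum_(j in span s) wt h b (ins j s) Z =
  split1 h (b i) (map b (k :: w)) * wt h b s (Z :\: span s).
Proof.
move=> sub sZ; have ss := stable_span_s g' si.
rewrite -(sum_prod_span cyc un si b hrot) big_distrl /=.
apply: eq_bigr => j jin; have sZD := stableD sZ ss.
rewrite (@wt_split _ _ _ _ _ _ (span s)) //; last exact: stable_ins_sup.
  by rewrite (wt_ins_out jin (span_dis _) sZD).
exact: stable_ins_sup.
Qed.

Lemma sum_ins_mark (v : seq A -> C) Z : rot_inv v -> span s \subset Z -> stable Z s ->
  \sum_(j in span s)
    mark (fun c => h (cyc_args b (ins j s) c)) (fun c => v (cyc_args b (ins j s) c))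
      (cycs (ins j s) Z) =
  split2 h v (b i) (map b (k :: w)) * wt h b s (Z :\: span s) +
  split1 h (b i) (map b (k :: w)) *
    mark (fun c => h (cyc_args b s c)) (fun c => v (cyc_args b s c))
      (cycs s (Z :\: span s)).
Proof.
move=> vrot sub sZ; have ss := stable_span_s g' si.
rewrite -(sum_prod_span cyc un si b hrot) -(sum_mark_span cyc un si b hrot vrot).
rewrite !big_distrl /= -big_split /=.
apply: eq_bigr => j jin; have sZD := stableD sZ ss.
have [E dis] : cycs (ins j s) Z = cycs (ins j s) (span s) :|: cycs (ins j s) (Z :\: span s)
  /\ [disjoint cycs (ins j s) (span s) & cycs (ins j s) (Z :\: span s)].
  by apply: cycs_split => //; apply: stable_ins_sup.
rewrite E mark_setU // (mark_ins_out v jin (span_dis _) sZD).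
by rewrite -/(wt h b (ins j s) (Z :\: span s)) (wt_ins_out jin (span_dis _) sZD).
Qed.

Lemma span_setD Z : Z :\: span s = (Z :\ i) :\: porbit s k.
Proof. by rewrite /ext_orbit setDDl. Qed.

Lemma args_merged (V : Type) (v : seq A -> V) : rot_inv v ->
  v (cyc_args b1 s (porbit s k)) = v (b i * b k :: map b w).
Proof.
move=> vrot; have /andP[_ unk] := un.
rewrite (fcycle_porbit cyc unk (mem_head _ _)) rot_inv_cyc //= /b1 eqxx.
congr (v (_ :: _)); apply/eq_in_map => x xw; case: eqP => // E.
by move: unk; rewrite /= -E xw.
Qed.

Lemma args_unmerged s' (e : {set T}) : stable (~: porbit s k) s' -> e \subset ~: porbit s k ->
  cyc_args b1 s' e = cyc_args b s' e.
Proof.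
move=> st; apply: eq_cyc_args => // x; rewrite inE /b1 => xk; case: eqP => // E.
by rewrite E porbit_id in xk.
Qed.

Lemma stable_porbitC : stable (~: porbit s k) s.
Proof. by rewrite stableC; apply/stableP => y; apply: mem_porbit_perm. Qed.

Lemma subDporbit Z : (Z :\ i) :\: porbit s k \subset ~: porbit s k.
Proof. by rewrite setDE subsetIr. Qed.

Lemma cycs_merged Z : span s \subset Z -> stable Z s ->
  cycs s (Z :\ i) = [set porbit s k] :|: cycs s (Z :\: span s) /\
  [disjoint [set porbit s k] & cycs s (Z :\: span s)].
Proof.
move=> /subsetP sub sZ; have sp : stable (porbit s k) s.
  by apply/stableP => y; apply: mem_porbit_perm.
have si1 : stable [set i] s.
  by apply/stableP => z; rewrite !inE -{1}si (inj_eq perm_inj).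
have sub2 : porbit s k \subset Z :\ i.
  apply/subsetP => x xk; rewrite !inE sub ?inE ?xk ?orbT // andbT.
  apply: contraTneq xk => ->; have /andP[_ unk] := un.
  rewrite (fcycle_porbit cyc unk (mem_head _ _)) inE.
  by have /andP[] := un.
have /andP[_ unk] := un.
have -> : [set porbit s k] = cycs s (porbit s k).
  by rewrite (fcycle_porbit cyc unk (mem_head _ _)) fcycle_cycs.
by rewrite span_setD; apply: cycs_split => //; apply: stableD.
Qed.

Lemma wt_merged Z : span s \subset Z -> stable Z s ->
  wt h b1 s (Z :\ i) = h (b i * b k :: map b w) * wt h b s (Z :\: span s).
Proof.
move=> sub sZ; have [E dis] := cycs_merged sub sZ.
rewrite /wt E big_setU_disjoint //= big_set1 args_merged //; congr (_ * _).
apply: eq_bigr => e /cycsP[_ _ eX]; rewrite args_unmerged ?stable_porbitC //.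
by apply: (subset_trans eX); rewrite span_setD subDporbit.
Qed.

Lemma mark_merged (v : seq A -> C) Z : rot_inv v -> span s \subset Z -> stable Z s ->
  mark (fun c => h (cyc_args b1 s c)) (fun c => v (cyc_args b1 s c)) (cycs s (Z :\ i)) =
  v (b i * b k :: map b w) * wt h b s (Z :\: span s) +
  h (b i * b k :: map b w) *
    mark (fun c => h (cyc_args b s c)) (fun c => v (cyc_args b s c))
      (cycs s (Z :\: span s)).
Proof.
move=> vrot sub sZ; have [E dis] := cycs_merged sub sZ.
rewrite E mark_setU // mark1 big_set1 !args_merged //.
have ag e : e \in cycs s (Z :\: span s) -> cyc_args b1 s e = cyc_args b s e.
  case/cycsP => _ _ eX; rewrite args_unmerged ?stable_porbitC //.
  by apply: (subset_trans eX); rewrite span_setD subDporbit.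
congr (_ * _ + _ * _); first by apply: eq_bigr => e /ag ->.
by apply: eq_mark => e /ag ->.
Qed.

Definition defect1 : C := split1 h (b i) (map b (k :: w)) - h (b i * b k :: map b w).

Lemma sum_ins_wt_defect Z : span s \subset Z -> stable Z s ->
  \sum_(j in span s) wt h b (ins j s) Z =
  wt h b1 s (Z :\ i) + defect1 * wt h b s (Z :\: span s).
Proof.
by move=> sub sZ; rewrite sum_ins_wt // wt_merged // /defect1; ring.
Qed.

Variable h2 : seq A -> seq A -> C.
Hypothesis h2rotl : forall l, rot_inv (h2^~ l).

(** The additional sum comes from the glueings: the whole cycle [z] of the other circle is inserted
    after [x], opened at any of its points, whence one rotation of [z] for each. *)
Definition splits2 (x : A) (l z : seq A) : C :=
  split2 h (h2^~ z) x l + \sum_(t < size z) h (rcons l x ++ rot t z).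

Definition defect2 (z : seq A) : C :=
  splits2 (b i) (map b (k :: w)) z - h2 (b i * b k :: map b w) z.

(** Glueing at the point of index [t] opens the other cycle after this point and so produces
    [rot t.+1], whereas [splits2] is written with [rot t]. *)
Lemma sum_rotS (F : seq A -> C) z :
  \sum_(t < size z) F (rot t.+1 z) = \sum_(t < size z) F (rot t z).
Proof.
case: z => [|x z]; first by rewrite !big_ord0.
rewrite [LHS]big_ord_recr [RHS]big_ord_recl /= addrC rot0 rot_oversize //.
Qed.

Lemma sum_cycs R (F : T -> C) : stable R s ->
  \sum_(j in R) F j = \sum_(d in cycs s R) \sum_(j in d) F j.
Proof.
move=> sR; rewrite (partition_big (porbit s) [in cycs s R]) /=; last first.
  by move=> j jR; rewrite cycs_porbit.
apply: eq_bigr => d /cycsP[x -> sub]; apply: eq_bigl => j.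
by rewrite eq_porbit_mem andb_idl // => /(subsetP sub).
Qed.

(** Only two cycles change: that of [g' i], with [i] added, and [d] become one. Its word is that of
    the first followed by a rotation of that of [d]; all other cycles factor out of the sum. *)
Lemma sum_merge_cycle L R d : [disjoint L & R] -> span s \subset L ->
  stable L s -> stable R s -> d \in cycs s R ->
  \sum_(j in d) wt h b (ins j s) (L :|: R) =
  (\sum_(t < size (cyc_args b s d))
     h (rcons (map b (k :: w)) (b i) ++ rot t (cyc_args b s d))) *
  (wt h b s (L :\: span s) * \prod_(e in cycs s R :\ d) h (cyc_args b s e)).
Proof.
move=> dis sub sL sR dR; have [x dE dsub] := cycsP _ _ _ dR.
have [p [cp up]] := porbit_fcycle s x; rewrite -dE => dEp.
have [n argsE] := fcycle_cyc_args b cp up; rewrite -dEp in argsE.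
set l := rot n (x :: p) in argsE.
have cl : fcycle s l by rewrite /l rot_cycle.
have ul : uniq l by rewrite /l rot_uniq.
have dl : d = [set y in l] by rewrite dEp; apply/setP => y; rewrite !inE /l mem_rot.
have sd : stable d s by rewrite dl; apply: fcycle_stable.
rewrite -wtD1 // argsE size_map big_distrl /=.
rewrite (eq_bigl (mem l)); last by move=> y; rewrite dl inE.
rewrite -big_uniq //= (big_nth x) big_mkord.
pose G z := h (rcons (map b (k :: w)) (b i) ++ z) *
   (wt h b s (L :\: span s) * wt h b s (R :\: d)).
have := sum_rotS G (map b l); rewrite /G size_map => <-; apply: eq_bigr => t _.
have tl := ltn_ord t; set j := nth x l t.
have El : rot t.+1 l = drop t.+1 l ++ rcons (take t l) j.
  by rewrite /rot -take_nth.
have [y [q yq]] : exists y q, rot t.+1 l = y :: q.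
  by rewrite El; case: (drop _ _) => [|y q]; [case: (take _ _) => [|y q]|];
    [exists j, [::]|exists y, (rcons q j)|exists y, (q ++ rcons (take t l) j)].
have lastj : last y q = j.
  by have := congr1 (last x) yq; rewrite El last_cat last_rcons.
have cq : fcycle s (y :: q) by rewrite -yq rot_cycle.
have memq z : (z \in y :: q) = (z \in d) by rewrite -yq mem_rot dl inE.
have ndL z : z \in d -> z \notin L.
  by move=> zd; rewrite (disjointFl dis) // (subsetP dsub).
have uq : uniq (rcons (k :: w) i ++ y :: q).
  rewrite cat_uniq un_full // -yq rot_uniq ul andbT -all_predC; apply/allP => z.
  rewrite mem_rot => zl /=; apply/negP => zf; have := ndL z.
  by rewrite dl inE zl (subsetP sub) ?(spanE cyc un) ?inE // => /(_ isT).
have cm := ins_merge_fcycle cyc un si cq uq; rewrite lastj in cm.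
have jd : j \in d by rewrite -memq -lastj mem_last.
set m := rcons (k :: w) i ++ y :: q in cm uq.
have mE : [set z in m] = span s :|: d.
  by apply/setP => z; rewrite (spanE cyc un) [LHS]in_set mem_cat memq in_setU in_set.
have sm : stable [set z in m] (ins j s) by apply: fcycle_stable.
have ss := stable_span_s g' si.
have iL : i \in L by apply: (subsetP sub); rewrite !inE eqxx.
have kL : k \in L by apply: (subsetP sub); rewrite !inE porbit_id orbT.
have jR : j \in R by apply: (subsetP dsub).
have sLR : stable (L :|: R) s.
  by apply/stableP => z; rewrite !inE (stableP _ _ sL) (stableP _ _ sR).
have sLR' : stable (L :|: R) (ins j s).
  by rewrite /reinsert stableM ?stableM ?stable_tperm ?inE ?iL ?kL ?jR ?orbT.
have restE : (L :|: R) :\: [set z in m] = (L :\: span s) :|: (R :\: d).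
  rewrite mE; apply/setP => z; rewrite in_setD !(in_setU z (_ : {set T}) d) !(in_setU z L) (in_setU z (L :\: _)) !in_setD.
  have [zL|zL] := boolP (z \in L).
    have -> : (z \in d) = false by apply: contraTF zL => /ndL.
    by rewrite (disjointFr dis zL); case: (z \in span s).
  have -> : (z \in span s) = false by apply/negbTE; apply: contraNN zL => /(subsetP sub).
  by case: (z \in d); case: (z \in R).
have restsub : (L :|: R) :\: [set z in m] \subset ~: [set z in m].
  by rewrite setDE subsetIr.
have srest : stable ((L :|: R) :\: [set z in m]) s.
  rewrite restE; apply/stableP => z.
  by rewrite !in_setU !in_setD (stableP _ _ sL) (stableP _ _ sR) (stableP _ _ ss) (stableP _ _ sd).
rewrite (@wt_split _ _ _ _ _ _ [set z in m]) //; last first.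
  by rewrite mE setUSS //.
congr (_ * _).
  rewrite /wt fcycle_cycs // big_set1 rot_inv_cyc // /m map_cat map_rcons -yq map_rot.
  by [].
set X := _ :\: _ in restsub srest *.
(* Away from the glued cycle no point is [i], [j] or [g' i], nor sent to one of them by [s]. *)
have agr : {in X, ins j s =1 s}.
  move=> z zX; have nm y' : y' \in X -> (y' == i) || (y' == j) || (y' == k) -> False.
    move/(subsetP restsub); rewrite in_setC mE !inE => /negP nm H; apply: nm.
    by case/orP: H => [/orP[]|] /eqP->; rewrite ?eqxx ?jd ?porbit_id ?orbT.
  have szX : s z \in X by rewrite (stableP _ _ srest).
  by apply: ins_id; apply/negP => E; [apply: (nm z zX)|apply: (nm z zX)|
     apply: (nm _ szX)|apply: (nm _ szX)]; rewrite E ?orbT.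
have srest' : stable X (ins j s) by apply: stableD.
rewrite (eq_wt h agr (fun _ _ => erefl) srest' srest) /X restE.
have sLs := stableD sL ss; have sRd := stableD sR sd.
rewrite (@wt_split _ _ _ _ _ _ (L :\: span s)) ?subsetUl //; last first.
  by rewrite -restE.
congr (_ * wt _ _ _ _); apply/setP => z; rewrite in_setD !(in_setU z (L :\: _)) !in_setD.
have [zL|zL] := boolP (z \in L); last by rewrite andbF.
by rewrite (disjointFr dis zL); case: (z \in span s); rewrite ?andbF.
Qed.

(** The marked cycle on the left circle either differs from the cycle of [g' i] or comes from it. In
    the first case the two sides differ by the first order defect, zero by assumption; in the
    second, the cuts together with the glueings at the points of [d] make up [defect2]. *)
Lemma sum_ins_wt2 L R : [disjoint L & R] -> span s \subset L ->
  stable L s -> stable R s -> defect1 = 0 ->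
  \sum_(j in span s) wt2 h h2 b (ins j s) L R + \sum_(j in R) wt h b (ins j s) (L :|: R) =
  wt2 h h2 b1 s (L :\ i) R +
  \sum_(d in cycs s R) defect2 (cyc_args b s d) *
    (wt h b s (L :\: span s) * \prod_(e in cycs s R :\ d) h (cyc_args b s e)).
Proof.
move=> dis sub sL sR /eqP; rewrite subr_eq0 => /eqP d1.
have disR : [disjoint R & span s].
  by rewrite disjoint_sym; apply: (disjointWl sub).
have Rk : R \subset ~: porbit s k.
  apply/subsetP => x xR; rewrite inE; apply: contraTN xR => xk.
  by rewrite (disjointFl disR) // !inE xk orbT.
have wtE j : j \in span s -> wt2 h h2 b (ins j s) L R = \sum_(d in cycs s R)
    mark (fun c => h (cyc_args b (ins j s) c))
      (fun c => h2 (cyc_args b (ins j s) c) (cyc_args b s d)) (cycs (ins j s) L) *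
    \prod_(e in cycs s R :\ d) h (cyc_args b s e).
  move=> jin; rewrite /wt2 (cycs_ins_out si jin disR sR).
  have sR' := stable_ins_out si jin disR sR.
  have ag e : e \in cycs s R -> cyc_args b (ins j s) e = cyc_args b s e.
    case/cycsP=> _ _ eR; apply: (eq_cyc_args _ (fun _ _ => erefl) sR' eR) => x xR.
    by apply: ins_agree_out => //; rewrite (disjointFr disR).
  apply: eq_bigr => d dR; congr (_ * _).
    by apply: eq_mark => c _ //=; rewrite (ag d).
  by apply: eq_bigr => e /setD1P[_ /ag->].
rewrite (eq_bigr _ wtE) exchange_big /= (@sum_cycs R _ sR) -big_split /=.
have ag e : e \in cycs s R -> cyc_args b1 s e = cyc_args b s e.
  case/cycsP => _ _ eR; rewrite args_unmerged ?stable_porbitC //.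
  exact: (subset_trans eR).
rewrite [wt2 h h2 b1 _ _ _]/wt2 -big_split /=; apply: eq_bigr => d dR.
rewrite -big_distrl /= (sum_ins_mark (h2rotl _)) // sum_merge_cycle //.
rewrite (mark_merged (h2rotl _)) // ag //.
have -> : \prod_(e in cycs s R :\ d) h (cyc_args b1 s e) =
          \prod_(e in cycs s R :\ d) h (cyc_args b s e).
  by apply: eq_bigr => e /setD1P[_ /ag->].
by rewrite /defect2 /splits2 -d1; ring.
Qed.

End Insertion.

(** * Extending permutations along an injection *)

Section Extension.
Variables (U T : finType) (f : U -> T).
Hypothesis finj : injective f.
Implicit Types (s t g : {perm U}) (u : U) (x : T) (X L R : {set U}).

Definition ext_fun s x := if [pick u | f u == x] is Some u then f (s u) else x.

Lemma ext_fun_f s u : ext_fun s (f u) = f (s u).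
Proof.
rewrite /ext_fun; case: pickP => [v /eqP/finj-> //|/(_ u)]; by rewrite eqxx.
Qed.

Lemma ext_fun_out s x : x \notin codom f -> ext_fun s x = x.
Proof.
rewrite /ext_fun; case: pickP => // v /eqP<-; by rewrite codom_f.
Qed.

Lemma ext_fun_inj s : injective (ext_fun s).
Proof.
suff K : cancel (ext_fun s) (ext_fun s^-1) by apply: can_inj K.
move=> x; have [/codomP[u ->]|out] := boolP (x \in codom f).
  by rewrite !ext_fun_f permK.
by rewrite !ext_fun_out.
Qed.

Definition ext s : {perm T} := perm (@ext_fun_inj s).

Lemma ext_f s u : ext s (f u) = f (s u).
Proof. by rewrite permE ext_fun_f. Qed.

Lemma ext_out s x : x \notin codom f -> ext s x = x.
Proof. by move=> out; rewrite permE ext_fun_out. Qed.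

Lemma extP (p : {perm T}) s : (forall u, p (f u) = f (s u)) ->
  (forall x, x \notin codom f -> p x = x) -> p = ext s.
Proof.
move=> H1 H2; apply/permP => x; have [/codomP[u ->]|out] := boolP (x \in codom f).
  by rewrite H1 ext_f.
by rewrite H2 ?ext_out.
Qed.

Lemma extM s t : ext (s * t)%g = (ext s * ext t)%g.
Proof.
by apply/esym/extP => [u|x out]; rewrite permM ?ext_f ?permM ?ext_out.
Qed.

Lemma ext1 : ext 1%g = 1%g.
Proof. by apply/esym/extP => [u|x out]; rewrite !perm1. Qed.

Lemma extV s : ext s^-1%g = (ext s)^-1%g.
Proof. by apply/(mulgI (ext s)); rewrite -extM !mulgV ext1. Qed.

Lemma ext_tperm u v : ext (tperm u v) = tperm (f u) (f v).
Proof.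
apply/esym/extP => [w|x out]; first by rewrite inj_tperm.
by rewrite tpermD //; apply: contraNneq out => <-; apply: codom_f.
Qed.

(** Added fixed points raise the number of points and the number of cycles equally. The proof peels
    transpositions instead, which [ext] carries to transpositions. *)
Lemma rl_ext s : rl (ext s) = rl s.
Proof.
elim/rl_ind: s => [|s i si E IH]; first by rewrite ext1 !rl1.
have ne : ext s (f i) != f i by rewrite ext_f (inj_eq finj).
by rewrite (rl_move ne) E -IH extM ext_tperm ext_f.
Qed.

Lemma ext_inj : injective ext.
Proof. by move=> s t E; apply/permP => u; apply: finj; rewrite -!ext_f E. Qed.

Lemma ext_geo g s : (ext s \in geo (ext g)) = (s \in geo g).
Proof. by rewrite !inE -extV -extM !rl_ext. Qed.

Lemma ext_stable L (L' : {set T}) s : (forall u, (f u \in L') = (u \in L)) ->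
  stable L' (ext s) = stable L s.
Proof.
move=> LL; apply/stableP/stableP => H x; first by rewrite -!LL -ext_f.
have [/codomP[u ->]|out] := boolP (x \in codom f); first by rewrite ext_f !LL.
by rewrite ext_out.
Qed.

Lemma perm_on_ext s : perm_on [set f u | u in U] (ext s).
Proof.
apply/subsetP => x; rewrite inE; apply: contraR => out; apply/eqP; apply: ext_out.
by apply: contra out => /codomP[u ->]; apply: imset_f.
Qed.

Lemma ext_ann g s L (L' : {set T}) : (forall u, (f u \in L') = (u \in L)) ->
  (ext s \in ann [set f u | u in U] (ext g) L') = (s \in ann setT g L).
Proof.
move=> LL; rewrite !inE -extV -extM !rl_ext perm_on_ext (ext_stable s LL).
by have -> : perm_on [set: U] s by apply/subsetP => x _; exact: in_setT.
Qed.

Lemma perm_on_extP (p : {perm T}) : perm_on [set f u | u in U] p ->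
  exists s, p = ext s.
Proof.
move=> on; have ex u : exists v, f v == p (f u).
  have : p (f u) \in [set f u | u in U] by rewrite perm_closed // imset_f.
  by case/imsetP => v _ ->; exists v.
pose r u := xchoose (ex u); have rE u : f (r u) = p (f u) by apply/eqP/(xchooseP (ex u)).
have rinj : injective r by move=> u v E; apply/finj/(@perm_inj _ p); rewrite -!rE E.
exists (perm rinj); apply: extP => [u|x out]; first by rewrite permE rE.
by apply: (out_perm on); apply: contra out => /imsetP[u _ ->]; apply: codom_f.
Qed.

Lemma geo_extE g : geo (ext g) = ext @: geo g.
Proof.
apply/setP => p; apply/idP/imsetP => [pg|[s sg ->]]; last by rewrite ext_geo.
have /perm_on_extP[s E] : perm_on [set f u | u in U] p.
  apply/subsetP => x; rewrite inE; apply: contraR => out; apply/eqP.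
  by apply: (geo_fix pg); apply: (out_perm (perm_on_ext g)).
by exists s; rewrite // -ext_geo -E.
Qed.

Lemma ann_extE g L (L' : {set T}) : (forall u, (f u \in L') = (u \in L)) ->
  ann [set f u | u in U] (ext g) L' = ext @: ann setT g L.
Proof.
move=> LL; apply/setP => p; apply/idP/imsetP => [pg|[s sg ->]]; last by rewrite (ext_ann g s LL).
have on : perm_on [set f u | u in U] p by move: pg; rewrite inE => /and3P[].
by have [s E] := perm_on_extP on; exists s; rewrite // -(ext_ann g s LL) -E.
Qed.

Lemma ext_exp s n u : (ext s ^+ n)%g (f u) = f ((s ^+ n)%g u).
Proof.
by elim: n => [|n IH]; rewrite ?perm1 // !expgSr !permM IH ext_f.
Qed.

Lemma porbit_ext s u : porbit (ext s) (f u) = f @: porbit s u.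
Proof.
apply/setP => x; apply/porbitP/imsetP => [[n ->]|[v /porbitP[n ->] ->]].
  by rewrite ext_exp; exists ((s ^+ n)%g u) => //; apply/porbitP; exists n.
by exists n; rewrite ext_exp.
Qed.

Lemma cycs_ext s X : cycs (ext s) (f @: X) = (fun c : {set U} => f @: c) @: cycs s X.
Proof.
apply/setP => c; apply/cycsP/imsetP => [[x -> sub]|[d /cycsP[u -> sub] ->]].
  have /imsetP[u uX xE] : x \in f @: X by apply: (subsetP sub); apply: porbit_id.
  rewrite xE porbit_ext in sub *; exists (porbit s u) => //; apply/cycsP; exists u => //.
  by apply/subsetP => v /(imset_f f)/(subsetP sub); rewrite mem_imset.
by exists (f u); rewrite ?porbit_ext // imsetS.
Qed.

Section ExtWeights.
Variables (A : pzRingType) (C : comPzRingType) (b : T -> A).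

Lemma ext_args (V : Type) (h : seq A -> V) s c : rot_inv h -> c \in porbits s ->
  h (cyc_args b (ext s) (f @: c)) = h (cyc_args (b \o f) s c).
Proof.
move=> hrot /imsetP[u _ ->]; have [p [cp up ->]] := porbit_fcycle s u.
have -> : f @: [set y in u :: p] = [set y in map f (u :: p)].
  apply/setP => x; rewrite inE; apply/imsetP/mapP => [[v]|[v]]; first by rewrite inE; exists v.
  by exists v; rewrite ?inE.
rewrite !rot_inv_cyc ?map_inj_uniq // -?map_comp //.
have /= := cp; rewrite -map_rcons; elim: (rcons p u) {1 3}u => //= v q IH w.
by case/andP => /eqP <- /IH ->; rewrite ext_f eqxx.
Qed.

Lemma ext_wt (h : seq A -> C) s X : rot_inv h ->
  wt h b (ext s) (f @: X) = wt h (b \o f) s X.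
Proof.
move=> hrot; rewrite /wt cycs_ext big_imset /=; last by move=> c d _ _; apply: imset_inj.
by apply: eq_bigr => c; rewrite inE => /andP[cs _]; apply: ext_args.
Qed.

Lemma imset_setD1 (D : {set {set U}}) (d : {set U}) : (fun c : {set U} => f @: c) @: D :\ (f @: d) =
  (fun c : {set U} => f @: c) @: (D :\ d).
Proof.
apply/setP => e; rewrite in_setD1; apply/andP/imsetP => [[ne /imsetP[c cD E]]|[c]].
  by exists c => //; rewrite in_setD1 cD andbT; apply: contraNneq ne => <-; rewrite E.
rewrite in_setD1 => /andP[ne cD] ->; split; last exact: imset_f.
by apply: contraNneq ne => /(imset_inj finj)->.
Qed.

Lemma ext_wt2 (h : seq A -> C) (h2 : seq A -> seq A -> C) s L R : rot_inv h ->
  (forall l, rot_inv (h2^~ l)) -> (forall l, rot_inv (h2 l)) ->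
  wt2 h h2 b (ext s) (f @: L) (f @: R) = wt2 h h2 (b \o f) s L R.
Proof.
move=> hr h2l h2r; rewrite /wt2 /mark !cycs_ext.
have inj (D : {set {set U}}) : {in D &, injective (fun c : {set U} => f @: c)}.
  by move=> c d _ _; apply: imset_inj.
rewrite big_imset //=; apply: eq_bigr => d dR.
have /andP[ds _] : (d \in porbits s) && (d \subset R) by move: dR; rewrite inE.
congr (_ * _).
  rewrite big_imset //=; apply: eq_bigr => c cL.
  have /andP[cs _] : (c \in porbits s) && (c \subset L) by move: cL; rewrite inE.
  rewrite (ext_args (h2r _) ds) (ext_args (h := h2^~ _) (h2l _) cs); congr (_ * _).
  rewrite imset_setD1 big_imset //=; apply: eq_bigr => e /setD1P[_].
  by rewrite inE => /andP[es _]; apply: ext_args.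
rewrite imset_setD1 big_imset //=; apply: eq_bigr => e /setD1P[_].
by rewrite inE => /andP[es _]; apply: ext_args.
Qed.

Lemma sum_geo_ext_wt (h : seq A -> C) g X : rot_inv h ->
  \sum_(p in geo (ext g)) wt h b p (f @: X) = \sum_(s in geo g) wt h (b \o f) s X.
Proof.
move=> hr; rewrite geo_extE big_imset /=; last by move=> s t _ _; apply: ext_inj.
by apply: eq_bigr => s _; apply: ext_wt.
Qed.

Lemma sum_ann_ext_wt (h : seq A -> C) g L (L' : {set T}) X : rot_inv h ->
  (forall u, (f u \in L') = (u \in L)) ->
  \sum_(p in ann [set f u | u in U] (ext g) L') wt h b p (f @: X) =
  \sum_(s in ann setT g L) wt h (b \o f) s X.
Proof.
move=> hr LL; rewrite (ann_extE _ LL) big_imset /=; last by move=> s t _ _; apply: ext_inj.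
by apply: eq_bigr => s _; apply: ext_wt.
Qed.

Lemma sum_geo_ext_wt2 (h : seq A -> C) (h2 : seq A -> seq A -> C) g L R : rot_inv h ->
  (forall l, rot_inv (h2^~ l)) -> (forall l, rot_inv (h2 l)) ->
  \sum_(p in geo (ext g)) wt2 h h2 b p (f @: L) (f @: R) =
  \sum_(s in geo g) wt2 h h2 (b \o f) s L R.
Proof.
move=> hr h2l h2r; rewrite geo_extE big_imset /=; last by move=> s t _ _; apply: ext_inj.
by apply: eq_bigr => s _; apply: ext_wt2.
Qed.

End ExtWeights.
End Extension.

Local Close Scope ring_scope.

(** * Non-crossing permutations are geodesic *)

Lemma porbit_eq (T : finType) (s : {perm T}) x y :
  y \in porbit s x -> porbit s x = porbit s y.
Proof. by rewrite -eq_porbit_mem => /eqP. Qed.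

Section Cyclic.

(* [y] lies strictly inside the cyclic arc from [x] to [z], which is everything but
   [x] when [x = z]. *)
Definition btw (x y z : nat) := [|| x < y < z, z <= x < y | y < z <= x].

Ltac btw_lia := rewrite /btw; lia.

Lemma btw_eq i u v : ~~ btw i u v -> ~~ btw i v u -> v = u.
Proof. btw_lia. Qed.

Lemma btw_refl i u : ~~ btw i u u.
Proof. btw_lia. Qed.

Lemma btw_step i y y' u : ~~ btw i y u -> y != i -> ~~ btw y i y' -> ~~ btw i y' u.
Proof. btw_lia. Qed.

Lemma btw_stuck i j u : ~~ btw i j u -> ~~ btw j i u -> i = j.
Proof. btw_lia. Qed.

Variable n : nat.
Implicit Types (s t : 'S_n) (x y z w i j : 'I_n).

Local Notation g := (gamma n).

(** Chord form of non-crossing: two points of one cycle never separate two points of another. As an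
    equality of order tests it is suited to linear arithmetic. *)
Definition uncrossed s := forall x y z w, z \notin porbit s x ->
  y \in porbit s x -> w \in porbit s z -> (z < x < w) = (z < y < w).

Definition increasing s := forall x y, y \in porbit s x -> ~~ btw x y (s x).

Lemma gamma_val i : (i.+1 = n /\ g i = 0 :> nat) \/ g i = i.+1 :> nat.
Proof.
rewrite permE /=; have := ltn_ord i; rewrite leq_eqVlt => /predU1P[->|lt].
  by rewrite modnn; left.
by rewrite modn_small //; right.
Qed.

Lemma gamma_stable (X : {set 'I_n}) x y : stable X g -> (x \in X) = (y \in X).
Proof.
move=> gX; have n0 : 0 < n by apply: leq_ltn_trans (ltn_ord x).
suff all z : (z \in X) = (Ordinal n0 \in X) by rewrite !all.
case: z => m; elim: m => [|m IH] lt; first by congr (_ \in X); apply: val_inj.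
have lt' : m < n by apply: ltnW.
rewrite -(IH lt') -(stableP _ _ gX (Ordinal lt')); congr (_ \in X); apply: val_inj.
by case: (gamma_val (Ordinal lt')) => [[/= E _]|//]; rewrite E ltnn in lt.
Qed.

Lemma porbit_gamma x : porbit g x = setT.
Proof.
apply/setP => y; rewrite in_setT -(porbit_id g x); apply: gamma_stable.
by apply/stableP => z; apply: mem_porbit_perm.
Qed.

Lemma porbits_porbit s x : porbit s x \in porbits s.
Proof. exact: imset_f. Qed.

Lemma noncrossing_porbits s : noncrossing (porbits s) <->
  forall p q a u b v, q \notin porbit s p -> a \in porbit s p -> b \in porbit s p ->
    u \in porbit s q -> v \in porbit s q -> ~~ ((a < u < b) && (b < v)).
Proof.
split=> [/forall_inP H p q a u b v qp ap bp uq vq|H].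
  have /forall_inP/(_ _ (porbits_porbit s q)) := H _ (porbits_porbit s p).
  rewrite eq_sym eq_porbit_mem qp /=; apply: contraNN => cr.
  apply/existsP; exists a; rewrite ap /=; apply/existsP; exists u; rewrite uq /=.
  by apply/existsP; exists b; rewrite bp /=; apply/existsP; exists v; rewrite vq.
apply/forall_inP => _ /imsetP[p _ ->]; apply/forall_inP => _ /imsetP[q _ ->].
apply/implyP; rewrite eq_sym eq_porbit_mem => qp; apply/negP.
case/existsP => a /andP[ap /existsP[u /andP[uq /existsP[b /andP[bp /existsP[v]]]]]].
case/andP => vq cr.
by have := H p q a u b v qp ap bp uq vq; rewrite cr.
Qed.

Lemma neq_porbit s p q a u : q \notin porbit s p -> a \in porbit s p ->
  u \in porbit s q -> a != u :> nat.
Proof.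
move=> qp; rewrite -!eq_porbit_mem => /eqP ap /eqP uq.
apply: contraNneq qp => /val_inj E; rewrite -eq_porbit_mem -ap E uq.
exact: eqxx.
Qed.

Lemma noncrossingP s : noncrossing (porbits s) <-> uncrossed s.
Proof.
split=> [/noncrossing_porbits noc x y z w zx yx wz|H].
  have xz : x \notin porbit s z by rewrite porbit_sym.
  have xx := porbit_id s x; have zz := porbit_id s z.
  (* If the two interval tests disagree, one of [x], [y] is inside the interval and the other to its
     left or right: four alternating patterns, each excluded by one instance of [noc]. *)
  have := noc x z x z y w zx xx yx zz wz; have := noc x z y z x w zx yx xx zz wz.
  have := noc z x z x w y xz zz wz xx yx; have := noc z x z y w x xz zz wz yx xx.
  have := neq_porbit zx xx zz; have := neq_porbit zx xx wz.
  have := neq_porbit zx yx zz; have := neq_porbit zx yx wz.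
  lia.
apply/noncrossing_porbits => p q a u b v qp ap bp uq vq.
have E x y : y \in porbit s x -> porbit s x = porbit s y.
  by rewrite -eq_porbit_mem => /eqP.
have qa : u \notin porbit s b.
  by rewrite -(E _ _ bp) porbit_sym -(E _ _ uq) porbit_sym.
have := H b a u v qa; rewrite -(E _ _ bp) -(E _ _ uq) => /(_ ap vq).
lia.
Qed.

Lemma sorted_enum (A : {set 'I_n}) : sorted ltn [seq val i | i <- enum A].
Proof.
have -> : [seq val i | i <- enum A] = [seq j <- iota 0 n | j \in map val (enum A)].
  have EA : enum A = [seq x <- enum 'I_n | x \in A] by rewrite [in RHS]enumT.
  rewrite -val_enum_ord filter_map; congr map; rewrite {1}EA; apply: eq_filter => x /=.
  by rewrite mem_map ?mem_enum //; apply: val_inj.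
by apply: sorted_filter; [exact: ltn_trans|exact: iota_ltn_sorted].
Qed.

Lemma next_enum (A : {set 'I_n}) x y : x \in A -> y \in A ->
  (next (enum A) x \in A) && ~~ btw x y (next (enum A) x).
Proof.
rewrite -!(mem_enum A) => xA yA; rewrite mem_next xA /=.
have so := sorted_enum A; have un := enum_uniq A.
move: (enum A) xA yA so un => c xA yA so un.
have mono k l : k < size c -> l < size c -> k < l -> nth x c k < nth x c l.
  move=> ks ls kl; have := sorted_ltn_nth ltn_trans (val x) so.
  by move=> /(_ k l); rewrite !inE size_map !(nth_map x) // => ->.
have mono2 k l : k < size c -> l < size c -> (nth x c k < nth x c l) = (k < l).
  move=> ks ls; apply/idP/idP => [|kl]; last exact: mono.
  apply: contraTT; rewrite -!leqNgt leq_eqVlt => /predU1P[->//|lk].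
  exact/ltnW/mono.
suff : ~~ btw (nth x c (index x c)) (nth x c (index y c)) (next c x).
  by rewrite !nth_index.
rewrite next_nth xA.
have ix : index x c < size c by rewrite index_mem.
have iy : index y c < size c by rewrite index_mem.
case E: c xA yA so un ix iy mono mono2 => [|z c'] // xA yA so un ix iy _ mono2.
rewrite -E in xA yA ix iy mono2 *.
have e2 : size c = (size c').+1 by rewrite E.
have [lt|ge] := ltnP (index x c) (size c').
  have -> : nth z c' (index x c) = nth x c (index x c).+1.
    by move: (index x c) lt => m lt; rewrite E /=; apply: set_nth_default.
  have l2 : (index x c).+1 < size c by rewrite e2.
  by rewrite /btw ?[nth x c _ <= _]leqNgt !mono2 //; lia.
(* Here [x] is the last entry, so [next] wraps around to the head. *)
rewrite (nth_default z ge); have -> : z = nth x c 0 by rewrite E.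
have l2 : 0 < size c by rewrite E.
by rewrite /btw ?[nth x c _ <= _]leqNgt !mono2 //; lia.
Qed.

Lemma increasingP s :
  (forall i, s i = next (enum (porbit s i)) i) <-> increasing s.
Proof.
split=> [H x y yx|H i].
  by rewrite H; have /andP[] := next_enum (porbit_id s x) yx.
have ii := porbit_id s i; have /andP[ni _] := next_enum ii ii.
have si : s i \in porbit s i by rewrite mem_porbit_perm.
have := H i _ ni; have /andP[_] := next_enum ii si.
by move=> h1 h2; apply/val_inj/(btw_eq h2 h1).
Qed.

Definition ncperm s := uncrossed s /\ increasing s.

Lemma NC_ncperm s : (s \in NC n) <-> ncperm s.
Proof.
rewrite inE; split=> [/andP[/noncrossingP uc /forallP inc]|[/noncrossingP uc /increasingP inc]].
  by split=> //; apply/increasingP => i; apply/eqP.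
by rewrite uc /=; apply/forallP => i; apply/eqP.
Qed.

(** The cut permutation sends [i] to [t j] and then follows [t]; it runs along the arc from [t j] to
    [i], where it closes up before it can meet [j]. *)
Lemma arc_porbit t i j y : increasing t -> j \in porbit t i -> i != j ->
  y \in porbit (tperm i j * t)%g i -> (y \in porbit t i) && ~~ btw i y (t j).
Proof.
move=> inc ji ij; set s := (tperm i j * t)%g => /porbitP[m ->]; elim: m => [|m].
  rewrite perm1 porbit_id /=; apply/negP => b; case/negP: ij; apply/eqP/val_inj.
  by move: b; rewrite /btw; lia.
set y' := (s ^+ m)%g i => /andP[yi yb].
rewrite expgSr permM -/y' permM; case: tpermP => [_|E|ny1 ny2].
- by rewrite mem_porbit_perm ji btw_refl.
- have ij' : i \in porbit t j by rewrite porbit_sym.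
  move: yb; rewrite E => yb; case/negP: ij; apply/eqP/val_inj.
  exact: btw_stuck yb (inc _ _ ij').
rewrite mem_porbit_perm yi /=; apply: (btw_step yb).
  by apply/eqP => /val_inj.
by apply: inc; rewrite porbit_sym.
Qed.

Lemma porbit_cut t i j x : x \in porbit t i -> 
  (x \in porbit (tperm i j * t)%g i) || (x \in porbit (tperm i j * t)%g j).
Proof.
set s := (tperm i j * t)%g => xi.
have st : stable (porbit s i :|: porbit s j) t.
  rewrite -(tperm_mulK i j t) -/s stableM //.
    by rewrite stable_tperm !inE !porbit_id orbT.
  by apply/stableP => y; rewrite !inE !mem_porbit_perm.
by have := stable_porbit st xi; rewrite !inE porbit_id.
Qed.

Lemma porbit_cut_sub t i j x y : j \in porbit t i ->
  y \in porbit (tperm i j * t)%g x -> y \in porbit t x.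
Proof.
move=> ji; set s := (tperm i j * t)%g => yx.
have st : stable (porbit t x) s.
  rewrite stableM //; last by apply/stableP => z; rewrite mem_porbit_perm.
  have /eqP E : porbit t j == porbit t i by rewrite eq_porbit_mem.
  by rewrite stable_tperm !(porbit_sym t _ x) E.
by rewrite (stable_porbit st yx) porbit_id.
Qed.

Lemma porbit_cut_out t i j x : j \in porbit t i -> x \notin porbit t i ->
  porbit (tperm i j * t)%g x = porbit t x.
Proof.
set s := (tperm i j * t)%g => ji xi.
rewrite -(@porbit_agree _ t s (porbit t x)) ?porbit_id //.
- move=> a ax; rewrite permM tpermD //.
    by apply: contraNneq xi => ia; rewrite porbit_sym ia.
  by apply: contraNneq xi => ia; move: ji; rewrite ia -!eq_porbit_mem => /eqP <-;
    move: ax; rewrite -eq_porbit_mem eq_sym.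
- by apply/stableP => a; rewrite mem_porbit_perm.
apply/stableP => a; rewrite permM; case: tpermP => [->|->|_ _].
- by rewrite mem_porbit_perm -!eq_porbit_mem (porbit_eq ji).
- by rewrite mem_porbit_perm -!eq_porbit_mem (porbit_eq ji).
by rewrite mem_porbit_perm.
Qed.

(** The pieces of a cut are separated by an ordinary interval, open at its left end: from [i] to [j]
    or from [j] to [i], according to their order. This lemma places the piece of [i]; [arc_in]
    places that of [j], using that the image of [i] is its cyclic successor. *)
Lemma arc_out (i j u x : nat) : i != j -> ~~ btw j i u -> ~~ btw i x u ->
  if i < j then ~~ (i < x <= j) else j < x <= i.
Proof. rewrite /btw; case: (ltnP i j); lia. Qed.

Lemma arc_in (i j gi z : nat) : (i.+1 = n /\ gi = 0) \/ gi = i.+1 -> i != j ->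
  j < n -> z < n -> ~~ btw j z gi -> if i < j then i < z <= j else ~~ (j < z <= i).
Proof. rewrite /btw => -[[E ->]|->]; case: (ltnP i j); lia. Qed.

Lemma interval_out (lo hi x y z w : nat) : ~~ (lo < x <= hi) -> ~~ (lo < y <= hi) ->
  lo < z <= hi -> lo < w <= hi -> (z < x < w) = (z < y < w).
Proof. lia. Qed.

Lemma interval_in (lo hi x y z w : nat) : lo < x <= hi -> lo < y <= hi ->
  ~~ (lo < z <= hi) -> ~~ (lo < w <= hi) -> (z < x < w) = (z < y < w).
Proof. lia. Qed.

(** A new crossing could only occur between the two pieces of the old cycle, which an interval
    separates; each piece is an arc of that cycle, so its increasing order persists. *)
Lemma ncperm_cut t i j : ncperm t -> t i = g i -> j \in porbit t i -> i != j ->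
  ncperm (tperm i j * t)%g.
Proof.
move=> [uc inc] ti ji ij; set s := (tperm i j * t)%g.
have ij' : i \in porbit t j by rewrite porbit_sym.
have arcI a : a \in porbit s i -> ~~ btw i a (t j).
  by move=> ai; have /andP[] := arc_porbit inc ji ij ai.
have arcJ a : a \in porbit s j -> ~~ btw j a (g i).
  move=> aj; have := @arc_porbit t j i a inc ij'; rewrite eq_sym tpermC -/s -ti.
  by case/(_ ij aj)/andP.
have nij : (i : nat) != j by apply: contraNneq ij => /val_inj->.
have gv := gamma_val i; have nb := inc j i ij'.
have outI a : a \in porbit s i -> if i < j then ~~ (i < a <= j) else j < a <= i.
  by move/arcI; apply: arc_out.
have inJ a : a \in porbit s j -> if i < j then i < a <= j else ~~ (j < a <= i).
  by move/arcJ; apply: arc_in.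
have E := @porbit_eq _ s.
split=> [x y z w zx yx wz|x y yx].
  have [zt|zt] := boolP (z \in porbit t x); last first.
    by apply: uc zt _ _; apply: porbit_cut_sub ji _.
  have [xi|xi] := boolP (x \in porbit t i); last first.
    by case/negP: zx; rewrite /s porbit_cut_out.
  have zi : z \in porbit t i by move: zt xi; rewrite -!eq_porbit_mem => /eqP->.
  have [xs|xs] := boolP (x \in porbit s i).
    have zs : z \in porbit s j.
      have := porbit_cut j zi; rewrite -/s => /orP[zs|//].
      by move: zx; rewrite -(E _ _ xs) zs.
    have ys : y \in porbit s i by rewrite (E _ _ xs).
    have ws : w \in porbit s j by rewrite (E _ _ zs).
    move: (outI x xs) (outI y ys) (inJ z zs) (inJ w ws); case: ltnP => _ h1 h2 h3 h4.
      exact: interval_out h1 h2 h3 h4.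
    exact: interval_in h1 h2 h3 h4.
  have {}xs : x \in porbit s j by have := porbit_cut j xi; rewrite -/s (negbTE xs).
  have zs : z \in porbit s i.
    have := porbit_cut j zi; rewrite -/s => /orP[//|zs].
    by move: zx; rewrite -(E _ _ xs) zs.
  have ys : y \in porbit s j by rewrite (E _ _ xs).
  have ws : w \in porbit s i by rewrite (E _ _ zs).
  move: (inJ x xs) (inJ y ys) (outI z zs) (outI w ws); case: ltnP => _ h1 h2 h3 h4.
    exact: interval_in h1 h2 h3 h4.
  exact: interval_out h1 h2 h3 h4.
rewrite /s permM; case: tpermP => [xi|xj|xi xj].
- by move: yx; rewrite xi => /arcI.
- by move: yx; rewrite xj => /arcJ; rewrite ti.
by apply: inc; apply: porbit_cut_sub ji yx.
Qed.

Lemma geo_ncperm s : s \in geo g -> ncperm s.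
Proof.
move: {2}(g * s^-1)%g (erefl (g * s^-1)%g) => k.
elim/rl_ind: k s => [|k i ki Ek IH] s Eks.
  have -> : s = g by rewrite -(perm_divK g s) Eks perm_mul1g.
  move=> _; split=> [x y z w|x y _]; first by rewrite porbit_gamma in_setT.
  have := gamma_val x; have := ltn_ord y; rewrite /btw; lia.
rewrite inE Eks => /eqP Es.
set j := k i in ki Ek IH; pose s' := (tperm i j * s)%g.
have Es' : (g * s'^-1)%g = (k * tperm i j)%g.
  by rewrite /s' perm_invM tpermV perm_mulA Eks.
have rls' : rl s' = (rl s).+1.
  by have := rl_triangle g s'; have := rl_tperm_le s i j; rewrite -/s' Es'; lia.
have s'g : s' \in geo g by rewrite inE Es' rls' -Es Ek; lia.
have sE : s = (tperm i j * s')%g by rewrite tperm_mulK.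
rewrite sE; apply: ncperm_cut (IH _ Es' s'g) _ _ _.
(* By definition of the complement, [k i = j] says that [s j] is the successor of [i]; this becomes
   the condition of [ncperm_cut] on [s']. *)
- have sj : s j = g i by rewrite /j -Eks permM permKV.
  by rewrite /s' permM tpermL.
- apply/negPn/negP; rewrite porbit_sym => H.
  have /eqP := rl_tperm_out H.
  by rewrite -sE rls' eqn_leq andbC ltnNge leqnSn.
by rewrite eq_sym.
Qed.

(** * Cyclic order around a point and its successor *)

Section Merge.
Variables i j gi si : nat.
Hypotheses (gv : (i.+1 = n /\ gi = 0) \/ gi = i.+1) (jn : j < n).

Lemma succ_neq : i != j -> i != gi.
Proof. move=> ij; case: gv => [[E ->]|->]; lia. Qed.

Lemma btw_pred : i != j -> btw j i gi.
Proof. move=> ij; rewrite /btw; case: gv => [[E ->]|->]; lia. Qed.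

Lemma btw_succ (y : nat) : y < n -> ~~ btw i y gi.
Proof. move=> yn; rewrite /btw; case: gv => [[E ->]|->]; lia. Qed.

Lemma between_succ (z w : nat) : z < n -> w < n -> z != i -> w != i -> z != gi -> w != gi ->
  (z < i < w) = (z < gi < w).
Proof. case: gv => [[E ->]|->]; lia. Qed.

Lemma btw_merge1 (y : nat) : i != j -> y < n -> ~~ btw j y gi -> si < n -> si != j -> si != gi ->
  (j < i < gi) = (j < si < gi) -> (gi < i < j) = (gi < si < j) -> ~~ btw j y si.
Proof. move=> ij yn; rewrite /btw; case: gv => [[E ->]|->]; lia. Qed.

Lemma btw_merge2 (y : nat) : i != j -> y < n -> si < n -> si != j -> si != gi ->
  y != j -> y != gi -> i != gi -> 
  (j < i < gi) = (j < si < gi) -> (gi < i < j) = (gi < si < j) ->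
  (j < i < gi) = (j < y < gi) -> (gi < i < j) = (gi < y < j) -> ~~ btw i y si ->
  ~~ btw j y si.
Proof. move=> ij yn; rewrite /btw; case: gv => [[E ->]|->]; lia. Qed.

Lemma btw_merge3 (x y sx : nat) : x < n -> y < n -> sx < n -> x != i -> sx != i -> y != x ->
  y != sx -> sx != gi ->
  (x < i < sx) = (x < y < sx) -> (sx < i < x) = (sx < y < x) -> ~~ btw x gi sx ->
  ~~ btw x y sx.
Proof. move=> xn yn sxn; rewrite /btw; case: gv => [[E ->]|->]; lia. Qed.

Lemma btw_merge4 (x y sx : nat) : x < n -> y < n -> sx < n -> x != i -> x != gi -> sx != gi ->
  y != x -> y != sx ->
  (x < gi < sx) = (x < y < sx) -> (sx < gi < x) = (sx < y < x) -> ~~ btw x i sx ->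
  ~~ btw x y sx.
Proof. move=> xn yn sxn; rewrite /btw; case: gv => [[E ->]|->]; lia. Qed.

End Merge.

(** Crossing of two chords is symmetric; this exchanges the roles of the two cycles. *)
Lemma between_swap (x y z w : nat) : x != z -> x != w -> y != z -> y != w ->
  (x < z < y) = (x < w < y) -> (y < z < x) = (y < w < x) ->
  (z < x < w) = (z < y < w).
Proof. lia. Qed.

Lemma uncrossed_orbits s p q x y z w : uncrossed s -> q \notin porbit s p ->
  x \in porbit s p -> y \in porbit s p -> z \in porbit s q -> w \in porbit s q ->
  (z < x < w) = (z < y < w).
Proof.
move=> uc qp xp yp zq wq; apply: uc.
- by rewrite -(porbit_eq xp) porbit_sym -(porbit_eq zq) porbit_sym.
- by rewrite -(porbit_eq xp).
by rewrite -(porbit_eq zq).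
Qed.

(** Converse of [ncperm_cut]. The two glued cycles contain the adjacent points [i] and [g i], which
    no third cycle can separate, so their union crosses nothing. *)
Lemma ncperm_merge s i j : ncperm s -> s j = g i -> i != j ->
  i \notin porbit s j /\ ncperm (tperm i j * s)%g.
Proof.
move=> [uc inc] sj ij; have gv := gamma_val i; have jn := ltn_ord j.
have nij : (i : nat) != j by apply: contraNneq ij => /val_inj->.
(* Otherwise [i] would lie strictly between [j] and its image [g i], against [increasing]. *)
have iB : i \notin porbit s j.
  by apply/negP => /inc; rewrite sj (btw_pred gv jn nij).
split=> //; set t := (tperm i j * s)%g.
have st : s = (tperm i j * t)%g by rewrite tperm_mulK.
have jt : j \in porbit t i.
  apply/negPn/negP; rewrite porbit_sym => /rl_tperm_out; rewrite -st => /eqP.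
  by rewrite (rl_tperm_out iB) eqn_leq andbC ltnNge leqnSn.
have ti : t i = g i by rewrite permM tpermL.
have tj : t j = s i by rewrite permM tpermR.
have tE x : x != i -> x != j -> t x = s x.
  by move=> xi xj; rewrite permM tpermD // eq_sym.
clearbody t.
have giB : g i \in porbit s j by rewrite -sj mem_porbit_perm porbit_id.
have iC := porbit_id s i; have jB := porbit_id s j.
have siC : s i \in porbit s i by rewrite mem_porbit_perm.
have jC : j \notin porbit s i by rewrite porbit_sym.
have inD x : x \in porbit t i -> (x \in porbit s i) || (x \in porbit s j).
  by move/(porbit_cut j); rewrite -st.
have outD x : x \notin porbit t i -> porbit t x = porbit s x.
  by move=> xt; rewrite -(porbit_cut_out jt xt) -st.
have neq x y : x \in porbit t i -> y \notin porbit t i -> (x : nat) != y.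
  by move=> xD yD; apply: contraNneq yD => /val_inj <-.
have giD : g i \in porbit t i by rewrite -ti mem_porbit_perm porbit_id.
have iD := porbit_id t i.
(* A chord of another cycle has the old cycle of [i] on one side, and likewise that of [j]; the
   adjacency of [i] and [g i] makes it the same side for both. *)
have uc2 x y z w : x \in porbit t i -> y \in porbit t x -> z \notin porbit t i ->
    w \in porbit t z -> (z < x < w) = (z < y < w).
  move=> xD yx zD wz; have yD : y \in porbit t i by rewrite (porbit_eq xD).
  have wD : w \notin porbit t i by rewrite porbit_sym -(porbit_eq wz) porbit_sym.
  have ws : w \in porbit s z by rewrite -(outD _ zD).
  have bs : (z < i < w) = (z < g i < w).
    by apply: (between_succ gv jn) => //; rewrite eq_sym neq.
  have zs v : v \in porbit t i -> z \notin porbit s v.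
    move=> vD; apply: contraNN zD => zv; rewrite (porbit_eq vD).
    by apply: (porbit_cut_sub jt); rewrite -st.
  suff all v : v \in porbit t i -> (z < v < w) = (z < i < w) by rewrite !all.
  move=> vD; have zz := porbit_id s z; case/orP: (inD _ vD) => [vC|vB].
    exact: uncrossed_orbits uc (zs i iD) vC iC zz ws.
  by rewrite bs; apply: uncrossed_orbits uc (zs j jt) vB giB zz ws.
have gin := succ_neq gv jn nij.
have nB x : x \in porbit s i -> (x : nat) != j /\ (x : nat) != g i.
  by move=> xC; split; apply: (neq_porbit (s := s) (p := i) (q := j)) => //.
split=> [x y z w zx yx wz|x y yx].
  have [xD|xD] := boolP (x \in porbit t i).
    by apply: uc2 => //; apply: contraNN zx => zD; rewrite -(porbit_eq xD).
  have [zD|zD] := boolP (z \in porbit t i); last first.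
    by apply: uc; rewrite -outD.
  have yD : y \notin porbit t i by rewrite porbit_sym -(porbit_eq yx) porbit_sym.
  have wD : w \in porbit t i by rewrite (porbit_eq zD).
  have xy : x \in porbit t y by rewrite porbit_sym.
  by apply: between_swap; rewrite 1?eq_sym ?neq //; apply: uc2.
have sCB u v z w : u \in porbit s i -> v \in porbit s i -> z \in porbit s j ->
    w \in porbit s j -> (z < u < w) = (z < v < w).
  exact: uncrossed_orbits uc jC.
have sBC u v z w : u \in porbit s j -> v \in porbit s j -> z \in porbit s i ->
    w \in porbit s i -> (z < u < w) = (z < v < w).
  exact: uncrossed_orbits uc iB.
(* Only [i] and [j] have new images. For the other points, a [y] in the opposite piece is handled by
   [btw_merge3] and [btw_merge4], since the pieces did not cross before. *)
have [/eqP|xi] := eqVneq x i.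
  by move/eqP->; rewrite ti (btw_succ gv jn).
have [sij sig] := nB _ siC.
have [xj|xj] := eqVneq x j.
  rewrite xj tj.
  have h1 : (j < i < g i) = (j < s i < g i) by apply: sCB.
  have h2 : (g i < i < j) = (g i < s i < j) by apply: sCB.
  have yD : y \in porbit t i by rewrite (porbit_eq jt) -xj.
  case/orP: (inD _ yD) => [yC|yB]; last first.
    by apply: (@btw_merge1 i j (g i) (s i) gv jn) => //; rewrite -sj; apply: inc.
  have [yj yg] := nB _ yC.
  apply: (@btw_merge2 i j (g i) (s i) gv jn) => //; [exact: sCB|exact: sCB|exact: inc].
rewrite tE //; have [xD|xD] := boolP (x \in porbit t i); last first.
  by apply: inc; rewrite -outD.
have yD : y \in porbit t i by rewrite (porbit_eq xD).
have xi' : (x : nat) != i by apply: contraNneq xi => /val_inj->.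
have sxg : (s x : nat) != g i.
  by apply: contraNneq xj => /val_inj; rewrite -sj => /perm_inj->.
case/orP: (inD _ xD) => [xC|xB]; case/orP: (inD _ yD) => [yC|yB].
- by apply: inc; rewrite -(porbit_eq xC).
- have sxC : s x \in porbit s i by rewrite mem_porbit_perm.
  have [xj' xg] := nB _ xC.
  apply: (btw_merge4 gv jn) => //.
  + by rewrite eq_sym; apply: (neq_porbit (s := s) (p := i) (q := j)).
  + by rewrite eq_sym; apply: (neq_porbit (s := s) (p := i) (q := j)).
  + exact: sBC.
  + exact: sBC.
  by apply: inc; rewrite -(porbit_eq xC).
- have sxB : s x \in porbit s j by rewrite mem_porbit_perm.
  apply: (btw_merge3 gv jn) => //.
  + by rewrite eq_sym; apply: (neq_porbit (s := s) (p := i) (q := j)).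
  + by apply: (neq_porbit (s := s) (p := i) (q := j)).
  + by apply: (neq_porbit (s := s) (p := i) (q := j)).
  + exact: sCB.
  + exact: sCB.
  by apply: inc; rewrite -(porbit_eq xB).
by apply: inc; rewrite -(porbit_eq xB).
Qed.

Lemma ncperm_geo s : ncperm s -> s \in geo g.
Proof.
move: {2}(g * s^-1)%g (erefl (g * s^-1)%g) => k.
elim/rl_ind: k s => [|k i ki Ek IH] s Eks.
  have -> : s = g by rewrite -(perm_divK g s) Eks perm_mul1g.
  by move=> _; apply: geo_id.
set j := k i in ki Ek IH => nc.
have sj : s j = g i by rewrite /j -Eks permM permKV.
have [|ins nct] := ncperm_merge nc sj; first by rewrite eq_sym.
have Et : (g * (tperm i j * s)^-1)%g = (k * tperm i j)%g.
  by rewrite perm_invM tpermV perm_mulA Eks.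
have := IH _ Et nct; rewrite inE => /eqP; rewrite Et (rl_tperm_out ins) => E.
by rewrite inE Eks Ek -E addSnnS.
Qed.

Lemma NC_geo : NC n = geo g.
Proof.
by apply/setP => s; apply/idP/idP => [/NC_ncperm/ncperm_geo|/geo_ncperm/NC_ncperm].
Qed.

End Cyclic.

(** * Two circles *)

(** As [t] fixes the image of [f], every transposition peeled off the second factor also shortens
    the product: lengths add for disjoint supports. *)
Lemma rl_mul_ext (U T : finType) (f : U -> T) (finj : injective f) (t : {perm T})
    (s : {perm U}) :
  (forall u, t (f u) = f u) -> rl (t * ext finj s)%g = rl t + rl s.
Proof.
move=> tf; elim/rl_ind: s => [|s i si E IH]; first by rewrite ext1 mulg1 rl1 addn0.
have Pf : (t * ext finj s)%g (f i) = f (s i) by rewrite permM tf ext_f.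
have ne : (t * ext finj s)%g (f i) != f i by rewrite Pf (inj_eq finj).
rewrite (rl_move ne) Pf E addnS -IH extM ext_tperm; congr (rl _).+1.
by rewrite perm_mulA.
Qed.

Lemma rl_shift_neq p q (j : 'I_q) (i : 'I_p) : rshift p j = lshift q i -> False.
Proof. by move=> E; have := eq_rlshift j i; rewrite E eqxx. Qed.

Section TwoCircles.
Variables p q : nat.

Local Notation lsh := (@lshift_inj p q).
Local Notation rsh := (@rshift_inj p q).
Local Notation Lp := (left_part p q).
Local Notation Rp := (right_part p q).
Implicit Types (s : 'S_p) (t : 'S_q) (r : 'S_(p + q)).

Lemma prod_perm_l s t i : prod_perm s t (lshift q i) = lshift q (s i).
Proof. by rewrite permE /prod_perm_fun -[lshift q i]/(unsplit (inl i)) unsplitK. Qed.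

Lemma prod_perm_r s t j : prod_perm s t (rshift p j) = rshift p (t j).
Proof. by rewrite permE /prod_perm_fun -[rshift p j]/(unsplit (inr j)) unsplitK. Qed.

Variant split_ord_spec : 'I_(p + q) -> Type :=
| SplitL i : split_ord_spec (lshift q i)
| SplitR j : split_ord_spec (rshift p j).

Lemma splitOrdP x : split_ord_spec x.
Proof. by rewrite -(splitK x); case: split => ?; constructor. Qed.

Lemma lshift_left i : lshift q i \in Lp. Proof. by apply/imsetP; exists i. Qed.

Lemma rshift_left j : (rshift p j \in Lp) = false.
Proof. by apply/imsetP => -[i _ /rl_shift_neq]. Qed.

Lemma rightE : Rp = ~: Lp.
Proof.
apply/setP => x; rewrite in_setC; case: (splitOrdP x) => [i|j].
  by rewrite lshift_left; apply/imsetP => -[j _ /esym/rl_shift_neq].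
by rewrite rshift_left; apply/imsetP; exists j.
Qed.

Lemma leftrightU : Lp :|: Rp = setT. Proof. by rewrite rightE setUCr. Qed.

Lemma leftright_disjoint : [disjoint Lp & Rp].
Proof. by rewrite rightE -subsets_disjoint. Qed.

Lemma prod_permE s t : prod_perm s t = (ext lsh s * ext rsh t)%g.
Proof.
apply/permP => x; rewrite permM; case: (splitOrdP x) => [i|j].
  rewrite prod_perm_l ext_f ext_out //; apply/codomP => -[j].
  by move/esym/rl_shift_neq.
rewrite prod_perm_r [ext lsh s _]ext_out ?ext_f //; apply/codomP => -[u].
by move/rl_shift_neq.
Qed.

Lemma rl_prod s t : rl (prod_perm s t) = rl s + rl t.
Proof.
rewrite prod_permE rl_mul_ext ?rl_ext // => j; apply: ext_out.
by apply/codomP => -[i /rl_shift_neq].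
Qed.

Lemma prod_permM s t s' t' :
  (prod_perm s t * prod_perm s' t' = prod_perm (s * s') (t * t'))%g.
Proof.
apply/permP => x; rewrite permM; case: (splitOrdP x) => i.
  by rewrite !prod_perm_l permM.
by rewrite !prod_perm_r permM.
Qed.

Lemma prod_perm1 : prod_perm 1 1 = 1%g :> 'S_(p + q).
Proof.
apply/permP => x; case: (splitOrdP x) => i; rewrite ?prod_perm_l ?prod_perm_r !perm1 //.
Qed.

Lemma prod_permV s t : ((prod_perm s t)^-1 = prod_perm s^-1 t^-1)%g.
Proof. by apply/(mulgI (prod_perm s t)); rewrite mulgV prod_permM !mulgV prod_perm1. Qed.

Lemma stable_prod s t : stable Lp (prod_perm s t).
Proof.
apply/stableP => x; case: (splitOrdP x) => i.
  by rewrite prod_perm_l !lshift_left.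
by rewrite prod_perm_r !rshift_left.
Qed.

Lemma stable_prodP r : stable Lp r -> exists s t, r = prod_perm s t.
Proof.
move=> /stableP rL.
have exl i : exists j, lshift q j == r (lshift q i).
  have := rL (lshift q i); rewrite lshift_left; case: (splitOrdP (r _)) => j; first by exists j.
  by rewrite rshift_left.
have exr i : exists j, rshift p j == r (rshift p i).
  have := rL (rshift p i); rewrite rshift_left; case: (splitOrdP (r _)) => j; last by exists j.
  by rewrite lshift_left.
have El i : lshift q (xchoose (exl i)) = r (lshift q i) by apply/eqP/(xchooseP (exl i)).
have Er i : rshift p (xchoose (exr i)) = r (rshift p i) by apply/eqP/(xchooseP (exr i)).
have injl : injective (fun i => xchoose (exl i)).
  by move=> i j E; apply/lsh/(@perm_inj _ r); rewrite -!El E.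
have injr : injective (fun i => xchoose (exr i)).
  by move=> i j E; apply/rsh/(@perm_inj _ r); rewrite -!Er E.
exists (perm injl), (perm injr); apply/permP => x; case: (splitOrdP x) => i.
  by rewrite prod_perm_l permE El.
by rewrite prod_perm_r permE Er.
Qed.

Lemma stable_gamma2 : stable Lp (gamma2 p q).
Proof. exact: stable_prod. Qed.

(** Lengths add over the circles, and equality in the sum of two triangle inequalities forces
    equality in each. *)
Lemma geo_prod s t :
  (prod_perm s t \in geo (gamma2 p q)) = (s \in geo (gamma p)) && (t \in geo (gamma q)).
Proof.
rewrite !inE prod_permV prod_permM !rl_prod.
have := rl_triangle (gamma p) s; have := rl_triangle (gamma q) t.
by move=> h1 h2; apply/eqP/andP => [E|[/eqP E1 /eqP E2]]; [split; apply/eqP|]; lia.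
Qed.

Lemma NCxNC_geo : NCxNC p q = geo (gamma2 p q).
Proof.
apply/setP => r; apply/imset2P/idP => [[s t sN tN ->]|rg].
  by rewrite geo_prod -!NC_geo sN tN.
have [s [t E]] := stable_prodP (geo_stable rg stable_gamma2).
by move: rg; rewrite E geo_prod -!NC_geo => /andP[sN tN]; exists s t.
Qed.

Lemma gamma2_stable_l (X : {set 'I_(p + q)}) i j : stable X (gamma2 p q) ->
  (lshift q i \in X) = (lshift q j \in X).
Proof.
move=> gX; have := @gamma_stable p [set k | lshift q k \in X] i j; rewrite !inE; apply.
by apply/stableP => k; rewrite !inE -(prod_perm_l _ (gamma q)) (stableP _ _ gX).
Qed.

Lemma gamma2_stable_r (X : {set 'I_(p + q)}) i j : stable X (gamma2 p q) ->
  (rshift p i \in X) = (rshift p j \in X).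
Proof.
move=> gX; have := @gamma_stable q [set k | rshift p k \in X] i j; rewrite !inE; apply.
by apply/stableP => k; rewrite !inE -(prod_perm_r (gamma p)) (stableP _ _ gX).
Qed.

End TwoCircles.

Lemma rl_gamma n : 0 < n -> rl (gamma n) = n.-1.
Proof.
move=> n0; rewrite /rl card_ord.
have -> : porbits (gamma n) = [set setT].
  apply/setP => c; rewrite inE; apply/imsetP/eqP => [[x _ ->]|->].
    exact: porbit_gamma.
  by exists (Ordinal n0); rewrite ?porbit_gamma.
by rewrite cards1 subn1.
Qed.

Lemma ncycles_rl n (s : 'S_n) : ncycles s + rl s = n.
Proof. by rewrite /rl card_ord subnKC // -{2}(card_ord n) leq_card_porbits. Qed.

Lemma SNC_ann p q : 0 < p -> 0 < q -> SNC p q = ann setT (gamma2 p q) (left_part p q).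
Proof.
move=> p0 q0; apply/setP => s; rewrite !inE.
have -> : perm_on [set: 'I_(p + q)] s by apply/subsetP => x _; rewrite inE.
rewrite andTb; congr (_ && _).
  apply/exists_inP/idP => [[_ /imsetP[x _ ->]] /andP[/set0Pn[y] /setIP[yx yL] /set0Pn[z]]|].
    rewrite rightE => /setIP[zx]; rewrite in_setC; apply: contraNN => sL.
    by rewrite (stable_porbit sL zx) -(stable_porbit sL yx).
  move=> /forallPn[x]; case xL: (x \in left_part p q) => sxL.
    exists (porbit s x); rewrite ?porbits_porbit //; apply/andP; split; apply/set0Pn.
      by exists x; rewrite in_setI porbit_id xL.
    exists (s x); rewrite in_setI mem_porbit_perm porbit_id rightE in_setC.
    by case: (s x \in _) sxL.
  exists (porbit s x); rewrite ?porbits_porbit //; apply/andP; split; apply/set0Pn.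
    exists (s x); rewrite in_setI mem_porbit_perm porbit_id.
    by case: (s x \in _) sxL.
  by exists x; rewrite in_setI porbit_id rightE in_setC xL.
(* Since [rl (gamma2 p q)] is p+q-2, passing from cycle counts to lengths turns the total p+q+2 into
   the excess of 2. *)
have := ncycles_rl s; have := ncycles_rl (gamma2 p q * s^-1)%g.
have := ncycles_rl (gamma2 p q); rewrite rl_prod !rl_gamma //.
by move=> h1 h2 h3; apply/eqP/eqP; lia.
Qed.

(** * Partitions with one joined pair of cycles *)

Section JoinedPartition.
Variables p q : nat.
Local Notation Lp := (left_part p q).
Local Notation Rp := (right_part p q).
Implicit Types (s : 'S_(p + q)) (c d e V W : {set 'I_(p + q)}).

Definition joined s c d : {set {set 'I_(p + q)}} := (c :|: d) |: (porbits s :\ c :\ d).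

Lemma cycles_in_porbit s c : c \in porbits s -> cycles_in s c = [set c].
Proof.
move=> /imsetP[x _ ->]; apply/setP => e; rewrite !inE.
apply/andP/eqP => [[/imsetP[y _ ->] sub]|->].
  by apply/eqP; rewrite eq_porbit_mem; apply: (subsetP sub); apply: porbit_id.
by rewrite porbits_porbit.
Qed.

Lemma porbits_disjoint s c d : c \in porbits s -> d \in porbits s -> c != d ->
  [disjoint c & d].
Proof.
move=> /imsetP[x _ ->] /imsetP[y _ ->] ne; apply/pred0P => z /=.
by apply/negbTE; apply: contraNN ne; rewrite -!eq_porbit_mem => /andP[/eqP-> /eqP->].
Qed.

Lemma cycsin s X c : c \in cycs s X -> c \in porbits s.
Proof. by rewrite inE => /andP[]. Qed.

Lemma cycs_sub s X c : c \in cycs s X -> c \subset X.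
Proof. by rewrite inE => /andP[]. Qed.

Section WithPair.
Variables (s : 'S_(p + q)) (c d : {set 'I_(p + q)}).
Hypotheses (sL : stable Lp s) (cL : c \in cycs s Lp) (dR : d \in cycs s Rp).

Lemma pair_neq : c != d.
Proof.
apply/eqP => E; have := porbits_n0 (cycsin cL); case/negP; rewrite -subset0.
have <- : Lp :&: Rp = set0 by apply/disjoint_setI0/leftright_disjoint.
by rewrite subsetI (cycs_sub cL) E (cycs_sub dR).
Qed.

Lemma pair_interL : (c :|: d) :&: Lp = c.
Proof.
rewrite setIUl (setIidPl (cycs_sub cL)) (_ : d :&: Lp = set0) ?setU0 //.
apply/disjoint_setI0; rewrite disjoint_sym.
exact: disjointWr (cycs_sub dR) (leftright_disjoint p q).
Qed.

Lemma pair_interR : (c :|: d) :&: Rp = d.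
Proof.
rewrite setIUl (setIidPl (cycs_sub dR)) (_ : c :&: Rp = set0) ?set0U //.
apply/disjoint_setI0.
exact: disjointWl (cycs_sub cL) (leftright_disjoint p q).
Qed.

Lemma cycles_in_pair : cycles_in s (c :|: d) = [set c; d].
Proof.
apply/setP => e; rewrite !inE; apply/andP/orP => [[es sub]|[/eqP->|/eqP->]]; last first.
- by rewrite (cycsin dR) subsetUr.
- by rewrite (cycsin cL) subsetUl.
have := es => /imsetP[x _ eE].
have xcd : x \in c :|: d by apply: (subsetP sub); rewrite eE porbit_id.
have [//|ec] := eqVneq e c; first by left.
have [//|ed] := eqVneq e d; first by right.
move: xcd; rewrite in_setU eE in ec ed *.
case/orP => [xc|xd].
  by have := disjointFr (porbits_disjoint (porbits_porbit s x) (cycsin cL) ec) (porbit_id s x);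
    rewrite xc.
by have := disjointFr (porbits_disjoint (porbits_porbit s x) (cycsin dR) ed) (porbit_id s x);
    rewrite xd.
Qed.

Lemma pair_notin : c :|: d \notin porbits s.
Proof.
apply/negP => cd; have := cycles_in_porbit cd; rewrite cycles_in_pair => E.
have /set1P E1 : c \in [set c :|: d] by rewrite -E !inE eqxx.
have /set1P E2 : d \in [set c :|: d] by rewrite -E !inE eqxx orbT.
by have := pair_neq; rewrite {1}E1 -E2 eqxx.
Qed.

Lemma joinedP V : V \in joined s c d ->
  V = c :|: d \/ [/\ V \in porbits s, V != c & V != d].
Proof. by rewrite !inE => /orP[/eqP->|/and3P[]]; [left|right]. Qed.

Lemma joined_disjoint V W : V \in joined s c d -> W \in joined s c d -> V != W ->
  [disjoint V & W].
Proof.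
have dis e : [/\ e \in porbits s, e != c & e != d] -> [disjoint e & c :|: d].
  case=> es ec ed; rewrite -setI_eq0 setIUr setU_eq0 !setI_eq0.
  by rewrite !(porbits_disjoint es) ?(cycsin cL) ?(cycsin dR).
move=> /joinedP[->|HV] /joinedP[->|HW]; first by rewrite eqxx.
- by move=> _; rewrite disjoint_sym dis.
- by move=> _; rewrite dis.
by case: HV HW => Vs _ _ [Ws _ _]; apply: porbits_disjoint Vs Ws.
Qed.

Lemma mem_joined x : exists2 V, V \in joined s c d & porbit s x \subset V.
Proof.
have [E|nc] := eqVneq (porbit s x) c.
  by exists (c :|: d); rewrite ?setU11 // E subsetUl.
have [E|nd] := eqVneq (porbit s x) d.
  by exists (c :|: d); rewrite ?setU11 // E subsetUr.
by exists (porbit s x); rewrite // !inE nc nd porbits_porbit orbT.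
Qed.

Lemma joined_PSNC' : s \in geo (gamma2 p q) -> (joined s c d, s) \in PSNC' p q.
Proof.
move=> sg; rewrite /PSNC' in_set /= NCxNC_geo sg; apply/and3P; split => //.
  rewrite /is_partitioned_perm /=; apply/andP; split; last first.
    apply/forall_inP => _ /imsetP[x _ ->]; have [V Vj sub] := mem_joined x.
    by apply/exists_inP; exists V.
  apply/and3P; split.
  - apply/eqP/setP => x; rewrite inE; have [V Vj sub] := mem_joined x.
    by apply/bigcupP; exists V => //; apply: (subsetP sub); apply: porbit_id.
  - by apply/trivIsetP => V W; apply: joined_disjoint.
  apply/negP => /joinedP[E|[/porbits_n0]]; last by rewrite eqxx.
  have := porbits_n0 (cycsin cL); case/negP; rewrite -subset0 E; exact: subsetUl.
apply/exists_inP; exists (c :|: d); first exact: setU11.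
apply/andP; split.
  apply/exists_inP; exists c; first exact: cycsin cL.
  apply/exists_inP; exists d; first exact: cycsin dR.
  by rewrite (cycs_sub cL) (cycs_sub dR) cycles_in_pair eqxx.
apply/forall_inP => V /joinedP[->|[Vs _ _]]; first by rewrite eqxx.
by rewrite cycles_in_porbit // cards1 eqxx implybT.
Qed.

End WithPair.

(** [c :|: d] is the only block that is not a cycle, and its traces on the two circles are [c] and
    [d]. *)
Lemma joined_inj s c d c' d' : stable Lp s -> c \in cycs s Lp -> d \in cycs s Rp ->
  c' \in cycs s Lp -> d' \in cycs s Rp -> joined s c d = joined s c' d' ->
  c = c' /\ d = d'.
Proof.
move=> sL cL dR cL' dR' E.
have : c :|: d \in joined s c' d' by rewrite -E setU11.
case/joinedP => [E2|[]]; last by rewrite (negbTE (pair_notin cL dR)).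
by split; [rewrite -(pair_interL cL dR) E2 (pair_interL cL' dR')|
  rewrite -(pair_interR cL dR) E2 (pair_interR cL' dR')].
Qed.

(** A block meeting a cycle contains it, so blocks are unions of cycles: a block with a single cycle
    is that cycle, and the exceptional block is the union of its two. *)
Lemma PSNC'_joined (V : {set {set 'I_(p + q)}}) s : (V, s) \in PSNC' p q ->
  s \in geo (gamma2 p q) /\ exists c d, [/\ c \in cycs s Lp, d \in cycs s Rp & V = joined s c d].
Proof.
rewrite /PSNC' in_set /= NCxNC_geo => /and3P[/andP[/= part /forall_inP cover]] sg.
have [/eqP cov triv V0] := and3P part.
case/exists_inP => W WV /andP[/exists_inP[c cs /exists_inP[d ds]]].
case/and3P => cL dR /eqP EW /forall_inP single.
split=> //; exists c, d; split; rewrite ?inE ?cs ?ds //.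
have mem B e x : B \in V -> e \in porbits s -> x \in B -> x \in e -> e \subset B.
  move=> BV es xB xe; have /exists_inP[B' B'V sub] := cover e es.
  by rewrite (_ : B = B') //; apply/eqP/negPn/negP => ne;
     have := disjointFr (trivIsetP triv B B' BV B'V ne) xB; rewrite (subsetP sub).
have blockE B x : B \in V -> x \in B -> porbit s x \in cycles_in s B.
  by move=> BV xB; rewrite inE porbits_porbit (mem B _ x) ?porbits_porbit ?porbit_id.
have cW : c \subset W by have := setU11 c [set d]; rewrite -EW inE => /andP[].
have dW : d \subset W by have := set22 c d; rewrite -EW inE => /andP[].
have WE : W = c :|: d.
  apply/eqP; rewrite eqEsubset subUset cW dW !andbT; apply/subsetP => x xW.
  have := blockE W x WV xW; rewrite EW in_setU => /set2P[<-|<-]; rewrite porbit_id ?orbT //.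
have other B : B \in V -> B != W -> exists2 e, e \in porbits s & B = e.
  move=> BV BW; have /implyP/(_ BW)/cards1P[e Ee] := single B BV.
  have eB : e \in cycles_in s B by rewrite Ee set11.
  exists e; first by move: eB; rewrite inE => /andP[].
  apply/eqP; rewrite eqEsubset; apply/andP; split; last by move: eB; rewrite inE => /andP[].
  apply/subsetP => x xB; have := blockE B x BV xB; rewrite Ee => /set1P <-.
  exact: porbit_id.
have VP B : (B \in V) = (B \in joined s c d).
  apply/idP/idP => [BV|/joinedP[->|[Bs Bc Bd]]].
  - rewrite in_setU1 -WE; have [//|BW] := eqVneq B W.
    have [e es BE] := other B BV BW; rewrite !in_setD1 BE es andbT -BE /=.
    have dis := trivIsetP triv B W BV WV BW.
    have [x xB] : exists x, x \in B by apply/set0Pn; rewrite BE; apply: porbits_n0 es.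
    have xW := disjointFr dis xB.
    apply/andP; split; apply/eqP => E; move: xW; rewrite WE in_setU -E xB ?orbT //.
  - by rewrite -WE.
  have /exists_inP[B' B'V sub] := cover B Bs.
  have B'W : B' != W.
    apply/eqP => E; have : B \in cycles_in s W by rewrite inE Bs -E.
    by rewrite EW !inE (negbTE Bc) (negbTE Bd).
  have [e es B'E] := other B' B'V B'W.
  by have := cycles_in_porbit es => /setP/(_ B); rewrite !inE Bs -B'E sub => /esym/eqP->.
by apply/setP.
Qed.

Section Sum.
Variables (R : realType) (A : algType R[i]) (k1 : seq A -> R[i]).
Variables (k2 : seq A -> seq A -> R[i]) (a : 'I_(p + q) -> A).
Local Open Scope ring_scope.

Lemma kappa_block1 s e : e \in porbits s -> kappa_block k1 k2 a s e = k1 (cyc_args a s e).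
Proof.
by move=> es; rewrite /kappa_block cycles_in_porbit // cards1 eqxx big_set1.
Qed.

Lemma kappa_pp_SNC s : kappa_pp k1 k2 a (porbits s, s) = wt k1 a s setT.
Proof.
by rewrite /kappa_pp /wt cycsT; apply: eq_bigr => e es; apply: kappa_block1.
Qed.

Lemma kappa_pp_joined s c d : stable Lp s -> c \in cycs s Lp -> d \in cycs s Rp ->
  kappa_pp k1 k2 a (joined s c d, s) =
  (k2 (cyc_args a s c) (cyc_args a s d) *
    \prod_(e in cycs s Lp :\ c) k1 (cyc_args a s e)) *
    \prod_(e in cycs s Rp :\ d) k1 (cyc_args a s e).
Proof.
move=> sL cL dR; rewrite /kappa_pp /= big_setU1 /=; last first.
  by rewrite !inE (negbTE (pair_notin cL dR)) !andbF.
rewrite -mulrA; congr (_ * _).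
  rewrite /kappa_block cycles_in_pair // cards2 (pair_neq cL dR) /=.
  rewrite (big_pred1 c) => [|e]; last first.
    rewrite !inE; have [->|ne] := eqVneq e c; first by rewrite (cycs_sub cL).
    have [->|//] := eqVneq e d; rewrite /=.
    apply/negP => dL; have := porbits_n0 (cycsin dR); case/negP; rewrite -subset0.
    have <- : Lp :&: Rp = set0 by apply/disjoint_setI0/leftright_disjoint.
    by rewrite subsetI dL (cycs_sub dR).
  rewrite (big_pred1 d) // => e.
  rewrite !inE; have [->|ne] := eqVneq e d; first by rewrite (cycs_sub dR) orbT.
  rewrite orbF; have [->|//] := eqVneq e c; rewrite /=.
  apply/negP => dL; have := porbits_n0 (cycsin cL); case/negP; rewrite -subset0.
  have <- : Lp :&: Rp = set0 by apply/disjoint_setI0/leftright_disjoint.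
  by rewrite subsetI dL (cycs_sub cL).
have sR : stable Rp s by rewrite rightE stableC.
have E : porbits s = cycs s Lp :|: cycs s Rp by rewrite -cycsU // leftrightU cycsT.
have dis : [disjoint cycs s Lp & cycs s Rp].
  apply/pred0P => e /=; apply/negP => /andP[eL eR].
  have := porbits_n0 (cycsin eL); case/negP; rewrite -subset0.
  have <- : Lp :&: Rp = set0 by apply/disjoint_setI0/leftright_disjoint.
  by rewrite subsetI (cycs_sub eL) (cycs_sub eR).
have -> : porbits s :\ c :\ d = (cycs s Lp :\ c) :|: (cycs s Rp :\ d).
  apply/setP => e; rewrite E !in_setD1 !in_setU !in_setD1.
  have [->|ed] := eqVneq e d; first by rewrite (disjointFl dis dR) andbF.
  have [->|//] := eqVneq e c; first by rewrite (disjointFr dis cL).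
rewrite big_setU_disjoint /=; last first.
  by apply: (disjointWl (subD1set _ _)); apply: (disjointWr (subD1set _ _)).
congr (_ * _); apply: eq_bigr => e /setD1P[_ /cycsin]; exact: kappa_block1.
Qed.

Lemma sum_PSNC' (Q : pred 'S_(p + q)) :
  \sum_(x in PSNC' p q | Q x.2) kappa_pp k1 k2 a x =
  \sum_(s in geo (gamma2 p q) | Q s) wt2 k1 k2 a s Lp Rp.
Proof.
pose P := [set t : 'S_(p + q) * ({set 'I_(p + q)} * {set 'I_(p + q)}) |
  (t.1 \in geo (gamma2 p q)) && Q t.1 &
  (t.2.1 \in cycs t.1 Lp) && (t.2.2 \in cycs t.1 Rp)].
pose f (t : 'S_(p + q) * ({set 'I_(p + q)} * {set 'I_(p + q)})) :=
  (joined t.1 t.2.1 t.2.2, t.1).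
transitivity (\sum_(t in P) kappa_pp k1 k2 a (f t)).
  have inj : {in P &, injective f}.
    move=> [s [c d]] [s' [c' d']]; rewrite /P in_set => /andP[/andP[/= sg _] /andP[cL dR]].
    rewrite in_set => /andP[_ /andP[/= cL' dR']] [E Es].
    have sL := geo_stable sg (stable_gamma2 p q).
    rewrite -Es in E cL' dR' *.
    by have [-> ->] := joined_inj sL cL dR cL' dR' E.
  rewrite -(big_imset (kappa_pp k1 k2 a) inj) /=.
  apply: eq_bigl => -[V s] /=; apply/andP/imsetP => [[VP Qs]|[[s' [c d]]]].
    have [sg [c [d [cL dR ->]]]] := PSNC'_joined VP.
    by exists (s, (c, d)); rewrite // /P in_set /= sg Qs cL dR.
  rewrite /P in_set /= => /andP[/andP[sg Qs] /andP[cL dR]] [-> ->]; split=> //.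
  exact: joined_PSNC' cL dR sg.
rewrite (eq_bigl (fun t => ((t.1 \in geo (gamma2 p q)) && Q t.1) &&
  ((t.2.1 \in cycs t.1 Lp) && (t.2.2 \in cycs t.1 Rp)))); last by move=> t; rewrite /P in_set.
rewrite -(pair_big_dep (fun s => (s \in geo (gamma2 p q)) && Q s)
  (fun s z => (z.1 \in cycs s Lp) && (z.2 \in cycs s Rp))
  (fun s z => kappa_pp k1 k2 a (f (s, z)))) /=.
apply: eq_bigr => s /andP[sg _]; have sL := geo_stable sg (stable_gamma2 p q).
rewrite -(pair_big (fun c => c \in cycs s Lp) (fun d => d \in cycs s Rp)
  (fun c d => kappa_pp k1 k2 a (f (s, (c, d))))) /= exchange_big /=.
apply: eq_bigr => d dR; rewrite /mark big_distrl /=; apply: eq_bigr => c cL.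
exact: kappa_pp_joined.
Qed.

(** The two parts of [PSNC] are disjoint because a geodesic preserves the circles and an annular
    permutation does not. With [Q] arbitrary, the formula serves both the relation defining the
    cumulants and the theorem. *)
Lemma sum_PSNC (Q : pred 'S_(p + q)) : (0 < p)%N -> (0 < q)%N ->
  \sum_(x in PSNC p q | Q x.2) kappa_pp k1 k2 a x =
  \sum_(s in ann setT (gamma2 p q) Lp | Q s) wt k1 a s setT +
  \sum_(s in geo (gamma2 p q) | Q s) wt2 k1 k2 a s Lp Rp.
Proof.
move=> p0 q0; rewrite -sum_PSNC' -SNC_ann //.
have dis : [disjoint [set (porbits s, s) | s in SNC p q] & PSNC' p q].
  apply/pred0P => -[V s] /=; apply/negP => /andP[/imsetP[t tS [_ st]]].
  case/PSNC'_joined => sg _; have := geo_stable sg (stable_gamma2 p q).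
  by move: tS; rewrite SNC_ann // -st inE => /and3P[_ /negbTE->].
rewrite [LHS]big_mkcondr /= big_setU_disjoint //=.
congr (_ + _); last by rewrite -big_mkcondr.
  rewrite big_imset /=; last by move=> s t _ _ [].
  by rewrite -big_mkcondr /=; apply: eq_bigr => s _; apply: kappa_pp_SNC.
Qed.

End Sum.
End JoinedPartition.

Local Open Scope ring_scope.

(** * Splitting one product *)

Section Step.

Variables (T : finType) (A : pzRingType) (C : comPzRingType).
Variables (h : seq A -> C) (h2 : seq A -> seq A -> C).
Hypothesis hrot : rot_inv h.
Hypothesis h2rotl : forall l, rot_inv (h2^~ l).

Implicit Types (s : {perm T}) (x j : T).

Definition arest s x := traject s (s x) #|porbit s x|.-1.

Lemma arestP s x : fcycle s (x :: arest s x) /\ uniq (x :: arest s x).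
Proof.
have E : x :: arest s x = traject s x #|porbit s x|.
  by rewrite /arest; case: #|_| (card_porbit_neq0 s x).
split; last by rewrite E uniq_traject_porbit.
rewrite /= rcons_path fpath_traject last_traject /=; apply/eqP.
rewrite -[RHS](iter_porbit s x) -iterS prednK //.
by rewrite lt0n card_porbit_neq0.
Qed.

Variables (g' : {perm T}) (i : T) (M' L : {set T}).
Hypotheses (gi : g' i != i) (iM : i \in M') (iL : i \in L).
Hypotheses (gM : perm_on M' g') (gL : stable L g').
Variable b : T -> A.

Local Notation k := (g' i).
Local Notation g := (remove_point g' i).
Local Notation M := (M' :\ i).
Local Notation b1 := (merge_label g' i b).

Lemma arest_uniq s : s i = i -> uniq (i :: k :: arest s k).
Proof.
move=> si; have [cyc un] := arestP s k; rewrite /= in un *; rewrite un andbT inE negb_or.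
rewrite eq_sym gi /=; apply/negP => iw.
have := fcycle_porbit cyc un (mem_head _ _).
move=> E; have : i \in porbit s k by rewrite E !inE iw orbT.
by rewrite porbit_sym (porbit_fix si) inE (negbTE gi).
Qed.

Lemma step_perm_on s : perm_on M s -> s i = i /\ stable M' s.
Proof.
move=> on; split; first by apply: (out_perm on); rewrite !inE eqxx.
apply/stableP => x; apply: perm_closed; apply: (subset_trans on); apply: subsetDl.
Qed.

(** Trivial predicates when moments are compared; the separation condition on the complement in the
    final iteration. *)
Variables (Q' Q : pred {perm T}).
Hypothesis QQ : forall s j, perm_on M s -> j \in M' -> Q' (reinsert g' i j s) = Q s.

Definition step_defect1 s := defect1 g' i (arest s k) b h * wt h b s (M' :\: ext_orbit g' i s).

Lemma step_geo_wt :
  \sum_(s in geo g' | Q' s) wt h b s M' =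
  \sum_(s in geo g | Q s) wt h b1 s M + \sum_(s in geo g | Q s) step_defect1 s.
Proof.
rewrite big_mkcondr (sum_geo_ins gi) -big_split [RHS]big_mkcondr /=.
apply: eq_bigr => s sg.
have on := geo_perm_on iM gM sg; have [si sM'] := step_perm_on on.
have sub := span_sub iM gM on; have [cyc un] := arestP s k.
rewrite -(sum_ins_wt_defect cyc (arest_uniq si) si b hrot sub sM').
by case Qs: (Q s); [|apply: big1]; try apply: eq_bigr; move=> j js; rewrite QQ ?Qs ?(subsetP sub).
Qed.

(** The annular permutations obtained by glueing come from geodesics. They are left as a separate
    sum, to be absorbed in [step_geo_wt2], where they complete [splits2]. *)
Lemma step_ann_wt : (forall (x y : A) (l : seq A), split1 h x (y :: l) = h (x * y :: l)) ->
  \sum_(s in ann M' g' L | Q' s) wt h b s M' =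
  \sum_(s in ann M g L | Q s) wt h b1 s M +
  \sum_(s in geo g | Q s) \sum_(j in M' :\: L) wt h b (reinsert g' i j s) M'.
Proof.
move=> E1; rewrite big_mkcondr (sum_ann_ins gi iM gM gL).
rewrite [\sum_(s in ann M g L | Q s) _]big_mkcondr.
rewrite [\sum_(s in geo g | Q s) _]big_mkcondr /=; congr (_ + _); apply: eq_bigr => s sg.
  have on : perm_on M s by move: sg; rewrite inE => /andP[].
  have [si sM'] := step_perm_on on.
  have sub := span_sub iM gM on; have [cyc un] := arestP s k.
  have -> : wt h b1 s M = \sum_(j in ext_orbit g' i s) wt h b (reinsert g' i j s) M'.
    rewrite (sum_ins_wt_defect cyc (arest_uniq si) si b hrot sub sM').
    by rewrite /defect1 /= E1 subrr mul0r addr0.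
  by case Qs: (Q s); [|apply: big1]; try apply: eq_bigr; move=> j js; rewrite QQ ?Qs ?(subsetP sub).
have on := geo_perm_on iM gM sg.
have -> : \sum_(j in M' :\: L) wt h b (reinsert g' i j s) M' =
          \sum_(j in M | (j \in L) != (i \in L)) wt h b (reinsert g' i j s) M'.
  apply: eq_bigl => j; rewrite !inE iL eqb_id.
  by case: eqP => [->|_] /=; rewrite ?iL ?andbF // andbC.
by case Qs: (Q s); [|apply: big1]; try apply: eq_bigr;
  move=> j; rewrite !inE => /andP[/andP[_ jM] _]; rewrite QQ ?Qs.
Qed.

Definition step_defect2 s :=
  \sum_(d in cycs s (M' :\: L)) defect2 g' i (arest s k) b h h2 (cyc_args b s d) *
   (wt h b s (M' :&: L :\: ext_orbit g' i s) *
    \prod_(e in cycs s (M' :\: L) :\ d) h (cyc_args b s e)).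

Lemma step_geo_wt2 : (forall (x y : A) (l : seq A), split1 h x (y :: l) = h (x * y :: l)) ->
  \sum_(s in geo g' | Q' s) wt2 h h2 b s (M' :&: L) (M' :\: L) +
  \sum_(s in geo g | Q s) \sum_(j in M' :\: L) wt h b (reinsert g' i j s) M' =
  \sum_(s in geo g | Q s) wt2 h h2 b1 s (M :&: L) (M :\: L) +
  \sum_(s in geo g | Q s) step_defect2 s.
Proof.
move=> E1; rewrite big_mkcondr (sum_geo_ins gi).
rewrite -[RHS]big_split [X in _ + X]big_mkcondr [RHS]big_mkcondr -big_split /=.
apply: eq_bigr => s sg.
have on := geo_perm_on iM gM sg; have [si sM'] := step_perm_on on.
have sub := span_sub iM gM on; have [cyc un] := arestP s k.
have sL : stable L s := geo_stable sg (stable_del i gL).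
have subL : ext_orbit g' i s \subset M' :&: L.
  apply/subsetP => j js; rewrite in_setI (subsetP sub) //=.
  by rewrite (span_side gL sL js).
have dis : [disjoint M' :&: L & M' :\: L].
  by rewrite -setI_eq0 setDE setIACA setICr setI0.
have := @sum_ins_wt2 _ g' i s (arest s k) cyc (arest_uniq si) si _ _ b _ hrot _
  h2rotl (M' :&: L) (M' :\: L) dis subL (stableI sM' sL) (stableD sM' sL).
rewrite setID => /(_ _) E; rewrite (setIDAC M' [set i] L : M :&: L = _).
have -> : M :\: L = M' :\: L.
  by rewrite setDDl (setUidPr _) // sub1set.
case Qs: (Q s).
  rewrite /step_defect2 -E; last by rewrite /defect1 /= E1 subrr.
  congr (_ + _); apply: eq_bigr => j js; rewrite QQ ?Qs //; exact: (subsetP sub).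
by rewrite addr0 big1 // => j js; rewrite QQ ?Qs //; apply: (subsetP sub).
Qed.

Lemma step : (forall (x y : A) (l : seq A), split1 h x (y :: l) = h (x * y :: l)) ->
  \sum_(s in ann M' g' L | Q' s) wt h b s M' +
  \sum_(s in geo g' | Q' s) wt2 h h2 b s (M' :&: L) (M' :\: L) =
  \sum_(s in ann M g L | Q s) wt h b1 s M +
  \sum_(s in geo g | Q s) wt2 h h2 b1 s (M :&: L) (M :\: L) +
  \sum_(s in geo g | Q s) step_defect2 s.
Proof.
move=> E1; rewrite step_ann_wt // -[RHS]addrA -step_geo_wt2 // -addrA.
by congr (_ + _); rewrite addrC.
Qed.

End Step.

Local Close Scope ring_scope.

(** * Cycle sizes bounded by reflection length *)

Section CycleSizes.
Variable T : finType.
Implicit Types (s : {perm T}) (c d : {set T}).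

Lemma rl_sum s : rl s = \sum_(c in porbits s) #|c|.-1.
Proof.
have E : #|T| = \sum_(c in porbits s) #|c|.
  rewrite -sum1_card (partition_big (porbit s) [in porbits s]) /=; last first.
    by move=> x _; apply: imset_f.
  apply: eq_bigr => _ /imsetP[x _ ->]; rewrite -sum1_card; apply: eq_bigl => y.
  by rewrite eq_porbit_mem.
have E2 : \sum_(c in porbits s) #|c| = \sum_(c in porbits s) #|c|.-1 + #|porbits s|.
  rewrite -sum1_card -big_split /=; apply: eq_bigr => c cs.
  by rewrite addn1 prednK // card_gt0 (porbits_n0 cs).
by rewrite /rl E E2 addnK.
Qed.

Lemma rl_cycle s c : c \in porbits s -> #|c|.-1 <= rl s.
Proof. by move=> cs; rewrite rl_sum (bigD1 c) //= leq_addr. Qed.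

Lemma rl_two_cycles s c d : c \in porbits s -> d \in porbits s -> c != d ->
  #|c|.-1 + #|d|.-1 <= rl s.
Proof.
move=> cs ds cd; rewrite rl_sum (bigD1 c) //= (bigD1 d) /=; last by rewrite ds eq_sym.
by rewrite addnA leq_addr.
Qed.

Lemma size_cyc_args (A : Type) (a : T -> A) s c : size (cyc_args a s c) = #|c|.
Proof.
rewrite /cyc_args cardE; case: (enum c) => //= x e; by rewrite size_map size_traject.
Qed.

Lemma args_n0 (A : Type) (a : T -> A) s X c : c \in cycs s X ->
  (size (cyc_args a s c) != 0)%N.
Proof.
rewrite inE size_cyc_args cards_eq0 => /andP[cs _]; exact: porbits_n0 cs.
Qed.

Lemma geo_rl_le g s : s \in geo g -> rl s <= rl g.
Proof. by rewrite inE => /eqP<-; rewrite leq_addr. Qed.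

End CycleSizes.

(** * Arguments along the long cycles *)

Section Gamma.

Lemma val_traject_gamma n (x : 'I_n) m : x + m <= n ->
  map val (traject (gamma n) x m) = iota x m.
Proof.
elim: m x => //= m IH x; rewrite addnS => lt; congr (_ :: _).
case: m IH lt => // m IH lt; have E : gamma n x = x.+1 :> nat.
  case: (gamma_val x) => // -[E _]; exfalso; move: lt E; move: (nat_of_ord x) => y; lia.
by rewrite IH E // addSnnS.
Qed.

Lemma enum_traject n : enum 'I_n.+1 = traject (gamma n.+1) ord0 n.+1.
Proof.
by apply: (inj_map val_inj); rewrite val_enum_ord val_traject_gamma.
Qed.

Lemma enum_head n (c : {set 'I_n}) x : x \in c -> (forall y, y \in c -> x <= y) ->
  exists e, enum c = x :: e.
Proof.
move=> xc H; have so := sorted_enum c; have := xc; rewrite -mem_enum.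
case E: (enum c) so => [//|y e] /= so; rewrite inE => /predU1P[->|xe]; first by exists e.
have yc : y \in c by rewrite -mem_enum E mem_head.
have := order_path_min ltn_trans so => /allP/(_ x); rewrite map_f // => /(_ isT).
by rewrite ltnNge H.
Qed.

Lemma cyc_args_head n (A : Type) (a : 'I_n -> A) (s : 'S_n) (c : {set 'I_n}) x :
  x \in c -> (forall y, y \in c -> x <= y) ->
  cyc_args a s c = [seq a j | j <- traject s x #|c|].
Proof. by move=> xc /(enum_head xc)[e E]; rewrite /cyc_args E. Qed.

Lemma args_gamma n (A : Type) (a : 'I_n -> A) : 0 < n ->
  cyc_args a (gamma n) setT = [seq a i | i <- enum 'I_n].
Proof.
case: n a => // n a _; rewrite (@cyc_args_head _ _ _ _ _ ord0) ?inE //.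
by rewrite cardsT card_ord enum_traject.
Qed.

Lemma traject_gamma2_l p q x m :
  traject (gamma2 p q) (lshift q x) m = [seq lshift q y | y <- traject (gamma p) x m].
Proof. by elim: m x => //= m IH x; rewrite prod_perm_l IH. Qed.

Lemma traject_gamma2_r p q x m :
  traject (gamma2 p q) (rshift p x) m = [seq rshift p y | y <- traject (gamma q) x m].
Proof. by elim: m x => //= m IH x; rewrite prod_perm_r IH. Qed.

Lemma card_left p q : #|left_part p q| = p.
Proof. by rewrite card_imset ?card_ord //; apply: lshift_inj. Qed.

Lemma card_right p q : #|right_part p q| = q.
Proof. by rewrite card_imset ?card_ord //; apply: rshift_inj. Qed.

Lemma args_gamma2_l p q (A : Type) (a : 'I_(p + q) -> A) : 0 < p ->
  cyc_args a (gamma2 p q) (left_part p q) = [seq a (lshift q i) | i <- enum 'I_p].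
Proof.
case: p a => // p a _; rewrite (@cyc_args_head _ _ _ _ _ (lshift q ord0)) ?lshift_left //.
by rewrite card_left traject_gamma2_l -enum_traject -map_comp.
Qed.

Lemma args_gamma2_r p q (A : Type) (a : 'I_(p + q) -> A) : 0 < q ->
  cyc_args a (gamma2 p q) (right_part p q) = [seq a (rshift p i) | i <- enum 'I_q].
Proof.
case: q a => // q a _; rewrite (@cyc_args_head _ _ _ _ _ (rshift p ord0)).
- by rewrite card_right traject_gamma2_r -enum_traject -map_comp.
- by apply/imsetP; exists ord0.
by move=> y /imsetP[j _ ->]; rewrite /= leq_add2l.
Qed.

(** Rotating the arguments is relabelling along [gamma], so rotation invariance becomes invariance
    under conjugation by [gamma]. *)
Lemma map_gamma_rot n (A : Type) (a : 'I_n -> A) :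
  [seq a (gamma n i) | i <- enum 'I_n] = rot 1 [seq a i | i <- enum 'I_n].
Proof.
case: n a => [|n] a; first by rewrite (size0nil (size_enum_ord 0)).
have E : iter n.+1 (gamma n.+1) ord0 = ord0.
  by have := iter_porbit (gamma n.+1) ord0; rewrite porbit_gamma cardsT card_ord.
have mt m x : [seq gamma n.+1 y | y <- traject (gamma n.+1) x m] =
    traject (gamma n.+1) (gamma n.+1 x) m.
  by elim: m x => //= m IH x; rewrite IH.
rewrite -map_rot enum_traject (map_comp a (gamma n.+1)) mt; congr map.
by rewrite [in RHS]trajectS rot1_cons trajectSr -iterSr E.
Qed.

End Gamma.

Local Open Scope ring_scope.

(** * First order cumulants *)

Lemma prod_enum_ord (A : pzRingType) n (a : 'I_n -> A) :
  \prod_(x <- [seq a i | i <- enum 'I_n]) x = \prod_(i < n) a i.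
Proof. by rewrite big_map enumT unlock. Qed.

Section FirstOrder.

Variables (R : realType) (A : algType R[i]) (phi : A -> R[i]) (k1 : seq A -> R[i]).
Hypothesis phi_tr : forall a b, phi (a * b) = phi (b * a).
Hypothesis hk1 : first_order_cumulants phi k1.

Lemma moment1 n (a : 'I_n -> A) : (0 < n)%N ->
  phi (\prod_(x <- [seq a i | i <- enum 'I_n]) x) =
  \sum_(s in geo (gamma n)) wt k1 a s setT.
Proof.
move=> n0; rewrite prod_enum_ord hk1 // NC_geo; apply: eq_bigr => s _.
by rewrite /wt cycsT.
Qed.

Lemma wt_gamma (k : seq A -> R[i]) n (a : 'I_n -> A) : (0 < n)%N ->
  wt k a (gamma n) setT = k [seq a i | i <- enum 'I_n].
Proof.
move=> n0; rewrite -args_gamma // /wt cycsT.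
have -> : porbits (gamma n) = [set setT].
  apply/setP => c; rewrite inE; apply/imsetP/eqP => [[x _ ->]|->].
    exact: porbit_gamma.
  by exists (Ordinal n0); rewrite ?porbit_gamma.
by rewrite big_set1.
Qed.

(* The cycles of a non-crossing permutation other than [gamma n] have less than [n]
   elements, so that truncation isolates the top cumulant. *)
Definition trunc1 m l : R[i] := if (size l < m)%N then k1 l else 0.

Lemma geo_gamma_small n (s : 'S_n) c : s \in geo (gamma n) -> s != gamma n ->
  c \in porbits s -> (#|c| < n)%N.
Proof.
have cn : (#|c| <= n)%N by have := max_card (mem c); rewrite card_ord.
move=> sg ne cs; rewrite ltn_neqAle cn andbT.
apply: contraNneq ne => E; apply/eqP; apply: (geo_full sg).
have n0 : (0 < n)%N by rewrite -E card_gt0 (porbits_n0 cs).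
by apply/eqP; rewrite eqn_leq geo_rl_le //= rl_gamma //; have := rl_cycle cs; rewrite E.
Qed.

Lemma sum_geo_trunc1 n (a : 'I_n -> A) : (0 < n)%N ->
  \sum_(s in geo (gamma n)) wt k1 a s setT =
  k1 [seq a i | i <- enum 'I_n] + \sum_(s in geo (gamma n)) wt (trunc1 n) a s setT.
Proof.
move=> n0; rewrite (bigD1 (gamma n)) ?geo_id //= [X in _ = _ + X](bigD1 (gamma n)) ?geo_id //=.
rewrite !wt_gamma // {1}/trunc1 size_map size_enum_ord ltnn add0r; congr (_ + _).
apply: eq_bigr => s /andP[sg ne]; rewrite /wt cycsT; apply: eq_bigr => c cs.
by rewrite /trunc1 size_cyc_args (geo_gamma_small sg).
Qed.

Lemma rot1_rot_inv (V : Type) (k : seq A -> V) :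
  (forall l, k (rot 1 l) = k l) -> rot_inv k.
Proof.
move=> H n l; have [le|/ltnW le] := leqP n (size l); last by rewrite rot_oversize.
elim: n le => [|n IH] le; first by rewrite rot0.
by rewrite rotS // H IH // ltnW.
Qed.

Lemma phi_rot l : phi (\prod_(x <- rot 1 l) x) = phi (\prod_(x <- l) x).
Proof.
by case: l => // x l; rewrite rot1_cons big_rcons big_cons phi_tr.
Qed.

Lemma tnth_enum (l : seq A) : [seq tnth (in_tuple l) i | i <- enum 'I_(size l)] = l.
Proof. exact: (map_tnth_enum (in_tuple l)). Qed.

(** Along a permutation, [ext] is conjugation, and [gamma] commutes with itself. *)
Lemma ext_gamma n : ext (@perm_inj _ (gamma n)) (gamma n) = gamma n.
Proof.
by apply/esym/extP => // x /negP[]; rewrite -(permKV (gamma n) x); apply: codom_f.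
Qed.

(** Induction on the length. The moments of [l] and of its rotation agree since [phi] is tracial;
    all terms but the top ones involve shorter lists, so their sum is unchanged by conjugation with
    [gamma]. *)
Lemma k1_rot : rot_inv k1.
Proof.
apply: rot1_rot_inv => l; have [m] := ubnP (size l); elim: m l => // m IH l lem.
case E : (size l) => [|n]; first by rewrite (size0nil E).
(* Transport asks for invariance on all lists; truncation lets the induction hypothesis provide
   it. *)
have tr : rot_inv (trunc1 n.+1).
  apply: rot1_rot_inv => l'; rewrite /trunc1 size_rot; case: ifP => // lt.
  by apply: IH; apply: leq_trans lt _; rewrite -E.
rewrite -E in tr; have l0 : (0 < size l)%N by rewrite E.
pose a := tnth (in_tuple l).
have Ea : [seq a i | i <- enum 'I_(size l)] = l by apply: tnth_enum.
have m1 := moment1 a l0; rewrite Ea in m1.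
have m2 := moment1 (a \o gamma (size l)) l0; rewrite map_gamma_rot Ea phi_rot m1 in m2.
move: m2; rewrite !sum_geo_trunc1 // map_gamma_rot Ea.
rewrite -(sum_geo_ext_wt (perm_inj (s := gamma (size l))) a _ _ tr) ext_gamma.
have -> : gamma (size l) @: [set: 'I_(size l)] = setT.
  by apply/setP => x; rewrite inE -(permKV (gamma (size l)) x) imset_f // inE.
by move/addIr.
Qed.

Lemma traject_ext (U T : finType) (f : U -> T) (finj : injective f) (s : {perm U}) u m :
  traject (ext finj s) (f u) m = map f (traject s u m).
Proof. by elim: m u => //= m IH u; rewrite ext_f IH. Qed.

Lemma del_gamma_lift n (u : 'I_n.+1) :
  remove_point (gamma n.+2) ord0 (lift ord0 u) = lift ord0 (gamma n.+1 u).
Proof.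
rewrite permM; apply: val_inj => /=.
have v0 : gamma n.+2 ord0 = 1%N :> nat by case: (gamma_val (ord0 : 'I_n.+2)) => -[].
have := gamma_val (lift ord0 u); have := gamma_val u.
have := ltn_ord u; have := ltn_ord (gamma n.+1 u).
have := ltn_ord (gamma n.+2 (lift ord0 u)).
case: tpermP => [->|->|/eqP ne1 /eqP ne2].
- by rewrite v0 /= /bump /=; move: (nat_of_ord _) (nat_of_ord _) => ? ?; lia.
- by rewrite v0 /= /bump /=; move: (nat_of_ord _) (nat_of_ord _) => ? ?; lia.
move: ne1; rewrite -val_eqE /= /bump /=.
by move: (nat_of_ord (gamma n.+2 _)) (nat_of_ord (gamma _ u)) (nat_of_ord u) => ? ? ?; lia.
Qed.

Lemma del_gamma n : ext (@lift_inj _ (ord0 : 'I_n.+2)) (gamma n.+1) = remove_point (gamma n.+2) ord0.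
Proof.
apply/esym/extP => [u|u out]; first exact: del_gamma_lift.
have -> : u = ord0; last by rewrite del_fix.
by apply/eqP; apply: contraR out; case: (unliftP ord0 u) => [v -> _|->];
  [apply: codom_f|rewrite eqxx].
Qed.

Lemma lift_setT n : lift (ord0 : 'I_n.+1) @: [set: 'I_n] = setT :\ ord0.
Proof.
apply/setP => x; rewrite !inE andbT; apply/imsetP/idP => [[u _ ->]|].
  by rewrite eq_sym neq_lift.
by case: (unliftP ord0 x) => [u -> _|-> /eqP//]; exists u.
Qed.

Lemma wt_set0 (T : finType) (k : seq A -> R[i]) (a : T -> A) s : wt k a s set0 = 1.
Proof.
rewrite /wt big1 // => c /cycsP[x -> ]; rewrite subset0 => E.
by have := porbit_n0 s x; rewrite E.
Qed.

(** The lists [x :: y :: l] and [x * y :: l] have the same moment. Expanding both, and erasing the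
    point 0 in the first expansion, leaves a vanishing sum of defects. A geodesic other than the
    full cycle carries the defect of a shorter list; the remaining defect is the claim. *)
Lemma split1_k1 (x y : A) (l : seq A) : split1 k1 x (y :: l) = k1 (x * y :: l).
Proof.
have [m] := ubnP (size l); elim: m x y l => // m IH x y l; rewrite ltnS => lem.
pose n := size l; pose b : 'I_n.+2 -> A := tnth (in_tuple (x :: y :: l)).
pose g' := gamma n.+2; pose i : 'I_n.+2 := ord0; pose f := lift i.
have gi1 : g' i = f ord0.
  by apply: val_inj; case: (gamma_val i) => -[].
have gi : g' i != i by rewrite gi1 eq_sym neq_lift.
have fb : [seq b (f u) | u <- enum 'I_n.+1] = y :: l.
  have := tnth_enum (x :: y :: l); rewrite /= -/n enum_ordSl /=.
  move=> /(congr1 behead) /= <-.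
  exact: map_comp.
have bi : b i = x by [].
have bk : b (g' i) = y by have := fb; rewrite enum_ordSl gi1 /= => -[].
have fb1 : [seq (merge_label g' i b \o f) u | u <- enum 'I_n.+1] = x * y :: l.
  move: fb; rewrite enum_ordSl /= -gi1 /merge_label eqxx bi bk => -[El].
  congr (_ :: _); rewrite -[RHS]El; apply/eq_in_map => u.
  by case/mapP => v _ ->; rewrite gi1 (inj_eq lift_inj) eq_sym (negbTE (neq_lift _ _)).
have m1 := moment1 b isT; rewrite (tnth_enum (x :: y :: l)) in m1.
have m2 := moment1 (merge_label g' i b \o f) isT; rewrite fb1 in m2.
rewrite big_cons in m2; rewrite !big_cons mulrA m2 in m1; move: m1.
rewrite -(sum_geo_ext_wt (@lift_inj _ i) _ _ _ k1_rot) del_gamma lift_setT.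
have gM : perm_on [set: 'I_n.+2] g' by apply/subsetP => z; rewrite inE.
have := @step_geo_wt _ _ _ k1 k1_rot g' i setT gi (in_setT _) gM b predT predT.
rewrite !big_mkcondr /= => -> //.
rewrite -[LHS]addr0 => /addrI/esym.
have rld : rl (remove_point g' i) = n by apply: succn_inj; rewrite -rl_del // rl_gamma.
(* Off the top term the list after [g' i] has at most [rl s] entries and [rl s < n], so the
   induction hypothesis makes the defect zero. *)
rewrite (bigD1 (remove_point g' i)) ?geo_id //= big1 ?addr0 => [|s /andP[sg ne]]; last first.
  rewrite /step_defect1 /defect1 [split1 _ _ _]IH ?subrr ?mul0r //.
  rewrite size_map size_traject.
  have lts : (rl s < n)%N.
    have := geo_rl_le sg; rewrite rld => le; rewrite ltn_neqAle le andbT.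
    by apply: contraNneq ne => E; apply/eqP/(geo_full sg); rewrite rld.
  apply: leq_trans lem; apply: leq_ltn_trans lts.
  exact: rl_cycle (porbits_porbit _ _).
have cl : g' i :: arest (remove_point g' i) (g' i) = [seq f u | u <- enum 'I_n.+1].
  rewrite /arest -del_gamma [in X in #|X|]gi1 porbit_ext porbit_gamma.
  rewrite card_imset; last exact: lift_inj.
  by rewrite cardsT card_ord /= gi1 ext_f traject_ext enum_traject.
(* The top cycle covers every point, so its defect comes with weight 1. *)
have spT : ext_orbit g' i (remove_point g' i) = setT.
  rewrite /ext_orbit -del_gamma gi1 porbit_ext porbit_gamma lift_setT.
  by apply/setP => z; rewrite !inE; case: eqP.
rewrite /step_defect1 spT setDv wt_set0 mulr1 /defect1 cl -map_comp.
have -> : [seq (b \o f) u | u <- enum 'I_n.+1] = y :: l by [].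
have El : [seq b z | z <- arest (remove_point g' i) (g' i)] = l.
  by have := congr1 behead (congr1 (map b) cl); rewrite /= -map_comp fb.
by rewrite El bi bk => /eqP; rewrite subr_eq0 => /eqP.
Qed.

End FirstOrder.

(** * Second order cumulants *)

Section SecondOrder.

Variables (R : realType) (A : algType R[i]) (phi : A -> R[i]) (phi2 : A -> A -> R[i]).
Hypothesis hphi : second_order_space phi phi2.
Variable k1 : seq A -> R[i].
Hypothesis hk1 : first_order_cumulants phi k1.

Let k1r : rot_inv k1 := k1_rot (phi_tracial hphi) hk1.
Let k1s := split1_k1 (phi_tracial hphi) hk1.

(** The second order relation in terms of geodesics, for an arbitrary [k], so that it applies to
    [nonempty2 k2] and to the functional with its two lists exchanged. *)
Definition moment2 (k : seq A -> seq A -> R[i]) := forall p q (a : 'I_(p + q) -> A),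
  (0 < p)%N -> (0 < q)%N ->
  phi2 (\prod_(x <- [seq a (lshift q i) | i <- enum 'I_p]) x)
       (\prod_(x <- [seq a (rshift p i) | i <- enum 'I_q]) x) =
  \sum_(s in ann setT (gamma2 p q) (left_part p q)) wt k1 a s setT +
  \sum_(s in geo (gamma2 p q)) wt2 k1 k a s (left_part p q) (right_part p q).

Lemma eq_wt2 (T : finType) (k k' : seq A -> seq A -> R[i]) (a : T -> A) s X Y :
  (forall c d, c \in cycs s X -> d \in cycs s Y ->
    k (cyc_args a s c) (cyc_args a s d) = k' (cyc_args a s c) (cyc_args a s d)) ->
  wt2 k1 k a s X Y = wt2 k1 k' a s X Y.
Proof.
move=> E; apply: eq_bigr => d dY; congr (_ * _); apply: eq_mark => c cX //; exact: E.
Qed.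

(* The values of [k] on empty lists are arbitrary, hence not invariant. *)
Definition nonempty2 (k : seq A -> seq A -> R[i]) l1 l2 : R[i] :=
  if (size l1 == 0)%N || (size l2 == 0)%N then 0 else k l1 l2.

Lemma moment2_cumulants k2 : second_order_cumulants phi2 k1 k2 -> moment2 (nonempty2 k2).
Proof.
move=> hk2 p q a p0 q0; rewrite !prod_enum_ord hk2 //.
have := sum_PSNC k1 k2 a predT p0 q0.
rewrite big_mkcondr /= => ->; congr (_ + _); rewrite big_mkcondr /=; apply: eq_bigr => s _ //.
  apply: eq_wt2 => c d cL dR.
by rewrite /nonempty2 (negbTE (args_n0 _ cL)) (negbTE (args_n0 _ dR)).
Qed.

Lemma cycs_full (T : finType) (s : {perm T}) (X : {set T}) x : stable X s -> x \in X ->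
  (forall Y : {set T}, stable Y s -> x \in Y -> X \subset Y) -> cycs s X = [set X].
Proof.
move=> sX xX H; have E y : y \in X -> porbit s y = X.
  move=> yX; apply/eqP; rewrite eqEsubset porbit_sub // yX /=.
  have sy : stable (porbit s y) s by apply/stableP => z; apply: mem_porbit_perm.
  have [xy|xy] := boolP (x \in porbit s y); first exact: H.
  have := H (~: porbit s y); rewrite stableC in_setC => /(_ sy xy)/subsetP/(_ y yX).
  by rewrite in_setC porbit_id.
apply/setP => c; rewrite in_set1; apply/cycsP/eqP => [[y -> sub]|->].
  by apply: E; apply: (subsetP sub); apply: porbit_id.
by exists x; rewrite ?E.
Qed.

Lemma cycs_gamma2_l p q : (0 < p)%N -> cycs (gamma2 p q) (left_part p q) = [set left_part p q].
Proof.
case: p => // p _; apply: (@cycs_full _ _ _ (lshift q ord0)).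
- exact: stable_gamma2.
- exact: lshift_left.
move=> Y sY oY; apply/subsetP => _ /imsetP[i _ ->].
by rewrite (gamma2_stable_l i ord0 sY).
Qed.

Lemma cycs_gamma2_r p q : (0 < q)%N -> cycs (gamma2 p q) (right_part p q) = [set right_part p q].
Proof.
case: q => // q _; apply: (@cycs_full _ _ _ (rshift p ord0)).
- by rewrite rightE stableC; apply: stable_gamma2.
- by apply/imsetP; exists ord0.
move=> Y sY oY; apply/subsetP => _ /imsetP[i _ ->].
by rewrite (gamma2_stable_r i ord0 sY).
Qed.

Lemma wt2_gamma2 k p q (a : 'I_(p + q) -> A) : (0 < p)%N -> (0 < q)%N ->
  wt2 k1 k a (gamma2 p q) (left_part p q) (right_part p q) =
  k [seq a (lshift q i) | i <- enum 'I_p] [seq a (rshift p i) | i <- enum 'I_q].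
Proof.
move=> p0 q0; rewrite /wt2 cycs_gamma2_r // cycs_gamma2_l // big_set1 mark1 setDv big_set0.
by rewrite mulr1 args_gamma2_l // args_gamma2_r.
Qed.

Lemma rl_gamma2 p q : (0 < p)%N -> (0 < q)%N -> rl (gamma2 p q) = (p.-1 + q.-1)%N.
Proof. by move=> p0 q0; rewrite rl_prod !rl_gamma. Qed.

Lemma geo_rl_lt (T : finType) (g s : {perm T}) : s \in geo g -> s != g -> (rl s < rl g)%N.
Proof.
move=> sg ne; rewrite ltn_neqAle geo_rl_le // andbT.
by apply: contraNneq ne => /(geo_full sg)->.
Qed.

Lemma cycs_pair_neq (T : finType) (s : {perm T}) (X Y c d : {set T}) : [disjoint X & Y] ->
  c \in cycs s X -> d \in cycs s Y -> c != d.
Proof.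
move=> dis; rewrite !inE => /andP[cs cX] /andP[_ dY]; apply/eqP => E.
have := porbits_n0 cs; case/negP; rewrite -subset0 -(disjoint_setI0 dis) subsetI cX.
by rewrite E.
Qed.

(** Together the two cycles have at most [rl s + 2] points, while [rl s] is less than p+q-2. *)
Lemma geo_gamma2_small p q (s : 'S_(p + q)) c d : (0 < p)%N -> (0 < q)%N ->
  s \in geo (gamma2 p q) -> s != gamma2 p q ->
  c \in cycs s (left_part p q) -> d \in cycs s (right_part p q) -> (#|c| + #|d| < p + q)%N.
Proof.
move=> p0 q0 sg ne cL dR; have := geo_rl_lt sg ne; rewrite rl_gamma2 //.
have cd := cycs_pair_neq (leftright_disjoint p q) cL dR.
have cs : c \in porbits s by move: cL; rewrite inE => /andP[].
have ds : d \in porbits s by move: dR; rewrite inE => /andP[].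
have := rl_two_cycles cs ds cd.
have : (0 < #|c|)%N by rewrite card_gt0 (porbits_n0 cs).
have : (0 < #|d|)%N by rewrite card_gt0 (porbits_n0 ds).
move: p0 q0; move: (rl s) #|c| #|d| => u v w; lia.
Qed.

Definition trunc2 (k : seq A -> seq A -> R[i]) m l1 l2 : R[i] :=
  if (size l1 + size l2 < m)%N then k l1 l2 else 0.

Lemma sum_geo_trunc2 k p q (a : 'I_(p + q) -> A) : (0 < p)%N -> (0 < q)%N ->
  \sum_(s in geo (gamma2 p q)) wt2 k1 k a s (left_part p q) (right_part p q) =
  k [seq a (lshift q i) | i <- enum 'I_p] [seq a (rshift p i) | i <- enum 'I_q] +
  \sum_(s in geo (gamma2 p q)) wt2 k1 (trunc2 k (p + q)) a s (left_part p q) (right_part p q).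
Proof.
move=> p0 q0; rewrite (bigD1 (gamma2 p q)) ?geo_id //= wt2_gamma2 //.
rewrite [X in _ = _ + X](bigD1 (gamma2 p q)) ?geo_id //= wt2_gamma2 //.
have sz n (f : 'I_n -> A) : size [seq f i | i <- enum 'I_n] = n.
  by rewrite size_map size_enum_ord.
rewrite {1}/trunc2 !sz ltnn add0r; congr (_ + _).
apply: eq_bigr => s /andP[sg ne]; apply: eq_wt2 => c d cL dR.
by rewrite /trunc2 !size_cyc_args (geo_gamma2_small p0 q0 sg ne cL dR).
Qed.

Section Transport.
Variables (p q : nat) (t : 'S_(p + q)).
Hypotheses (tL : stable (left_part p q) t) (tg : commute t (gamma2 p q)).

Lemma ext_gamma2 : ext (@perm_inj _ t) (gamma2 p q) = gamma2 p q.
Proof.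
apply/esym/extP => [u|x /negP[]]; first by rewrite -permM tg permM.
by rewrite -(permKV t x); apply: codom_f.
Qed.

Lemma imset_stable (X : {set 'I_(p + q)}) : stable X t -> t @: X = X.
Proof.
move/stableP => tX; apply/setP => x; rewrite -[in LHS](permKV t x) mem_imset; last exact: perm_inj.
by rewrite -tX permKV.
Qed.

(** Conjugation by [t] permutes the geodesics and the annular permutations, since [t] commutes with
    [gamma2] and preserves each circle. *)
Lemma sum_transport k (a : 'I_(p + q) -> A) : (forall l, rot_inv (k^~ l)) ->
  (forall l, rot_inv (k l)) ->
  \sum_(s in ann setT (gamma2 p q) (left_part p q)) wt k1 (a \o t) s setT =
  \sum_(s in ann setT (gamma2 p q) (left_part p q)) wt k1 a s setT /\
  \sum_(s in geo (gamma2 p q)) wt2 k1 k (a \o t) s (left_part p q) (right_part p q) =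
  \sum_(s in geo (gamma2 p q)) wt2 k1 k a s (left_part p q) (right_part p q).
Proof.
move=> kl kr; have tR : stable (right_part p q) t by rewrite rightE stableC.
have tT : t @: [set: 'I_(p + q)] = setT by apply: imset_stable; apply/stableP => x; rewrite !inE.
have ET : [set t u | u in 'I_(p + q)] = setT.
  by apply/setP => x; rewrite inE; apply/imsetP; exists (t^-1%g x); rewrite ?permKV.
split.
  rewrite -(sum_ann_ext_wt (perm_inj (s := t)) a _ (L' := left_part p q) _ k1r).
    by rewrite ext_gamma2 ET tT.
  by move=> u; apply: (stableP _ _ tL).
rewrite -(sum_geo_ext_wt2 (perm_inj (s := t)) a _ _ _ k1r kl kr).
by rewrite ext_gamma2 !imset_stable.
Qed.

End Transport.
Definition pair_label (l1 l2 : seq A) (x : 'I_(size l1 + size l2)) : A :=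
  match split x with inl i => tnth (in_tuple l1) i | inr j => tnth (in_tuple l2) j end.

Lemma pair_label_l l1 l2 i : @pair_label l1 l2 (lshift _ i) = tnth (in_tuple l1) i.
Proof. by rewrite /pair_label -[lshift _ _]/(unsplit (inl i)) unsplitK. Qed.

Lemma pair_label_r l1 l2 i : @pair_label l1 l2 (rshift _ i) = tnth (in_tuple l2) i.
Proof. by rewrite /pair_label -[rshift _ _]/(unsplit (inr i)) unsplitK. Qed.

Lemma map_pair_label_l l1 l2 :
  [seq @pair_label l1 l2 (lshift (size l2) i) | i <- enum 'I_(size l1)] = l1.
Proof. by rewrite -[RHS]tnth_enum; apply: eq_map => i; apply: pair_label_l. Qed.

Lemma map_pair_label_r l1 l2 :
  [seq @pair_label l1 l2 (rshift (size l1) i) | i <- enum 'I_(size l2)] = l2.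
Proof. by rewrite -[RHS]tnth_enum; apply: eq_map => i; apply: pair_label_r. Qed.

Section Rotation.
Variable k : seq A -> seq A -> R[i].
Hypotheses (km : moment2 k) (k0l : forall l, k [::] l = 0) (k0r : forall l, k l [::] = 0).

(** Both rotations are proved in one induction, because transporting the truncated sum requires
    invariance in both variables at smaller total length. *)
Lemma moment2_rot_aux m l1 l2 : (size l1 + size l2 < m)%N ->
  k (rot 1 l1) l2 = k l1 l2 /\ k l1 (rot 1 l2) = k l1 l2.
Proof.
elim: m l1 l2 => // m IH l1 l2; rewrite ltnS => lem.
case E1 : (size l1) => [|p']; first by rewrite (size0nil E1) !k0l.
case E2 : (size l2) => [|q']; first by rewrite (size0nil E2) !k0r.
have p0 : (0 < size l1)%N by rewrite E1.
have q0 : (0 < size l2)%N by rewrite E2.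
set p := size l1 in lem p0; set q := size l2 in lem q0; set a := @pair_label l1 l2.
have trl l : rot_inv (trunc2 k (p + q) ^~ l).
  apply: rot1_rot_inv => l'; rewrite /trunc2 size_rot; case: ifP => // lt.
  by have [] := IH l' l (leq_trans lt lem).
have trr l : rot_inv (trunc2 k (p + q) l).
  apply: rot1_rot_inv => l'; rewrite /trunc2 size_rot; case: ifP => // lt.
  by have [] := IH l l' (leq_trans lt lem).
have m0 := km a p0 q0.
rewrite sum_geo_trunc2 // map_pair_label_l map_pair_label_r in m0.
split.
  (* Turning one circle alone rotates its labels; [phi2] is tracial in the corresponding
     variable. *)
  pose t := prod_perm (gamma p) (1%g : 'S_q).
  have tg : commute t (gamma2 p q) by rewrite /commute !prod_permM mul1g mulg1.
  have [e1 e2] := sum_transport (stable_prod _ _) tg a trl trr.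
  have := km (a \o t) p0 q0; rewrite sum_geo_trunc2 // e1 e2.
  have -> : [seq (a \o t) (lshift q i) | i <- enum 'I_p] = rot 1 l1.
    rewrite -[in RHS](map_pair_label_l l1 l2) -map_gamma_rot.
    by apply: eq_map => i; rewrite /= prod_perm_l.
  have -> : [seq (a \o t) (rshift p i) | i <- enum 'I_q] = l2.
    rewrite -[RHS](map_pair_label_r l1 l2).
    by apply: eq_map => i; rewrite /= prod_perm_r perm1.
  have /= -> := @phi_rot _ _ (phi2^~ (\prod_(x <- l2) x)) (fun x y => phi2_tracial_l hphi x y _) l1.
  rewrite m0.
  by move/addrI/addIr.
pose t := prod_perm (1%g : 'S_p) (gamma q).
have tg : commute t (gamma2 p q) by rewrite /commute !prod_permM mul1g mulg1.
have [e1 e2] := sum_transport (stable_prod _ _) tg a trl trr.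
have := km (a \o t) p0 q0; rewrite sum_geo_trunc2 // e1 e2.
have -> : [seq (a \o t) (rshift p i) | i <- enum 'I_q] = rot 1 l2.
  rewrite -[in RHS](map_pair_label_r l1 l2) -map_gamma_rot.
  by apply: eq_map => i; rewrite /= prod_perm_r.
have -> : [seq (a \o t) (lshift q i) | i <- enum 'I_p] = l1.
  rewrite -[RHS](map_pair_label_l l1 l2).
  by apply: eq_map => i; rewrite /= prod_perm_l perm1.
have /= -> := @phi_rot _ _ (phi2 (\prod_(x <- l1) x)) (fun x y => phi2_tracial_r hphi x y _) l2.
rewrite m0.
by move/addrI/addIr.
Qed.

Lemma moment2_rotl l : rot_inv (k^~ l).
Proof. by apply: rot1_rot_inv => l'; have [] := @moment2_rot_aux _ l' l (ltnSn _). Qed.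

Lemma moment2_rotr l : rot_inv (k l).
Proof. by apply: rot1_rot_inv => l'; have [] := @moment2_rot_aux _ l l' (ltnSn _). Qed.

Definition swap_sum p q (x : 'I_(q + p)) : 'I_(p + q) :=
  match split x with inl j => rshift p j | inr i => lshift q i end.

Lemma swap_sum_l p q j : @swap_sum p q (lshift p j) = rshift p j.
Proof. by rewrite /swap_sum -[lshift _ _]/(unsplit (inl j)) unsplitK. Qed.

Lemma swap_sum_r p q i : @swap_sum p q (rshift q i) = lshift q i.
Proof. by rewrite /swap_sum -[rshift _ _]/(unsplit (inr i)) unsplitK. Qed.

Lemma swap_sumK p q : cancel (@swap_sum p q) (@swap_sum q p).
Proof.
by move=> x; case: (splitOrdP x) => i; rewrite ?swap_sum_l ?swap_sum_r ?swap_sum_l.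
Qed.

(** Exchanges the two circles, using the symmetry of [phi2]. What is proved for the left circle
    thereby applies to the right one, with the lists of [k] exchanged. *)
Lemma moment2_swap : moment2 (fun l1 l2 => k l2 l1).
Proof.
move=> q p a q0 p0; rewrite (phi2_symmetric hphi).
pose f := @swap_sum q p; have finj : injective f := can_inj (@swap_sumK q p).
have fT : [set f u | u in 'I_(p + q)] = setT.
  apply/setP => x; rewrite inE; apply/imsetP; exists (@swap_sum p q x) => //.
  by rewrite /f swap_sumK.
have fT' : f @: [set: 'I_(p + q)] = setT by rewrite -fT; apply/setP => x; apply/imsetP/imsetP => -[u _ ->]; exists u.
have fL : f @: left_part p q = right_part q p.
  apply/setP => x; apply/imsetP/imsetP => [[_ /imsetP[i _ ->] ->]|[i _ ->]].
    by exists i; rewrite // /f swap_sum_l.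
  by exists (lshift q i); rewrite ?lshift_left // /f swap_sum_l.
have fR : f @: right_part p q = left_part q p.
  apply/setP => x; apply/imsetP/imsetP => [[_ /imsetP[i _ ->] ->]|[i _ ->]].
    by exists i; rewrite // /f swap_sum_r.
  by exists (rshift p i); rewrite ?imset_f // /f swap_sum_r.
have extE : ext finj (gamma2 p q) = gamma2 q p.
  apply/esym/extP => [u|x /negP[]].
    by case: (splitOrdP u) => i; rewrite /f ?prod_perm_l ?prod_perm_r ?swap_sum_l ?swap_sum_r
      ?prod_perm_l ?prod_perm_r.
  by rewrite -(swap_sumK x); apply: codom_f.
have := km (a \o f) p0 q0.
have -> : [seq (a \o f) (lshift q i) | i <- enum 'I_p] = [seq a (rshift q i) | i <- enum 'I_p].
  by apply: eq_map => i; rewrite /= /f swap_sum_l.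
have -> : [seq (a \o f) (rshift p i) | i <- enum 'I_q] = [seq a (lshift p i) | i <- enum 'I_q].
  by apply: eq_map => i; rewrite /= /f swap_sum_r.
move=> ->; congr (_ + _).
  rewrite -(sum_ann_ext_wt finj a _ (L' := right_part q p) _ k1r).
    rewrite extE fT fT'; apply: eq_bigl => s; rewrite !inE rightE stableC //.
  by move=> u; rewrite -fL mem_imset.
rewrite -(sum_geo_ext_wt2 finj a _ _ _ k1r moment2_rotl moment2_rotr) extE fL fR.
by apply: eq_bigr => s _; rewrite wt2_swap.
Qed.

End Rotation.
End SecondOrder.

(** * Erasing the first point of the left circle *)

Section LiftLeft.
Variables n q : nat.

Definition lift_left (x : 'I_(n.+1 + q)) : 'I_(n.+2 + q) :=
  match split x with inl u => lshift q (lift ord0 u) | inr v => rshift n.+2 v end.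

Lemma lift_left_l u : lift_left (lshift q u) = lshift q (lift ord0 u).
Proof. by rewrite /lift_left -[lshift _ _]/(unsplit (inl u)) unsplitK. Qed.

Lemma lift_left_r u : lift_left (rshift n.+1 u) = rshift n.+2 u.
Proof. by rewrite /lift_left -[rshift _ _]/(unsplit (inr u)) unsplitK. Qed.

Lemma lift_left_inj : injective lift_left.
Proof.
move=> x y; case: (splitOrdP x) => u; case: (splitOrdP y) => v; rewrite ?lift_left_l ?lift_left_r.
- by move/lshift_inj/lift_inj->.
- by move/esym/rl_shift_neq.
- by move/rl_shift_neq.
by move/rshift_inj->.
Qed.

Local Notation i := (lshift q (ord0 : 'I_n.+2)).

Lemma lift_left_setT : lift_left @: setT = setT :\ i.
Proof.
apply/setP => x; rewrite !inE andbT; apply/imsetP/idP => [[y _ ->]|].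
  case: (splitOrdP y) => u; rewrite ?lift_left_l ?lift_left_r.
    by rewrite (inj_eq (@lshift_inj _ _)) eq_sym neq_lift.
  by rewrite eq_rlshift.
case: (splitOrdP x) => u; last by exists (rshift n.+1 u); rewrite ?lift_left_r.
rewrite (inj_eq (@lshift_inj _ _)); case: (unliftP ord0 u) => [v -> _|-> /eqP//].
by exists (lshift q v); rewrite ?lift_left_l.
Qed.

Lemma lift_left_left x : (lift_left x \in left_part n.+2 q) = (x \in left_part n.+1 q).
Proof.
case: (splitOrdP x) => u; first by rewrite lift_left_l !lshift_left.
by rewrite lift_left_r !rshift_left.
Qed.

Lemma del_gamma2 : ext lift_left_inj (gamma2 n.+1 q) = remove_point (gamma2 n.+2 q) i.
Proof.
apply/esym/extP => [x|x out]; last first.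
  have -> : x = i; last by rewrite del_fix.
  apply/eqP; apply: contraR out => ne.
  have : x \in setT :\ i by rewrite !inE ne.
  by rewrite -lift_left_setT => /imsetP[u _ ->]; apply: codom_f.
rewrite permM prod_perm_l; case: (splitOrdP x) => u.
  rewrite lift_left_l !prod_perm_l lift_left_l -inj_tperm; last exact: lshift_inj.
  by rewrite -del_gamma_lift permM.
by rewrite lift_left_r !prod_perm_r lift_left_r tpermD // eq_lrshift.
Qed.

End LiftLeft.

Section SecondOrder.

Variables (R : realType) (A : algType R[i]) (phi : A -> R[i]) (phi2 : A -> A -> R[i]).
Hypothesis hphi : second_order_space phi phi2.
Variable k1 : seq A -> R[i].
Hypothesis hk1 : first_order_cumulants phi k1.

Let k1r : rot_inv k1 := k1_rot (phi_tracial hphi) hk1.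
Let k1s := split1_k1 (phi_tracial hphi) hk1.

Variable k : seq A -> seq A -> R[i].
Hypothesis km : moment2 phi2 k1 k.
Hypotheses (k0l : forall l, k [::] l = 0) (k0r : forall l, k l [::] = 0).
Let krl := moment2_rotl hphi hk1 km k0l k0r.
Let krr := moment2_rotr hphi hk1 km k0l k0r.

(** The argument of [split1_k1] on two circles. The first order identity removes the first order
    defects, which leaves one [defect2] for each geodesic and each of its cycles on the right
    circle. *)
Lemma splits2_cumulants (x y : A) (l z : seq A) : (0 < size z)%N ->
  splits2 k1 k x (y :: l) z = k (x * y :: l) z.
Proof.
have [m] := ubnP (size l + size z); elim: m x y l z => // m IH x y l z.
rewrite ltnS => lem q0.
pose n := size l; pose q := size z.
pose b : 'I_(n.+2 + q) -> A := @pair_label R A (x :: y :: l) z.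
pose g' := gamma2 n.+2 q; pose i : 'I_(n.+2 + q) := lshift q ord0.
pose f := @lift_left n q.
have gi1 : g' i = f (lshift q ord0).
  rewrite /g' prod_perm_l /f lift_left_l; congr lshift; apply: val_inj.
  by case: (gamma_val (ord0 : 'I_n.+2)) => -[].
have gi : g' i != i.
  by rewrite gi1 /f lift_left_l (inj_eq (@lshift_inj _ _)) eq_sym neq_lift.
have bl : [seq b (lshift q u) | u <- enum 'I_n.+2] = x :: y :: l.
  exact: (map_pair_label_l (x :: y :: l) z).
have br : [seq b (rshift n.+2 u) | u <- enum 'I_q] = z.
  exact: (map_pair_label_r (x :: y :: l) z).
have bi : b i = x by have := bl; rewrite enum_ordSl => -[].
have fbl : [seq b (f (lshift q u)) | u <- enum 'I_n.+1] = y :: l.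
  have := bl; rewrite enum_ordSl /= => /(congr1 behead) /= <-.
  by rewrite -map_comp; apply: eq_map => u; rewrite /= /f lift_left_l.
have bk : b (g' i) = y by have := fbl; rewrite enum_ordSl gi1 /= => -[].
pose b1 := merge_label g' i b.
have fb1 : [seq (b1 \o f) (lshift q u) | u <- enum 'I_n.+1] = x * y :: l.
  move: fbl; rewrite enum_ordSl /= -gi1 /b1 /merge_label eqxx bi bk => -[El].
  congr (_ :: _); rewrite -[RHS]El; apply/eq_in_map => u.
  case/mapP => v _ ->; rewrite gi1 (inj_eq (@lift_left_inj n q)) (inj_eq (@lshift_inj _ _)).
  by rewrite eq_sym (negbTE (neq_lift _ _)).
have fb1r : [seq (b1 \o f) (rshift n.+1 u) | u <- enum 'I_q] = z.
  rewrite -[RHS]br; apply: eq_map => u; rewrite /= /f lift_left_r /b1 /merge_label.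
  by rewrite gi1 /f lift_left_l eq_rlshift.
have m1 := km b isT q0; rewrite bl br in m1.
have m2 := km (b1 \o f) isT q0; rewrite fb1 fb1r in m2.
rewrite big_cons in m2; rewrite !big_cons mulrA m2 in m1; move: m1.
have fT : [set f u | u in 'I_(n.+1 + q)] = setT :\ i.
  rewrite -lift_left_setT; apply/setP => u; apply/imsetP/imsetP => -[v _ ->]; exists v => //.
have fL : f @: left_part n.+1 q = (setT :\ i) :&: left_part n.+2 q.
  rewrite -lift_left_setT; apply/setP => u; rewrite in_setI; apply/imsetP/andP.
    by case=> v vL ->; rewrite imset_f ?inE // lift_left_left.
  by case=> /imsetP[v _ ->]; rewrite lift_left_left => vL; exists v.
have fR : f @: right_part n.+1 q = (setT :\ i) :\: left_part n.+2 q.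
  rewrite -lift_left_setT rightE; apply/setP => u; rewrite in_setD; apply/imsetP/andP.
    by case=> v; rewrite inE => vL ->; rewrite imset_f ?inE // lift_left_left.
  by case=> + /imsetP[v _ uE]; rewrite uE lift_left_left => vL; exists v; rewrite ?inE.
rewrite -(sum_ann_ext_wt (@lift_left_inj n q) _ _ _ k1r (@lift_left_left n q)).
rewrite -(sum_geo_ext_wt2 (@lift_left_inj n q) _ _ _ _ k1r krl krr).
rewrite del_gamma2 lift_left_setT -/f fL fR fT.
have gM : perm_on [set: 'I_(n.+2 + q)] g' by apply/subsetP => u; rewrite inE.
have gL : stable (left_part n.+2 q) g' by apply: stable_gamma2.
have := @step _ _ _ k1 k k1r krl g' i setT (left_part n.+2 q) gi (in_setT _)
  (lshift_left _ _) gM gL b predT predT (fun _ _ _ _ => erefl) k1s.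
rewrite ![\sum_(s in _ | predT s) _]big_mkcondr /= setTI setTD -rightE => ->.
rewrite -[LHS]addr0 => /addrI/esym.
have rld : rl (remove_point g' i) = (n + q.-1)%N.
  by apply: succn_inj; rewrite -rl_del // rl_gamma2.
have lar : setT :\: left_part n.+2 q = right_part n.+2 q by rewrite setTD rightE.
have giL : g' i \in left_part n.+2 q by rewrite (stableP _ _ gL) lshift_left.
have sdel : stable (left_part n.+2 q) (remove_point g' i) := stable_del i gL.
rewrite (bigD1 (remove_point g' i)) ?geo_id //= big1 ?addr0 => [|s /andP[sg ne]]; last first.
  (* The cycle of [g' i] and [d] are distinct, being on different circles, so [rl s] bounds their
     total size; off the top term this total is smaller and the induction hypothesis applies. *)
  rewrite /step_defect2 big1 // => d; rewrite lar => dR.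
  have sL := geo_stable sg sdel.
  have cL : porbit s (g' i) \in cycs s (left_part n.+2 q) by rewrite cycs_porbit.
  have cd := cycs_pair_neq (leftright_disjoint _ _) cL dR.
  have ds : d \in porbits s by move: dR; rewrite inE => /andP[].
  have dn : (0 < #|d|)%N by rewrite card_gt0 (porbits_n0 ds).
  rewrite /defect2 [splits2 _ _ _ _ _]IH ?subrr ?mul0r ?size_cyc_args //.
  rewrite size_map size_traject; apply: leq_trans lem; rewrite -/n -/q.
  have := geo_rl_lt sg ne; rewrite rld.
  have := rl_two_cycles (porbits_porbit s (g' i)) ds cd.
  move: dn q0; rewrite -/q; move: (rl s) #|d| #|porbit _ _|.-1 => u v w; lia.
have porbL : porbit (gamma2 n.+1 q) (lshift q ord0) = left_part n.+1 q.
  apply/set1P; rewrite -cycs_gamma2_l // cycs_porbit ?lshift_left //.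
  exact: stable_gamma2.
have cl : g' i :: arest (remove_point g' i) (g' i) = [seq f (lshift q u) | u <- enum 'I_n.+1].
  rewrite /arest -del_gamma2 [in X in #|X|]gi1 porbit_ext card_imset; last exact: lift_left_inj.
  rewrite porbL.
  rewrite card_left /= gi1 ext_f prod_perm_l traject_ext traject_gamma2_l.
  by rewrite -map_comp enum_traject.
have agR : {in right_part n.+2 q, remove_point g' i =1 g'}.
  move=> _ /imsetP[u _ ->]; rewrite permM /g' prod_perm_r tpermD // ?eq_lrshift //.
  by rewrite prod_perm_l eq_lrshift.
have gR : stable (right_part n.+2 q) g' by rewrite rightE stableC.
have sdelR : stable (right_part n.+2 q) (remove_point g' i) by rewrite rightE stableC.
(* In the top term each circle is a single cycle, so no other factor accompanies the defect. *)
have spL : left_part n.+2 q :\: ext_orbit g' i (remove_point g' i) = set0.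
  apply/eqP; rewrite setD_eq0; apply/subsetP => _ /imsetP[u _ ->].
  rewrite /ext_orbit in_setU1 (inj_eq (@lshift_inj _ _)).
  case: (unliftP ord0 u) => [v ->|->]; last by rewrite eqxx.
  by rewrite -lift_left_l -del_gamma2 gi1 porbit_ext porbL imset_f ?lshift_left ?orbT.
rewrite /step_defect2 lar setTI spL (cycs_agree agR) // cycs_gamma2_r //.
rewrite big_set1 wt_set0 mul1r setDv big_set0 mulr1 (eq_cyc_args agR (fun _ _ => erefl) sdelR) //.
rewrite args_gamma2_r // br /defect2 cl -map_comp.
have -> : [seq (b \o (fun u => f (lshift q u))) u | u <- enum 'I_n.+1] = y :: l by [].
have El : [seq b u | u <- arest (remove_point g' i) (g' i)] = l.
  by have := congr1 behead (congr1 (map b) cl); rewrite /= -map_comp fbl.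
by rewrite El bi bk => /eqP; rewrite subr_eq0 => /eqP.
Qed.

End SecondOrder.

(** * Splitting all the products *)

Section Separation.
Variable T : finType.
Implicit Types (s K : {perm T}) (N M : {set T}).

Definition sep s N := [forall x in N, forall y in N, (x != y) ==> (y \notin porbit s x)].

Lemma sepP s N : reflect {in N &, forall x y, y \in porbit s x -> x = y} (sep s N).
Proof.
apply: (iffP forall_inP) => [H x y xN yN yx|H x xN].
  have /forall_inP/(_ y yN) := H x xN; rewrite yx implybF negbK => /eqP //.
apply/forall_inP => y yN; apply/implyP; apply: contraNN => yx.
by apply/eqP; apply: H.
Qed.

(** Multiplying by (i j) only inserts the fixed point [i] into the cycle of [j], which does not
    affect whether two other points share a cycle. *)
Lemma porbit_insert K i j x y : K i = i -> x != i -> y != i ->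
  (y \in porbit (K * tperm i j)%g x) = (y \in porbit K x).
Proof.
move=> Ki xi yi; set K' := (K * tperm i j)%g.
have iP : i \notin porbit K x by rewrite porbit_sym (porbit_fix Ki) inE.
have sP : stable (porbit K x) K by apply/stableP => z; apply: mem_porbit_perm.
have sQ : stable (porbit K' x) K' by apply/stableP => z; apply: mem_porbit_perm.
have si : stable [set i] K by apply/stableP => z; rewrite !inE -{1}Ki (inj_eq perm_inj).
apply/idP/idP => [yQ|yP].
  have [jP|jP] := boolP (j \in porbit K x).
    have sP' : stable (i |: porbit K x) K'.
      rewrite stableM ?stable_tperm ?inE ?eqxx ?jP ?orbT //.
      by apply/stableP => z; rewrite !in_setU (stableP _ _ si) (stableP _ _ sP).
    have := stable_porbit sP' yQ; rewrite !in_setU1 porbit_id orbT (negbTE yi) /=.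
    by move=> ->.
  have sP' : stable (porbit K x) K' by rewrite stableM ?stable_tperm ?(negbTE iP) ?(negbTE jP).
  by rewrite (stable_porbit sP' yQ) porbit_id.
have K'i : K' i = j by rewrite permM Ki tpermL.
have EK : K = (K' * tperm i j)%g by rewrite mul_tpermK.
have ij : (i \in porbit K' x) = (j \in porbit K' x) by rewrite -K'i mem_porbit_perm.
have sQ' : stable (porbit K' x) K by rewrite EK stableM ?stable_tperm ?ij.
by rewrite (stable_porbit sQ' yP) porbit_id.
Qed.

(** Reinsertion multiplies the complement by (i j), so a point outside [N] can be erased without
    changing the separation condition. *)
Lemma sep_ins g i j s N : i \notin N -> s i = i ->
  sep (g * (reinsert g i j s)^-1)%g N = sep (remove_point g i * s^-1)%g N.
Proof.
move=> iN si.
have -> : (g * (reinsert g i j s)^-1)%g = (remove_point g i * s^-1 * tperm i j)%g.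
  by rewrite /reinsert !perm_invM !tpermV /remove_point !perm_mulA.
have Ki : (remove_point g i * s^-1)%g i = i by rewrite permM del_fix -{1}si permK.
have ne x : x \in N -> x != i by move=> xN; apply: contraNneq iN => <-.
by apply/sepP/sepP => H x y xN yN yx; apply: H; rewrite // ?porbit_insert ?ne // -(porbit_insert j Ki) ?ne.
Qed.

Lemma sep_id N : sep 1 N.
Proof.
by apply/sepP => x y _ _ /porbitP[n ->]; rewrite expg1n perm1.
Qed.

(** A point and its image share a cycle, so separating all points of the support forces every one of
    them to be fixed. *)
Lemma sep_full K M N : perm_on M K -> M \subset N -> sep K N -> K = 1%g.
Proof.
move=> on /subsetP MN /sepP H; apply/permP => x; rewrite perm1.
have [xM|xM] := boolP (x \in M); last exact: out_perm on xM.
by apply/esym/H; rewrite ?mem_porbit_perm ?porbit_id // MN // perm_closed.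
Qed.

End Separation.

Section Group.
Variables (T : finType) (A : pzRingType) (N : {set T}).
Implicit Types (b : T -> A) (l : seq T).

(* Multiplies the consecutive labels up to each point of [N]. *)
Fixpoint group_prod b l : seq A :=
  if l is x :: l' then
    if x \in N then b x :: group_prod b l'
    else if group_prod b l' is h :: t then b x * h :: t else [::]
  else [::].

Lemma eq_group_prod b b' l : {in l, b =1 b'} -> group_prod b l = group_prod b' l.
Proof.
elim: l => //= x l IH H; rewrite H ?mem_head // IH // => y yl.
by apply: H; rewrite inE yl orbT.
Qed.

Lemma group_prod_all b l : all [in N] l -> group_prod b l = map b l.
Proof. by elim: l => //= x l IH /andP[-> /IH->]. Qed.

Lemma group_prod_merge (b b' : T -> A) u x y v : x \notin N -> b' y = b x * b y ->
  {in u ++ v, b =1 b'} -> group_prod b (u ++ x :: y :: v) = group_prod b' (u ++ y :: v).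
Proof.
move=> xN E; elim: u => [|z u IH] H /=; last first.
  rewrite H ?mem_head // IH // => t tin; apply: H; by rewrite inE tin orbT.
rewrite (negbTE xN) E (eq_group_prod H); case: ifP => // _.
by case: group_prod => // h t; rewrite mulrA.
Qed.

Lemma group_prod_flatten b (Bs : seq (seq T)) :
  {in Bs, forall B, exists u x, [/\ B = rcons u x, x \in N & all [predC N] u]} ->
  group_prod b (flatten Bs) = [seq \prod_(j <- B) b j | B <- Bs].
Proof.
elim: Bs => //= B Bs IH H; rewrite -IH => [|B' B'in]; last by apply: H; rewrite inE B'in orbT.
have [u [x [-> xN]]] := H B (mem_head _ _).
elim: u {H} => [|z u IHu] /=; first by rewrite xN big_seq1.
by case/andP => /negbTE-> /IHu ->; rewrite big_cons.
Qed.

End Group.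

Lemma fcycle_remove (T : finType) (g : {perm T}) u x y v : uniq (u ++ x :: y :: v) ->
  fcycle g (u ++ x :: y :: v) -> g x = y /\ fcycle (remove_point g x) (u ++ y :: v).
Proof.
move=> un cyc.
have cyc2 : fcycle g (x :: y :: v ++ u) by rewrite -(rot_cycle (size u)) rot_size_cat in cyc.
have un2 : uniq (x :: y :: v ++ u) by rewrite -(rot_uniq (size u)) rot_size_cat in un.
have gx : g x = y by have := cyc2 => /= /andP[/eqP].
split => //; rewrite -(rot_cycle (size u)) rot_size_cat.
set l := last y (v ++ u).
have gl : g l = x by have := cyc2 => /= /andP[_]; rewrite rcons_path => /andP[_ /eqP].
(* As [g l = x], conjugation by [g] turns the transposition of [l] and [x] into that of [x] and
   [g x]; [fcycle_cut] then splits off the list made of [x] alone. *)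
have E : g = (tperm l x * remove_point g x)%g.
  by rewrite perm_mulA [(tperm l x * g)%g]conjgC tpermJ gl mul_tpermK.
have un3 : uniq ((y :: v ++ u) ++ [:: x]) by rewrite cats1 -rot1_cons rot_uniq.
have cyc3 : fcycle g ((y :: v ++ u) ++ [:: x]) by rewrite cats1 -rot1_cons rot_cycle.
have := @fcycle_cut _ (remove_point g x) y (v ++ u) x [::] un3.
by rewrite -[last y (v ++ u)]/l -[last x [::]]/x -E cyc3 => /esym/andP[].
Qed.

Section Iterate.

Variables (T : finType) (A : pzRingType) (C : comPzRingType) (N : {set T}).
Variable h : seq A -> C.
Hypotheses (hrot : rot_inv h).
Hypothesis E1 : forall (x y : A) (l : seq A), split1 h x (y :: l) = h (x * y :: l).

Definition cumulant_like (k : seq A -> seq A -> C) :=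
  [/\ forall l, rot_inv (k^~ l), forall l, rot_inv (k l) &
   forall (x y : A) (l z : seq A), (0 < size z)%N ->
     splits2 h k x (y :: l) z = k (x * y :: l) z].

(** Guarantees that a point outside [N] is followed in its list by a point to be merged with. *)
Definition ends_in (l : seq T) := if l is x :: p then last x p \in N else false.

Lemma ends_in_cat u x v : ends_in (u ++ x :: v) = (last x v \in N).
Proof. by case: u => //= z u; rewrite last_cat. Qed.

(** State of the iteration: [s1] and [s2] list in cyclic order the points of the two circles that
    are not yet erased. Points of [N] are never erased. *)
Record circles (M : {set T}) (g : {perm T}) (L : {set T}) (s1 s2 : seq T) : Prop := Circles {
  circles_uniq : uniq (s1 ++ s2);
  circles_l : fcycle g s1;
  circles_r : fcycle g s2;
  circles_on : perm_on M g;
  circles_mem : forall x, (x \in M) = (x \in s1 ++ s2);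
  circles_left : {in s1, forall x, x \in L};
  circles_right : {in s2, forall x, x \notin L};
  circles_end_l : ends_in s1;
  circles_end_r : ends_in s2;
  circles_sub : N \subset M }.

Lemma circles_swap M g L s1 s2 : circles M g L s1 s2 -> circles M g (~: L) s2 s1.
Proof.
case=> un c1 c2 on mem l r e1 e2 sub; split=> //; rewrite 1?uniq_catC //.
- by move=> x; rewrite mem mem_cat orbC -mem_cat.
- by move=> x xs; rewrite in_setC r.
by move=> x xs; rewrite in_setC negbK l.
Qed.

Lemma circles_stable M g L s1 s2 : circles M g L s1 s2 -> stable L g.
Proof.
case=> un c1 c2 on mem l r _ _ _; apply/stableP => x.
have [xM|xM] := boolP (x \in M); last by rewrite (out_perm on).
have next_in s : fcycle g s -> x \in s -> g x \in s.
  by move=> cs xs; rewrite (eqP (next_cycle cs xs : g x == _)) mem_next.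
move: xM; rewrite mem mem_cat => /orP[x1|x2].
  by rewrite !l // next_in.
by rewrite !(negbTE (r _ _)) // next_in.
Qed.

Lemma circles_interL M g L s1 s2 : circles M g L s1 s2 -> M :&: L = [set x in s1].
Proof.
case=> un c1 c2 on mem l r _ _ _; apply/setP => x; rewrite in_setI mem mem_cat in_set.
apply/andP/idP => [[/orP[//|x2]]|x1]; first by rewrite (negbTE (r x x2)).
by rewrite x1 l.
Qed.

Lemma circles_setD M g L s1 s2 : circles M g L s1 s2 -> M :\: L = [set x in s2].
Proof. by move/circles_swap/circles_interL; rewrite -setDE. Qed.

Definition expansion k M g L (b : T -> A) : C :=
  \sum_(s in ann M g L | sep (g * s^-1)%g N) wt h b s M +
  \sum_(s in geo g | sep (g * s^-1)%g N) wt2 h k b s (M :&: L) (M :\: L).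

Lemma expansion_swap k M g L b :
  expansion (fun l1 l2 => k l2 l1) M g (~: L) b = expansion k M g L b.
Proof.
rewrite /expansion; congr (_ + _).
  by apply: eq_bigl => s; rewrite !inE stableC.
by apply: eq_bigr => s _; rewrite wt2_swap setDE setCK -setDE.
Qed.

(** When only points of [N] are left, separating them forces the complement to be the identity, so
    [s = g]; this is geodesic but not annular, and leaves a single term. *)
Lemma expansion_base k M g L s1 s2 b : cumulant_like k -> circles M g L s1 s2 ->
  all [in N] (s1 ++ s2) ->
  k (group_prod N b s1) (group_prod N b s2) = expansion k M g L b.
Proof.
case=> kl kr _ cf; rewrite all_cat => /andP[a1 a2].
have gL := circles_stable cf; have on := circles_on cf.
have MN : M \subset N.
  apply/subsetP => x; rewrite (circles_mem cf) mem_cat => /orP[/(allP a1)|/(allP a2)] //.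
have eqg s : perm_on M s -> sep (g * s^-1)%g N -> s = g.
  move=> ons /(sep_full (perm_onM on (perm_onV ons)) MN) E.
  by rewrite -(perm_divK g s) E perm_mul1g.
rewrite !group_prod_all // /expansion big1 => [|s /andP[]]; last first.
  by rewrite inE => /and3P[ons nst _] /(eqg s ons) E; rewrite E gL in nst.
rewrite add0r (big_pred1 g) => [|s /=]; last first.
  apply/andP/eqP => [[sg]|->]; last by rewrite geo_id mulgV sep_id.
  apply: eqg; apply/subsetP => x; rewrite inE; apply: contraR => xM.
  by apply/eqP/(geo_fix sg)/(out_perm on).
rewrite (circles_interL cf) (circles_setD cf).
have := circles_uniq cf; rewrite cat_uniq => /and3P[u1 _ u2].
have n1 : s1 != [::] by have := circles_end_l cf; case: (s1).
have n2 : s2 != [::] by have := circles_end_r cf; case: (s2).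
have c1 := circles_l cf; have c2 := circles_r cf.
rewrite /wt2 !fcycle_cycs // big_set1 mark1 setDv big_set0 mulr1.
by rewrite (rot_inv_cyc b (kr _) c2 u2) (rot_inv_cyc b (h := k^~ _) (kl _) c1 u1).
Qed.

Lemma circles_remove M g L u x y v s2 : circles M g L (u ++ x :: y :: v) s2 -> x \notin N ->
  g x = y /\ circles (M :\ x) (remove_point g x) L (u ++ y :: v) s2.
Proof.
move=> cf xN; have := circles_uniq cf; rewrite cat_uniq => /and3P[u1 dis u2].
have [gx c1'] := fcycle_remove u1 (circles_l cf); split=> //.
have gL := circles_stable cf.
have xM : x \in M by rewrite (circles_mem cf) mem_cat mem_cat mem_head orbT.
have perm1 : perm_eq (u ++ x :: y :: v) (x :: u ++ y :: v).
  by rewrite -cat1s perm_catCA.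
have un' : uniq (x :: (u ++ y :: v) ++ s2).
  rewrite -cat_cons -(perm_uniq (_ : perm_eq ((u ++ x :: y :: v) ++ s2) _)) ?perm_cat2r //.
  exact: circles_uniq cf.
have /andP[xnot un''] := un'.
split=> //.
- rewrite (fcycle_agree (h := g)) ?(circles_r cf) // => z zs.
  have gz : g z \in s2 by rewrite (eqP (next_cycle (circles_r cf) zs : g z == _)) mem_next.
  have L2 := circles_right cf gz; have L1 := circles_left cf.
  rewrite permM tpermD //; apply: contraNneq L2 => <-; apply: L1.
    by rewrite mem_cat mem_head orbT.
  by rewrite gx mem_cat !inE eqxx !orbT.
- exact: perm_on_del xM (circles_on cf).
- move=> z; rewrite in_setD1 (circles_mem cf) mem_cat (perm_mem perm1) in_cons.
  rewrite -orbA -mem_cat; have [->|//] := eqVneq z x.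
  by rewrite (negbTE xnot).
- move=> z zin; apply: (circles_left cf); rewrite (perm_mem perm1) inE zin orbT //.
- exact: circles_right cf.
- by have := circles_end_l cf; rewrite !ends_in_cat.
- exact: circles_end_r cf.
apply/subsetP => z zN; rewrite in_setD1 (subsetP (circles_sub cf)) // andbT.
by apply: contraNneq xN => <-.
Qed.

Lemma expansion_step k M g L u x y v s2 b : cumulant_like k ->
  circles M g L (u ++ x :: y :: v) s2 -> x \notin N ->
  expansion k M g L b = expansion k (M :\ x) (remove_point g x) L (merge_label g x b).
Proof.
case=> kl kr E2 cf xN; have [gx cf'] := circles_remove cf xN.
have := circles_uniq cf; rewrite cat_uniq => /and3P[u1 dis u2].
have gi : g x != x.
  rewrite gx; move: u1; rewrite cat_uniq => /and3P[_ _ /= /andP[]].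
  by rewrite inE negb_or eq_sym => /andP[].
have gL := circles_stable cf; have on := circles_on cf.
have xM : x \in M by rewrite (circles_mem cf) mem_cat mem_cat mem_head orbT.
have xL : x \in L by apply: (circles_left cf); rewrite mem_cat mem_head orbT.
rewrite /expansion.
rewrite (@step _ _ _ h k hrot kl g x M L gi xM xL on gL b
  (fun s => sep (g * s^-1)%g N) (fun s => sep (remove_point g x * s^-1)%g N)) //; last first.
  move=> s j ons _; apply: sep_ins => //; by have [] := step_perm_on ons.
rewrite [X in _ + _ + X]big1 ?addr0 // => s _; rewrite /step_defect2 big1 // => d dR.
rewrite /defect2 E2 ?subrr ?mul0r // lt0n; exact: args_n0 dR.
Qed.

(** Induction on the number of points left. Points outside [N] are erased from the left circle; when
    it has none, the circles are exchanged. *)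
Lemma expansion_all k M g L s1 s2 b : cumulant_like k ->
  cumulant_like (fun l1 l2 => k l2 l1) -> circles M g L s1 s2 ->
  k (group_prod N b s1) (group_prod N b s2) = expansion k M g L b.
Proof.
have [m] := ubnP (size (s1 ++ s2)); elim: m k M g L s1 s2 b => // m IH k M g L s1 s2 b.
have main k' L' M' g' t1 t2 b' : (size (t1 ++ t2) <= m)%N -> cumulant_like k' ->
    cumulant_like (fun l1 l2 => k' l2 l1) -> circles M' g' L' t1 t2 -> ~~ all [in N] t1 ->
    k' (group_prod N b' t1) (group_prod N b' t2) = expansion k' M' g' L' b'.
  move=> sz ck cks cf; case/allPn => x xt xN; case/splitPr: xt cf sz => u w cf sz.
  case: w cf sz => [|y v] cf sz.
    by have := circles_end_l cf; rewrite ends_in_cat /= (negbTE xN).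
  rewrite (expansion_step _ ck cf xN); have [gx cf'] := circles_remove cf xN.
  rewrite -(IH k' _ _ _ _ _ _ _ ck cks cf'); last first.
    by move: sz; rewrite !size_cat /=; lia.
  have un := circles_uniq cf; have un1 := circles_uniq cf'.
  have perm1 : perm_eq ((u ++ x :: y :: v) ++ t2) (x :: y :: (u ++ v) ++ t2).
    rewrite -[X in perm_eq _ X]/((x :: y :: u ++ v) ++ t2) perm_cat2r.
    by rewrite -[x :: y :: v]/([:: x; y] ++ v) perm_catCA.
  have := un; rewrite (perm_uniq perm1) /= => /and3P[_ ynot _].
  have off z : z != y -> b' z = merge_label g' x b' z.
    by move=> zy; rewrite /merge_label gx (negbTE zy).
  congr (k' _ _).
    apply: group_prod_merge => //; first by rewrite /merge_label gx eqxx.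
    move=> z zin; apply: off; apply: contraNneq ynot => <-.
    by rewrite mem_cat zin.
  apply: eq_group_prod => z zin; apply: off; apply: contraNneq ynot => <-.
  by rewrite mem_cat zin orbT.
rewrite ltnS => sz ck cks cf.
have [a1|n1] := boolP (all [in N] s1); last exact: main.
have [a2|n2] := boolP (all [in N] s2); last first.
  rewrite -expansion_swap -(main (fun l1 l2 => k l2 l1) (~: L) M g s2 s1 b) //.
    by rewrite size_cat addnC -size_cat.
  exact: circles_swap.
by apply: (expansion_base b ck cf); rewrite all_cat a1.
Qed.

End Iterate.

Local Close Scope ring_scope.

(** * The intervals of consecutive factors *)

Section Blocks.

Variables (r s : nat) (n : 'I_(r + s) -> nat).
Hypothesis hn : forall i, 0 < n i.

(** Extending [n] by zero makes the ends of the intervals partial sums indexed by natural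
    numbers. *)
Definition nat_size m : nat := if insub m is Some i then n i else 0.
Definition psum m : nat := \sum_(j < m) nat_size j.

Lemma nat_sizeE (i : 'I_(r + s)) : nat_size i = n i.
Proof. by rewrite /nat_size valK. Qed.

Lemma psumS m : psum m.+1 = psum m + nat_size m.
Proof. by rewrite /psum big_ord_recr. Qed.

Lemma psum_mono m m' : m <= m' -> psum m <= psum m'.
Proof.
move/subnK <-; elim: (m' - m) => // d IH; rewrite addSn psumS.
exact: leq_trans IH (leq_addr _ _).
Qed.

Lemma psum_narrow m : m <= r + s -> \sum_(i < r + s | i < m) n i = psum m.
Proof.
move=> mrs; rewrite /psum (big_ord_widen _ _ mrs); apply: eq_bigr => i _.
by rewrite nat_sizeE.
Qed.

Lemma block_startE k : block_start n k = psum k.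
Proof. by rewrite -psum_narrow // ltnW. Qed.

Lemma block_endE k : block_end n k = psum k.+1.
Proof. by rewrite -psum_narrow. Qed.

Lemma size_lE : size_l n = psum r.
Proof. by apply: eq_bigr => i _; rewrite -nat_sizeE. Qed.

Lemma size_lrE : size_l n + size_r n = psum (r + s).
Proof.
rewrite /psum big_split_ord /=; congr (_ + _); apply: eq_bigr => i _;
by rewrite -nat_sizeE.
Qed.

Local Notation P := (size_l n + size_r n).

Definition block k : seq 'I_P := 
  [seq j : 'I_P <- enum 'I_P | block_start n k <= j < block_end n k].

Lemma filter_iota a m b : a + m <= b -> [seq j <- iota 0 b | a <= j < a + m] = iota a m.
Proof.
move=> le; rewrite -(subnKC le) -addnA !iotaD !filter_cat /=.
have -> : [seq j <- iota 0 a | a <= j < a + m] = [::].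
  by apply/eqP; rewrite -size_eq0 size_filter -leqn0 leqNgt -has_count; apply/hasPn => j;
    rewrite mem_iota; lia.
have -> : [seq j <- iota (0 + a + m) (b - (a + m)) | a <= j < a + m] = [::].
  by apply/eqP; rewrite -size_eq0 size_filter -leqn0 leqNgt -has_count; apply/hasPn => j;
    rewrite mem_iota; lia.
by rewrite cats0; apply/all_filterP/allP => j; rewrite mem_iota; lia.
Qed.

Lemma val_block k : map val (block k) = iota (psum k) (n k).
Proof.
rewrite -(filter_iota (b := P)); last first.
  by rewrite size_lrE -nat_sizeE -psumS psum_mono.
rewrite -val_enum_ord filter_map /block block_startE block_endE psumS nat_sizeE.
by congr map; apply: eq_filter.
Qed.

Lemma flatten_iota u v :
  flatten [seq iota (psum m) (nat_size m) | m <- iota u v] = iota (psum u) (psum (u + v) - psum u).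
Proof.
elim: v u => [|v IH] u; first by rewrite addn0 subnn.
rewrite /= IH psumS -iotaD addSnnS; congr iota.
have := psum_mono (leq_addr v u.+1); rewrite psumS addSnnS; lia.
Qed.

Lemma flatten_block (m u : nat) (f : 'I_m -> 'I_(r + s)) :
  (forall i, f i = u + i :> nat) ->
  map val (flatten [seq block (f i) | i <- enum 'I_m]) = iota (psum u) (psum (u + m) - psum u).
Proof.
move=> fE; rewrite -flatten_iota map_flatten -map_comp; congr flatten.
rewrite -[in RHS](addn0 u) iotaDl -val_enum_ord -!map_comp; apply: eq_map => i /=.
by rewrite val_block -nat_sizeE fE.
Qed.

Lemma enum_left_blocks :
  [seq lshift (size_r n) i | i <- enum 'I_(size_l n)] =
  flatten [seq block (lshift s i) | i <- enum 'I_r].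
Proof.
have p0 : psum 0 = 0 by rewrite /psum big_ord0.
apply: (inj_map val_inj); rewrite (flatten_block (u := 0)) // add0n p0 subn0.
by rewrite -size_lE -val_enum_ord -map_comp; apply: eq_map.
Qed.

Lemma enum_right_blocks :
  [seq rshift (size_l n) i | i <- enum 'I_(size_r n)] =
  flatten [seq block (rshift r i) | i <- enum 'I_s].
Proof.
apply: (inj_map val_inj); rewrite (flatten_block (u := r)) // -size_lrE -size_lE addKn.
by rewrite -[in RHS](addn0 (size_l n)) iotaDl -val_enum_ord -!map_comp; apply: eq_map.
Qed.

Lemma block_endsP (j : 'I_P) : reflect (exists k : 'I_(r + s), j.+1 = psum k.+1) (j \in block_ends n).
Proof.
rewrite inE; apply: (iffP existsP) => -[k]; first by move/eqP; rewrite block_endE; exists k.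
by move=> E; exists k; rewrite block_endE E.
Qed.

(** The ends increase with the index: that of an earlier interval comes before all points of
    [block k], and that of [k] itself or of a later one comes after all points of [u]. *)
Lemma block_rcons k : exists u x, [/\ block k = rcons u x, x \in block_ends n &
  all [predC block_ends n] u].
Proof.
have vb := val_block k; have := hn k; case E: (n k) vb => [//|m] vb _.
move: vb; case/lastP: (block k) => [|u x]; first by [].
rewrite map_rcons -addn1 iotaD cats1 => /rcons_inj[Eu Ex]; exists u, x; split=> //.
  by apply/block_endsP; exists k; rewrite psumS nat_sizeE E addnS -Ex.
apply/allP => j ju /=; apply/negP => /block_endsP[k' E'].
have : val j \in iota (psum k) m by rewrite -Eu map_f.
rewrite mem_iota => /andP[le1 lt2]; move: lt2 le1 => /= lt2 le1.
have [lt|ge] := ltnP k' k.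
  by have := psum_mono lt; rewrite -E'; move: le1; lia.
have := psum_mono (ge : k.+1 <= k'.+1); rewrite -E' [psum k.+1]psumS nat_sizeE E.
by move: lt2; lia.
Qed.

Lemma block_prodE (A : pzRingType) (a : 'I_P -> A) k :
  block_prod a k = (\prod_(j <- block k) a j)%R.
Proof. by rewrite /block_prod /block big_filter enumT [index_enum _]unlock. Qed.

Lemma group_prod_blocks (A : pzRingType) (a : 'I_P -> A) m (f : 'I_m -> 'I_(r + s)) :
  group_prod (block_ends n) a (flatten [seq block (f i) | i <- enum 'I_m]) =
  [seq block_prod a (f i) | i <- enum 'I_m].
Proof.
rewrite group_prod_flatten => [|_ /mapP[i _ ->]]; last exact: block_rcons.
by rewrite -map_comp; apply: eq_map => i; rewrite /= block_prodE.
Qed.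

End Blocks.

Lemma fcycle_gamma n : fcycle (gamma n) (enum 'I_n).
Proof.
case: n => [|n]; first by rewrite (size0nil (size_enum_ord 0)).
have E : iter n.+1 (gamma n.+1) ord0 = ord0.
  by have := iter_porbit (gamma n.+1) ord0; rewrite porbit_gamma cardsT card_ord.
by rewrite enum_traject /= rcons_path fpath_traject last_traject /=; apply/eqP.
Qed.

Lemma fcycle_map (T U : finType) (f : T -> U) (g : {perm T}) (g' : {perm U}) l :
  (forall x, g' (f x) = f (g x)) -> fcycle g l -> fcycle g' (map f l).
Proof.
move=> E; case: l => //= x p; rewrite -map_rcons; elim: (rcons p x) {1 3}x => //= y q IH z.
by case/andP => /eqP <- /IH->; rewrite E eqxx.
Qed.

Lemma ends_in_enum (T : finType) (N : {set T}) m (f : 'I_m -> T) : 0 < m ->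
  (forall i : 'I_m, i.+1 = m -> f i \in N) -> ends_in N [seq f i | i <- enum 'I_m].
Proof.
case: m f => // m f _ H; rewrite enum_ordSr map_rcons -cats1 ends_in_cat /=.
exact: H.
Qed.

Local Open Scope ring_scope.

Lemma moment2_cumulant_like (R : realType) (A : algType R[i]) (phi : A -> R[i])
    (phi2 : A -> A -> R[i]) (hphi : second_order_space phi phi2) (k1 : seq A -> R[i])
    (hk1 : first_order_cumulants phi k1) (k : seq A -> seq A -> R[i]) :
  moment2 phi2 k1 k -> (forall l, k [::] l = 0) -> (forall l, k l [::] = 0) ->
  cumulant_like k1 k.
Proof.
move=> km k0l k0r; split.
- exact: (moment2_rotl hphi hk1 km k0l k0r).
- exact: (moment2_rotr hphi hk1 km k0l k0r).
exact: (splits2_cumulants hphi hk1 km k0l k0r).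
Qed.

Lemma circles_gamma2 p q (N : {set 'I_(p + q)}) : (0 < p)%N -> (0 < q)%N ->
  (forall i : 'I_p, i.+1 = p -> lshift q i \in N) ->
  (forall i : 'I_q, i.+1 = q -> rshift p i \in N) ->
  circles N setT (gamma2 p q) (left_part p q)
    [seq lshift q i | i <- enum 'I_p] [seq rshift p i | i <- enum 'I_q].
Proof.
move=> p0 q0 Nl Nr; split.
- rewrite cat_uniq (map_inj_uniq (@lshift_inj p q)) (map_inj_uniq (@rshift_inj p q)).
  rewrite !enum_uniq andbT /=; apply/hasPn => _ /mapP[i _ ->].
  by apply/mapP => -[j _ /rl_shift_neq].
- by apply: fcycle_map (@fcycle_gamma p) => i; apply: prod_perm_l.
- by apply: fcycle_map (@fcycle_gamma q) => i; apply: prod_perm_r.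
- by apply/subsetP => x _; rewrite inE.
- move=> x; rewrite inE mem_cat; case: (splitOrdP x) => i.
    by rewrite map_f ?mem_enum.
  by rewrite orbC map_f ?mem_enum.
- by move=> _ /mapP[i _ ->]; apply: lshift_left.
- by move=> _ /mapP[i _ ->]; rewrite rshift_left.
- exact: ends_in_enum.
- exact: ends_in_enum.
exact: subsetT.
Qed.

Theorem theorem3 (R : realType) (A : algType R[i])
    (phi : A -> R[i]) (phi2 : A -> A -> R[i])
    (hphi : second_order_space phi phi2)
    (k1 : seq A -> R[i]) (hk1 : first_order_cumulants phi k1)
    (k2 : seq A -> seq A -> R[i]) (hk2 : second_order_cumulants phi2 k1 k2)
    (r s : nat) (hr : (1 <= r)%N) (hs : (1 <= s)%N)
    (n : 'I_(r + s) -> nat) (hn : forall i, (0 < n i)%N)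
    (a : 'I_(size_l n + size_r n) -> A) :
  k2 [seq block_prod a (lshift s i) | i <- enum 'I_r]
     [seq block_prod a (rshift r j) | j <- enum 'I_s]
  = \sum_(x in PSNC (size_l n) (size_r n)
           | separates (gamma2 (size_l n) (size_r n) * x.2^-1)%g (block_ends n))
      kappa_pp k1 k2 a x.
Proof.
(* Rotation invariance is available only once the values on empty lists are set to zero; the two
   functionals agree on all lists that occur. *)
pose k := nonempty2 k2; pose N := block_ends n.
have km : moment2 phi2 k1 k := moment2_cumulants hk2.
have k0l l : k [::] l = 0 by [].
have k0r l : k l [::] = 0 by rewrite /k /nonempty2 orbT.
have ck := moment2_cumulant_like hphi hk1 km k0l k0r.
have cks : cumulant_like k1 (fun l1 l2 => k l2 l1).
  have km' := moment2_swap hphi hk1 km k0l k0r.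
  exact: (moment2_cumulant_like hphi hk1 km' k0r k0l).
have p0 : (0 < size_l n)%N.
  by case: r hr n {a N} hn => // r' _ n hn; rewrite /size_l big_ord_recl ltn_addr.
have q0 : (0 < size_r n)%N.
  by case: s hs n {a N p0} hn => // s' _ n hn; rewrite /size_r big_ord_recl ltn_addr.
have cf : circles N setT (gamma2 (size_l n) (size_r n)) (left_part _ _)
    [seq lshift _ i | i <- enum 'I_(size_l n)] [seq rshift _ i | i <- enum 'I_(size_r n)].
  apply: circles_gamma2 => // i E; apply/block_endsP.
    (* The last point of the left circle ends the interval of index [r.-1], that of the right circle
       the interval of index [(r + s).-1]. *)
    have lt : (r.-1 < r + s)%N by lia.
    by exists (Ordinal lt); rewrite /= E size_lE prednK.
  have lt : ((r + s).-1 < r + s)%N by lia.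
  by exists (Ordinal lt); rewrite /= -addnS E size_lrE prednK // addn_gt0 hr.
have := expansion_all (k1_rot (phi_tracial hphi) hk1)
  (split1_k1 (phi_tracial hphi) hk1) a ck cks cf.
rewrite enum_left_blocks enum_right_blocks !group_prod_blocks //.
have sz m (f : 'I_m -> A) : size [seq f i | i <- enum 'I_m] = m.
  by rewrite size_map size_enum_ord.
(* Both lists of products are nonempty because [r] and [s] are positive, so here [k] is [k2]. *)
rewrite /k {1}/nonempty2 !sz !eqn0Ngt hr hs /= => ->.
rewrite (sum_PSNC k1 k2 a
  (fun t => separates (gamma2 (size_l n) (size_r n) * t^-1)%g N) p0 q0).
rewrite /expansion setTI setTD -rightE; congr (_ + _).
apply: eq_bigr => t _; apply: eq_wt2 => c d cL dR.
by rewrite /k /nonempty2 (negbTE (args_n0 _ cL)) (negbTE (args_n0 _ dR)).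
Qed.
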